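(* Suppose Assumptions (A) and (B) of the context hold. Then for all $x>0$, $$\sup_{v\in\mathbb R^d,\|v\|_2=1}\mathbb P_{A_0}\big(|v^\star(C_T-C_\infty)v|>x\big)\le2\exp\Big(-\frac{x^2\,n\,(1-\exp(-\mathfrak m\Delta_n))\,(x+\mathfrak l_{\max})^{-1}}{8\mathfrak p_0\mathfrak l_{\max}\big(1-\exp(-(n+1)\mathfrak m\Delta_n)\big)}\Big).$$ In particular, when $\Delta_n\to0$, $$\sup_{v\in\mathbb R^d,\|v\|_2=1}\mathbb P_{A_0}\big(|v^\star(C_T-C_\infty)v|>x\big)\le2\exp(-n\Delta_nH_0(x)),\qquad H_0(x)=\frac{\mathfrak m}{8\mathfrak p_0\mathfrak l_{\max}}\,\frac{x^2}{x+\mathfrak l_{\max}}.$$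
   Context: $X$ is the stationary $d$-dimensional Ornstein–Uhlenbeck process $dX_t=-A_0X_tdt+dW_t$, $t\ge0$, $W$ a $d$-dimensional Brownian motion, $A_0\in\mathbb R^{d\times d}$; $\mathbb P_{A_0}$ is its law. $\Delta_n=T/n$, $t_i=i\Delta_n$, and $C_T=\frac1n\sum_{i=1}^nX_{t_{i-1}}X_{t_{i-1}}^\star$ is the empirical covariance ($^\star$ is transposition). (A) $A_0=P_0\,\mathrm{diag}(\tau_1,\dots,\tau_d)P_0^{-1}$ is diagonalizable with (complex) eigenvalues of positive real part; $\mathfrak m:=\min_i\mathrm{Re}(\tau_i)>0$, $\mathfrak p_0:=\|P_0\|_{\mathrm{op}}\|P_0^{-1}\|_{\mathrm{op}}$. The stationary law is $\mathcal N(0,C_\infty)$, $C_\infty=\int_0^\infty e^{-sA_0}e^{-sA_0^\star}ds$. (B) $C_\infty$ is non-degenerate with smallest and largest eigenvalues $0<\mathfrak l_{\min}<\mathfrak l_{\max}<\infty$. *)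

(* Defs.v *)
From HB Require Import structures.
From mathcomp Require Import all_boot all_order all_algebra.
From mathcomp Require Import complex.
From mathcomp Require Import all_classical all_reals all_analysis.

Set Implicit Arguments.
Unset Strict Implicit.
Unset Printing Implicit Defensive.

Import Order.TTheory GRing.Theory Num.Theory.
Import numFieldNormedType.Exports.

Local Open Scope classical_set_scope.
Local Open Scope ring_scope.
Local Open Scope complex_scope.

Definition is_minimum (R : realType) (S : set R) (m : R) : Prop :=
  S m /\ lbound S m.

Definition is_maximum (R : realType) (S : set R) (m : R) : Prop :=
  S m /\ ubound S m.

Section LinearAlgebra.
Variables (R : realType) (d : nat).
Implicit Types (A : 'M[R]_d) (v : 'cV[R]_d) (P : 'M[R[i]]_d) (z : 'cV[R[i]]_d).

Definition l2norm v : R := Num.sqrt (\sum_i v i 0 ^+ 2).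

Definition l2normC z : R :=
  Num.sqrt (\sum_i (complex.Re (z i 0) ^+ 2 + complex.Im (z i 0) ^+ 2)).

Definition op_norm P : R :=
  sup [set l2normC (P *m z) | z in [set z | l2normC z = 1]].

Definition cond_number P : R := op_norm P * op_norm (invmx P).

Definition expmx A : 'M[R]_d :=
  limn (series (fun k => (k`!%:R)^-1 *: A ^+ k)).

Definition stationary_cov A : 'M[R]_d :=
  \matrix_(i, j) \int[lebesgue_measure]_(s in `[0, +oo[)
    (expmx (- s *: A) *m expmx (- s *: A^T)) i j.

(* The diagonalization is over the complex numbers: A is real, but P0 and the
   eigenvalues tau are complex. *)
Definition stable_diagonalizable A P0 (tau : 'rV[R[i]]_d) (m : R) : Prop :=
  [/\ P0 \in unitmx,
      map_mx (fun a : R => a%:C) A = P0 *m diag_mx tau *m invmx P0,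
      is_minimum [set complex.Re (tau 0 i) | i in [set: 'I_d]] m
    & 0 < m].

Definition extreme_eigenvalues A (lmin lmax : R) : Prop :=
  is_minimum [set a | eigenvalue A a] lmin /\
  is_maximum [set a | eigenvalue A a] lmax.

Definition borel_vec : set (set 'cV[R]_d) :=
  <<s [set U : set 'cV[R]_d | open U] >>.

End LinearAlgebra.

(* The case split is needed: [normal_prob 0 0] is not the Dirac mass at 0 (its
   density is conventionally the indicator of [0, 1]). *)
Definition centered_normal (R : realType) (var : R) (B : set R) : \bar R :=
  if var == 0 then \d_(0 : R) B else normal_prob 0 (Num.sqrt var) B.

Section Processes.
Variables (R : realType) (d : nat) (disp : measure_display).
Variables (Omega : measurableType disp) (P : probability Omega R).
Implicit Types (F : R -> set (set Omega)) (Y W X : R -> Omega -> 'cV[R]_d).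

(* Y has law N(0, S): every linear form u^T Y has law N(0, u^T S u). *)
Definition centered_gaussian (Y : Omega -> 'cV[R]_d) (S : 'M[R]_d) : Prop :=
  forall (u : 'cV[R]_d) (B : set R), measurable B ->
    P [set w | B ((u^T *m Y w) 0 0)] = centered_normal ((u^T *m S *m u) 0 0) B.

(* Processes and filtrations are indexed by R; only times t >= 0 matter. *)
Definition filtration F : Prop :=
  [/\ forall t, 0 <= t -> sigma_algebra setT (F t),
      forall t, 0 <= t -> F t `<=` measurable
    & forall s t, 0 <= s -> s <= t -> F s `<=` F t].

Definition adapted F Y : Prop :=
  forall t B, 0 <= t -> borel_vec B -> F t (Y t @^-1` B).

Definition as_continuous Y : Prop :=
  {ae P, forall w, {within `[0, +oo[, continuous (fun t => Y t w)}}.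

Definition brownian_motion F W : Prop :=
  [/\ adapted F W,
      as_continuous W,
      {ae P, forall w, W 0 w = 0},
      forall s t, 0 <= s -> s < t ->
        centered_gaussian (fun w => W t w - W s w) (t - s)%:M
    & forall s t, 0 <= s -> s < t -> forall E B, F s E -> borel_vec B ->
        let D := [set w | B (W t w - W s w)] in P (E `&` D) = (P E * P D)%E].

(* dX_t = - A X_t dt + dW_t in integrated form; since the noise is additive, no
   stochastic integral appears. *)
Definition ou_solution F (A : 'M[R]_d) W X : Prop :=
  [/\ adapted F X,
      as_continuous X
    & {ae P, forall w, forall t, 0 <= t ->
        X t w = X 0 w
                - (\col_i \int[lebesgue_measure]_(s in `[0, t])
                            (A *m X s w) i 0)
                + W t w}].

Definition stationary_ou F (A : 'M[R]_d) W X : Prop :=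
  [/\ filtration F,
      brownian_motion F W,
      ou_solution F A W X
    & centered_gaussian (X 0) (stationary_cov A)].

(* C_T for the sampling times t_i = i T / n. *)
Definition empirical_cov X (T : R) (n : nat) (w : Omega) : 'M[R]_d :=
  n%:R^-1 *: \sum_(1 <= i < n.+1)
    X (i.-1%:R * (T / n%:R)) w *m (X (i.-1%:R * (T / n%:R)) w)^T.

Definition sup_deviation (A : 'M[R]_d) X (T : R) (n : nat) (x : R) : \bar R :=
  ereal_sup
    [set P [set w |
       x < `|(v^T *m (empirical_cov X T n w - stationary_cov A) *m v) 0 0|]
    | v in [set v : 'cV[R]_d | l2norm v = 1]].

End Processes.

(* Main.v *)
Require Import Defs.
From HB Require Import structures.
From mathcomp Require Import all_boot all_order all_algebra.
From mathcomp Require Import complex.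
From mathcomp Require Import all_classical all_reals all_analysis.
From mathcomp Require Import measurable_realfun.
From mathcomp Require Import ring lra zify.

Set Implicit Arguments.
Unset Strict Implicit.
Unset Printing Implicit Defensive.

Import Order.TTheory GRing.Theory Num.Theory.
Import numFieldNormedType.Exports.

Local Open Scope classical_set_scope.
Local Open Scope ring_scope.

(** Fix a unit vector v.  The numbers y_i = v^T X_(t_i), i < n, are jointly
    Gaussian.  If S denotes their covariance matrix, then v^T (C_T - C) v is
    (|y|^2 - tr S) / n, and in an orthonormal eigenbasis of S the square |y|^2
    is a weighted sum of independent chi-square variables.  Hence
      E exp (s (|y|^2 - tr S)) <= exp (s^2 |S|_F^2 / (1 - 2 s lam)),
    where lam bounds the eigenvalues of S and |S|_F is its Frobenius norm, with
    a similar bound for - s ([gaussian_chi2_mgf]).  By the Chernoff inequality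
    the deviation has the Bernstein tail 2 exp (- n x^2 / (4 (F + lam x))) as
    soon as |S|_F^2 <= n F ([deviation_bound]).

    The matrix S is controlled through its rows.  Diagonalizability gives
    |exp (- t A)| <= p0 exp (- m t), so that
      |S i j| <= lmax min (1, p0 exp (- m |t_i - t_j|)),
    and the row sums of S are bounded by geometric sums, of order
    2 p0 lmax / (m Delta).  They bound the eigenvalues of S (Gershgorin), and
    F <= lmax lam because the entries are at most lmax.  Bounding the geometric
    sums crudely gives the first claim.  The second claim asks for a constant
    at least as good as the limiting one, so some room must be found: if
    1 < p0 it comes from the diagonal, where the correlation is 1 and not p0;
    if p0 = 1 it comes from F, because squared correlations decay twice as
    fast.

    The Gaussian nature of y is obtained from the Euler scheme of mesh
    Delta / N driven by the increments of W.  A linear form of the scheme is a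
    form of X_0 plus forms of independent Gaussian increments, so its
    exponential and its cosine have Gaussian expectations
    ([euler_forms_gaussian]).  As N tends to infinity the scheme converges to X
    along almost every path ([euler_path_cvg]), and its covariances converge to
    the stationary ones because C solves the Lyapunov equation
    A C + C A^T = 1 ([lyapunov_equation], [euler_crosscov_limit]).  The lemma of
    Fatou then carries the exponential moments over to X
    ([sampled_chi2_mgf]).  Squares are reduced to linear forms by averaging
    over auxiliary independent Gaussian variables ([mgf_sum_squares_pos],
    [mgf_sum_squares_neg]), so no joint density is ever used. *)

(** * Finite-dimensional linear algebra *)

Section LinAlg.
Variable R : realType.
Local Open Scope complex_scope.

Lemma sum_cauchy_schwarz (I : finType) (a b : I -> R) :
  (\sum_i a i * b i) ^+ 2 <= (\sum_i a i ^+ 2) * (\sum_i b i ^+ 2).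
Proof.
have h : 0 <= \sum_i \sum_j (a i * b j - a j * b i) ^+ 2.
  by apply: sumr_ge0 => i _; apply: sumr_ge0 => j _; exact: sqr_ge0.
have e : \sum_i \sum_j (a i * b j - a j * b i) ^+ 2 =
  2 * ((\sum_i a i ^+ 2) * (\sum_i b i ^+ 2)) - 2 * (\sum_i a i * b i) ^+ 2.
  transitivity (\sum_i \sum_j (a i ^+ 2 * b j ^+ 2)
     + \sum_i \sum_j (b i ^+ 2 * a j ^+ 2)
     - 2 * \sum_i \sum_j ((a i * b i) * (a j * b j))).
    rewrite mulr_sumr -big_split -sumrB /=; apply: eq_bigr => i _.
    rewrite mulr_sumr -big_split -sumrB /=; apply: eq_bigr => j _.
    by ring.
  rewrite expr2 !big_distrlr /=.
  have -> : \sum_i \sum_j b i ^+ 2 * a j ^+ 2 = \sum_i \sum_j a i ^+ 2 * b j ^+ 2.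
    by rewrite exchange_big; apply: eq_bigr => i _; apply: eq_bigr => j _; rewrite mulrC.
  by ring.
by rewrite e in h; lra.
Qed.

(** The complexification is normal, hence unitarily diagonalizable, and its
   eigenvalues are real. *)
Lemma symmetric_has_eigenvalue n (S : 'M[R]_n.+1) : S^T = S ->
  exists r, eigenvalue S r.
Proof.
move=> Ssym; set SC := map_mx (real_complex R) S.
have symSC : SC \is symmetricmx.
  by apply/is_hermitianmxP/matrixP => i j; rewrite expr0 scale1r !mxE -[in LHS]Ssym mxE.
have realSC : SC \is a realmx.
  by apply/mxOverP => i j; rewrite mxE complex_real.
have hermSC := realsym_hermsym symSC realSC.
have /mxOverP real := hermitian_spectral_diag_real hermSC.
have /complex_realP [r Er] := real 0 0.
exists r; rewrite -(eigenvalue_map (real_complex R)).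
apply/eigenvalueP; exists (row 0 (spectralmx SC)).
  have /orthomx_spectralP E := symmetric_normalmx symSC realSC.
  rewrite /= -/SC -row_mul {2}E !mulmxA mulmxV ?spectral_unit// mul1mx.
  by rewrite row_mul row_diag_mx -scalemxAl -rowE Er.
apply/eqP => h0; have := spectral_unit SC.
rewrite unitmxE (_ : \det _ = 0) ?unitr0//.
by rewrite (expand_det_row _ 0) big1// => j _; move/rowP/(_ j) : h0; rewrite !mxE => ->; rewrite mul0r.
Qed.

(** The reflection in the hyperplane orthogonal to e_0 - u exchanges u and e_0;
   it lets an eigenvector be split off by an orthogonal change of basis. *)
Lemma householder n (u : 'cV[R]_n.+1) : (u^T *m u) 0 0 = 1 ->
  exists H : 'M[R]_n.+1, [/\ H^T = H, H *m H = 1%:M & H *m delta_mx 0 0 = u].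
Proof.
move=> u1; have [->|neq] := eqVneq u (delta_mx 0 0).
  by exists 1%:M; rewrite trmx1 !mulmx1 mul1mx.
set e : 'cV[R]_n.+1 := delta_mx 0 0 in neq *.
pose w := e - u; pose c := (w^T *m w) 0 0.
have ww : w^T *m w = c%:M by rewrite [LHS]mx11_scalar.
have uu : u^T *m u = 1%:M by rewrite [LHS]mx11_scalar u1.
have c0 : c != 0.
  apply: contra_neq neq => /eqP; rewrite /c mxE psumr_eq0; last first.
    by move=> i _; rewrite mxE -expr2 sqr_ge0.
  move=> /allP h; apply/esym/eqP; rewrite -subr_eq0; apply/eqP/colP => i.
  have := h i (mem_index_enum _); rewrite mxE mulf_eq0 orbb => /eqP.
  by rewrite -/w => ->; rewrite mxE.
have wT : w^T = e^T - u^T by rewrite /w linearB.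
have we : w^T *m e = (c / 2)%:M.
  have ee : e^T *m e = 1%:M.
    by rewrite [LHS]mx11_scalar trmx_delta mul_delta_mx mxE eqxx.
  have ue : (u^T *m e)^T = e^T *m u by rewrite trmx_mul trmxK.
  have eu : e^T *m u = u^T *m e by rewrite -ue; apply/matrixP => i j; rewrite mxE !ord1.
  have Ec : c%:M = 2 *: (1%:M - u^T *m e).
    rewrite -ww wT /w mulmxBl !mulmxBr ee uu eu.
    by rewrite scalerBr scaler_nat; apply/matrixP => i j; rewrite !mxE; ring.
  rewrite wT mulmxBl ee.
  by rewrite mulrC -scale_scalar_mx Ec scalerA mulVf ?pnatr_eq0// scale1r.
exists (1%:M - (2 / c) *: (w *m w^T)); split.
- by rewrite linearB /= trmx1 linearZ /= trmx_mul trmxK.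
- rewrite mulmxBl mul1mx mulmxBr mulmx1 -scalemxAl -scalemxAr -mulmxA.
  rewrite (mulmxA w^T) ww mul_scalar_mx -scalemxAr !scalerA opprB addrA.
  rewrite -!addrA -scalerBl -scaleNr -scalerDl.
  by rewrite [X in X *: _](_ : _ = 0) ?scale0r ?addr0//; field.
- rewrite mulmxBl mul1mx -scalemxAl -mulmxA we mul_mx_scalar scalerA.
  have -> : 2 / c * (c / 2) = 1 by field.
  by rewrite scale1r /w subKr.
Qed.

(** Induction on the dimension: after a reflection carrying the first basis
   vector to a unit eigenvector, symmetry makes the matrix block diagonal. *)
Theorem real_spectral n (S : 'M[R]_n) : S^T = S ->
  exists (O : 'M[R]_n) (l : 'rV[R]_n),
    O *m O^T = 1%:M /\ S = O^T *m diag_mx l *m O.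
Proof.
elim: n S => [|n IH] S Ssym.
  by exists 1%:M, 0; split; apply/matrixP => -[].
have [r /eigenvalueP [v vS v0]] := symmetric_has_eigenvalue Ssym.
pose s := (v *m v^T) 0 0.
have s0 : 0 < s.
  rewrite /s mxE lt_neqAle eq_sym psumr_neq0 => [|i _]; last first.
    by rewrite mxE -expr2 sqr_ge0.
  rewrite sumr_ge0 ?andbT => [|i _]; last by rewrite mxE -expr2 sqr_ge0.
  have /rV0Pn [i vi] := v0.
  by apply/hasP; exists i; rewrite ?mem_index_enum//= mxE -expr2 exprn_even_gt0.
pose u := (Num.sqrt s)^-1 *: v^T.
have u1 : (u^T *m u) 0 0 = 1.
  have -> : u^T = (Num.sqrt s)^-1 *: v by apply/rowP => i; rewrite !mxE.
  rewrite /u -scalemxAl -scalemxAr scalerA mxE -/s -invfM -expr2.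
  by rewrite sqr_sqrtr ?ltW// mulVf ?gt_eqF.
have Su : S *m u = r *: u.
  rewrite /u -scalemxAr -[S in LHS]Ssym -trmx_mul vS.
  by apply/colP => i; rewrite !mxE mulrCA.
have [H [Hsym HH He]] := householder u1.
have [T defT] : exists T : 'M[R]_(1 + n), T = H *m S *m H by eexists.
have Tsym : T^T = T by rewrite defT !trmx_mul Hsym Ssym mulmxA.
have Te : T *m delta_mx 0 0 = r *: (delta_mx 0 0 : 'cV[R]_(1+n)).
  rewrite defT -[_ *m _ *m delta_mx _ _]mulmxA He -mulmxA Su -scalemxAr -He mulmxA HH.
  by rewrite mul1mx.
have Ti0 i : T i (lshift n 0) = r * (i == lshift n 0)%:R.
  have -> : lshift n 0 = 0 :> 'I_(1 + n) by apply: val_inj.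
  by have /colP/(_ i) := Te; rewrite -colE !mxE eqxx andbT.
have T0 : dlsubmx T = 0.
  by apply/matrixP => i j; rewrite !mxE ord1 Ti0 eq_shift mulr0.
have T1 : ursubmx T = 0.
  by rewrite -[LHS]trmxK trmx_ursub Tsym T0 trmx0.
have T2 : ulsubmx T = r%:M.
  apply/matrixP => i j; rewrite !ord1 !mxE Ti0 eqxx mulr1.
  by rewrite mulr1n.
have S'sym : (drsubmx T)^T = drsubmx T by rewrite trmx_drsub Tsym.
have [U [l' [UU ES']]] := IH _ S'sym.
pose B : 'M[R]_(1 + n) := block_mx 1%:M 0 0 U.
have ET : T = B^T *m diag_mx (row_mx r%:M l') *m B.
  rewrite -[LHS]submxK T0 T1 T2 ES' /B tr_block_mx trmx1 !trmx0 diag_mx_row.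
  rewrite !mulmx_block !(mulmx0, mul0mx, mulmx1, mul1mx, addr0, add0r).
  by congr block_mx; apply/matrixP => i j; rewrite !ord1 !mxE !mulr1n.
have BB : B *m B^T = 1%:M.
  rewrite /B tr_block_mx trmx1 !trmx0.
  rewrite !mulmx_block !(mulmx0, mul0mx, mulmx1, mul1mx, addr0, add0r) UU.
  by rewrite -scalar_mx_block.
exists (B *m H), (row_mx r%:M l'); split.
  by rewrite trmx_mul Hsym mulmxA -(mulmxA B) HH mulmx1.
rewrite trmx_mul Hsym -!mulmxA (mulmxA B^T) (mulmxA (B^T *m _)) -ET defT.
by rewrite !mulmxA HH mul1mx -mulmxA HH mulmx1.
Qed.

End LinAlg.

Section Rayleigh.
Variable R : realType.

Definition sqnorm d (v : 'cV[R]_d) : R := \sum_i v i 0 ^+ 2.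

Lemma sqnormE d (v : 'cV[R]_d) : sqnorm v = (v^T *m v) 0 0.
Proof. by rewrite mxE; apply: eq_bigr => i _; rewrite mxE expr2. Qed.

Lemma sqnorm_ge0 d (v : 'cV[R]_d) : 0 <= sqnorm v.
Proof. by apply: sumr_ge0 => i _; exact: sqr_ge0. Qed.

Lemma l2norm_sqr d (v : 'cV[R]_d) : l2norm v ^+ 2 = sqnorm v.
Proof. by rewrite /l2norm sqr_sqrtr ?sqnorm_ge0. Qed.

Lemma l2norm_ge0 d (v : 'cV[R]_d) : 0 <= l2norm v.
Proof. exact: sqrtr_ge0. Qed.

Lemma dot_le_l2norm d (u v : 'cV[R]_d) :
  `|(u^T *m v) 0 0| <= l2norm u * l2norm v.
Proof.
rewrite -ler_sqr ?nnegrE ?mulr_ge0 ?l2norm_ge0// real_normK ?num_real//.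
rewrite exprMn !l2norm_sqr mxE; under eq_bigr do rewrite mxE.
exact: sum_cauchy_schwarz.
Qed.

Lemma orthogonal_sqnorm d (U : 'M[R]_d) (v : 'cV[R]_d) :
  U *m U^T = 1%:M -> sqnorm (U *m v) = sqnorm v.
Proof.
move=> /mulmx1C UU; rewrite !sqnormE trmx_mul -mulmxA (mulmxA U^T) UU.
by rewrite mul1mx.
Qed.

Lemma spectral_eigenvalue d (S U : 'M[R]_d) (l : 'rV[R]_d) j :
  U *m U^T = 1%:M -> S = U^T *m diag_mx l *m U -> eigenvalue S (l 0 j).
Proof.
move=> UU ->; apply/eigenvalueP; exists (row j U).
  by rewrite -row_mul !mulmxA UU mul1mx row_mul row_diag_mx -scalemxAl -rowE.
apply/eqP => /(congr1 (fun x => (x *m U^T) 0 j)).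
rewrite -row_mul UU mul0mx !mxE eqxx => /eqP.
by rewrite oner_eq0.
Qed.

Lemma quad_diag d (l : 'rV[R]_d) (y : 'cV[R]_d) :
  (y^T *m diag_mx l *m y) 0 0 = \sum_j l 0 j * y j 0 ^+ 2.
Proof.
rewrite mxE; apply: eq_bigr => j _.
by rewrite mul_mx_diag !mxE; ring.
Qed.

Lemma rayleigh_le d (S : 'M[R]_d) (lmin lmax : R) (v : 'cV[R]_d) :
  S^T = S -> extreme_eigenvalues S lmin lmax ->
  (v^T *m S *m v) 0 0 <= lmax * sqnorm v.
Proof.
move=> /real_spectral[U [l [UU ES]]] [_ [_ ub]].
have -> : (v^T *m S *m v) 0 0 = ((U *m v)^T *m diag_mx l *m (U *m v)) 0 0.
  by rewrite ES trmx_mul !mulmxA.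
rewrite quad_diag -(orthogonal_sqnorm v UU) mulr_sumr.
apply: ler_sum => j _; rewrite ler_wpM2r ?sqr_ge0//.
by apply: ub => /=; exact: spectral_eigenvalue ES.
Qed.

Lemma rayleigh_l2norm_le d (S : 'M[R]_d) (lmin lmax : R) (v : 'cV[R]_d) :
  S^T = S -> extreme_eigenvalues S lmin lmax -> 0 <= lmin ->
  l2norm (S *m v) <= lmax * l2norm v.
Proof.
move=> /real_spectral[U [l [UU ES]]] [[_ lb] [eigmax ub]] lmin0.
have lmax0 : 0 <= lmax by apply: (le_trans lmin0); exact: lb.
rewrite -ler_sqr ?nnegrE ?mulr_ge0 ?l2norm_ge0// exprMn !l2norm_sqr.
have UTU : U^T *m U^T^T = 1%:M by rewrite trmxK; exact: mulmx1C.
rewrite ES -!mulmxA (orthogonal_sqnorm _ UTU) -(orthogonal_sqnorm v UU).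
rewrite mulr_sumr; apply: ler_sum => j _.
rewrite mul_diag_mx mxE exprMn ler_wpM2r ?sqr_ge0//.
have ev := spectral_eigenvalue j UU ES.
by rewrite ler_sqr ?nnegrE// ?ub// (le_trans lmin0)// lb.
Qed.

End Rayleigh.

Section OpNorm.
Variables (R : realType) (d : nat).
Implicit Types (P : 'M[R[i]]_d) (z : 'cV[R[i]]_d).
Local Open Scope complex_scope.
Local Notation nrm := (@ComplexField.Normc.normc R).

Let sqC (c : R[i]) : R := complex.Re c ^+ 2 + complex.Im c ^+ 2.

Let sqCE c : sqC c = nrm c ^+ 2.
Proof. by case: c => a b; rewrite /sqC /= sqr_sqrtr// addr_ge0 ?sqr_ge0. Qed.

Let sqCM (a b : R[i]) : sqC (a * b) = sqC a * sqC b.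
Proof. by case: a => a a'; case: b => b b'; rewrite /sqC /=; ring. Qed.

Let sqC_ge0 c : 0 <= sqC c. Proof. by rewrite sqCE sqr_ge0. Qed.

Let nrm_ge0 c : 0 <= nrm c. Proof. by case: c => a b; exact: sqrtr_ge0. Qed.

Lemma l2normC_ge0 z : 0 <= l2normC z. Proof. exact: sqrtr_ge0. Qed.

Let l2normC_sqr z : l2normC z ^+ 2 = \sum_i sqC (z i 0).
Proof. by rewrite /l2normC sqr_sqrtr// sumr_ge0// => i _; exact: sqC_ge0. Qed.

Lemma l2normC_real (v : 'cV[R]_d) :
  l2normC (map_mx (real_complex R) v) = l2norm v.
Proof.
by congr Num.sqrt; apply: eq_bigr => i _; rewrite mxE /= expr0n addr0.
Qed.

Lemma l2normC_diag_le (t : 'rV[R[i]]_d) (r : R) z : 0 <= r ->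
  (forall i, complex.Re (t 0 i) ^+ 2 + complex.Im (t 0 i) ^+ 2 <= r ^+ 2) ->
  l2normC (diag_mx t *m z) <= r * l2normC z.
Proof.
move=> r0 tr; rewrite -ler_sqr ?nnegrE ?mulr_ge0 ?l2normC_ge0//.
rewrite exprMn !l2normC_sqr mulr_sumr; apply: ler_sum => i _.
by rewrite mul_diag_mx mxE sqCM ler_wpM2r// ; exact: tr.
Qed.

Lemma l2normCZ (c : R) z : 0 <= c -> l2normC (c%:C *: z) = c * l2normC z.
Proof.
move=> c0; apply/eqP; rewrite -(@eqrXn2 _ 2) ?mulr_ge0 ?l2normC_ge0//.
rewrite exprMn !l2normC_sqr mulr_sumr; apply/eqP/eq_bigr => i _.
by rewrite mxE sqCM; congr (_ * _); rewrite /sqC /=; ring.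
Qed.

Lemma l2normC_eq0 z : l2normC z = 0 -> z = 0.
Proof.
move=> /(congr1 (fun x => x ^+ 2)); rewrite l2normC_sqr expr0n /=.
move=> /eqP; rewrite psumr_eq0 => [|i _]; last exact: sqC_ge0.
move=> /allP h; apply/colP => i; have := h i (mem_index_enum _).
rewrite mxE /= sqCE expf_eq0 /= => /eqP.
exact: ComplexField.Normc.eq0_normc.
Qed.

Let op_set P := [set l2normC (P *m z) | z in [set z | l2normC z = 1]].

Let op_set_bounded P : has_ubound (op_set P).
Proof.
pose B := \sum_i (\sum_j nrm (P i j)) ^+ 2.
have B0 : 0 <= B by apply: sumr_ge0 => i _; exact: sqr_ge0.
exists (Num.sqrt B) => _ /= [z z1 <-].
rewrite -ler_sqr ?nnegrE ?l2normC_ge0 ?sqrtr_ge0// l2normC_sqr sqr_sqrtr//.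
apply: ler_sum => i _; rewrite sqCE.
have zj j : nrm (z j 0) <= 1.
  rewrite -ler_sqr ?nnegrE// expr1n -[X in _ <= X](expr1n _ 2) -z1 l2normC_sqr.
  rewrite (bigD1 j)//= -sqCE lerDl sumr_ge0// => k _; exact: sqC_ge0.
rewrite ler_sqr ?nnegrE ?sumr_ge0// mxE.
apply: (@le_trans _ _ (\sum_j nrm (P i j * z j 0))).
  elim/big_ind2: _ => [|a b a' b' h h'|//]; first by rewrite ComplexField.Normc.normc0.
  by apply: (le_trans (le_normcD _ _)); exact: lerD.
apply: ler_sum => j _; rewrite ComplexField.Normc.normcM.
by rewrite -[leRHS]mulr1 ler_wpM2l.
Qed.

Lemma op_normP P z : l2normC (P *m z) <= op_norm P * l2normC z.
Proof.
have [z0|z0] := eqVneq (l2normC z) 0.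
  by rewrite (l2normC_eq0 z0) mulmx0 -(l2normC_eq0 z0) z0 mulr0.
have zp : 0 < l2normC z by rewrite lt_def z0 l2normC_ge0.
rewrite -ler_pdivrMr//.
have -> : l2normC (P *m z) / l2normC z = l2normC (P *m (((l2normC z)^-1)%:C *: z)).
  by rewrite -scalemxAr l2normCZ ?invr_ge0 ?l2normC_ge0// mulrC.
apply: (ub_le_sup (op_set_bounded P)) => /=; exists (((l2normC z)^-1)%:C *: z) => //.
by rewrite /= l2normCZ ?invr_ge0 ?l2normC_ge0// mulVf.
Qed.

Let l2normC_delta (i0 : 'I_d) : l2normC (delta_mx i0 0 : 'cV[R[i]]_d) = 1.
Proof.
apply/eqP; rewrite -(@eqrXn2 _ 2) ?l2normC_ge0// l2normC_sqr expr1n.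
rewrite (bigD1 i0)//= big1 ?addr0 => [|j /negPf ji]; rewrite mxE.
    by rewrite !eqxx /sqC /= expr1n expr0n addr0.
by rewrite ji /= /sqC /= expr0n addr0.
Qed.

Lemma op_norm_ge0 (i0 : 'I_d) P : 0 <= op_norm P.
Proof.
have := op_normP P (delta_mx i0 0); rewrite l2normC_delta mulr1.
exact/le_trans/l2normC_ge0.
Qed.

Lemma cond_number_ge1 (i0 : 'I_d) P : P \in unitmx -> 1 <= cond_number P.
Proof.
move=> uP; have e1 := l2normC_delta i0; rewrite -e1 -{1}[delta_mx i0 0](mulKVmx uP).
apply: (le_trans (op_normP _ _)); rewrite /cond_number ler_wpM2l ?op_norm_ge0//.
by have := op_normP (invmx P) (delta_mx i0 0); rewrite e1 mulr1.
Qed.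

(** The eigenvalues of 1 - h A satisfy
   |1 - h tau|^2 = 1 - 2 h Re tau + h^2 |tau|^2 <= exp (- 2 m h + K h^2),
   and diagonalizing costs the condition number once, whatever the exponent. *)
Lemma euler_contraction (A : 'M[R]_d) P (tau : 'rV[R[i]]_d) (m : R) :
  stable_diagonalizable A P tau m ->
  exists2 K, 0 <= K & forall h k (v : 'cV[R]_d), 0 <= h ->
    l2norm ((1 - h *: A) ^+ k *m v)
    <= cond_number P * expR (- (m * h * k%:R) + K * h ^+ 2 * k%:R) * l2norm v.
Proof.
move=> [uP EA [_ lbm] m0].
case: (posnP d) => [d0|dpos].
  exists 0 => // h k v h0.
  have E0 (w : 'cV[R]_d) : l2norm w = 0.
    by rewrite /l2norm big1 ?sqrtr0// => i; exfalso; move: (i) => [j]; rewrite d0.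
  by rewrite !E0 mulr0.
have i0 := Ordinal dpos.
exists (\sum_i sqC (tau 0 i)) => [|h k v h0]; first by apply: sumr_ge0 => i _; exact: sqC_ge0.
set K := \sum_i _; pose t : 'rV[R[i]]_d := \row_i (1 - h%:C * tau 0 i).
have EG j : map_mx (real_complex R) ((1 - h *: A) ^+ j) =
    P *m diag_mx (\row_i (t 0 i) ^+ j) *m invmx P.
  elim: j => [|j IH].
    rewrite expr0 map_mx1 (_ : diag_mx _ = 1%:M) ?mulmx1 ?mulmxV//.
    by rewrite -diag_const_mx; congr diag_mx; apply/rowP => i; rewrite !mxE expr0.
  rewrite exprS -mulmxE map_mxM IH !rmorphB /= map_mx1.
  have -> : map_mx (real_complex R) (h *: A) = h%:C *: (P *m diag_mx tau *m invmx P).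
    by rewrite map_mxZ -EA; congr (_ *: _); apply/matrixP => a b; rewrite !mxE.
  have -> : 1%:M - h%:C *: (P *m diag_mx tau *m invmx P) = P *m diag_mx t *m invmx P.
    have -> : diag_mx t = 1%:M - h%:C *: diag_mx tau.
      rewrite -diag_const_mx -linearZ -linearB /=; congr diag_mx.
      by apply/rowP => i; rewrite !mxE.
    by rewrite mulmxBr mulmxBl mulmx1 mulmxV// -scalemxAr -scalemxAl.
  rewrite !mulmxA mulmxKV// -(mulmxA P) mulmx_diag; congr (_ *m diag_mx _ *m _).
  by apply/rowP => i; rewrite !mxE exprS.
set r := expR _.
rewrite -!l2normC_real map_mxM EG -!mulmxA.
apply: (le_trans (op_normP _ _)).
rewrite /cond_number -!mulrA ler_wpM2l ?op_norm_ge0//.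
rewrite mulrCA.
apply: (@le_trans _ _ (r * l2normC (invmx P *m map_mx (real_complex R) v))); last first.
  by rewrite ler_wpM2l ?expR_ge0// op_normP.
apply: l2normC_diag_le; first exact: expR_ge0.
move=> i; rewrite mxE -/(sqC _).
have -> : sqC (t 0 i ^+ k) = sqC (t 0 i) ^+ k.
  elim: (k) => [|j IH]; first by rewrite !expr0 /sqC /= expr1n expr0n addr0.
  by rewrite !exprS sqCM IH.
have ht : sqC (t 0 i) <= expR (- (2 * m * h) + 2 * K * h ^+ 2).
  apply: le_trans (expR_ge1Dx _).
  have Ki : sqC (tau 0 i) <= K.
    by rewrite /K (bigD1 i)//= lerDl sumr_ge0// => j _; exact: sqC_ge0.
  have mi : m <= complex.Re (tau 0 i) by apply: lbm; exists i.
  have -> : sqC (t 0 i) = 1 - 2 * h * complex.Re (tau 0 i) + h ^+ 2 * sqC (tau 0 i).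
    by rewrite mxE /sqC; case: (tau 0 i) => a b /=; ring.
  have := sqC_ge0 (tau 0 i) => s0.
  have h2 : 0 <= h ^+ 2 := sqr_ge0 _.
  have a1 : h ^+ 2 * sqC (tau 0 i) <= h ^+ 2 * K by rewrite ler_wpM2l.
  have a2 : h * m <= h * complex.Re (tau 0 i) by rewrite ler_wpM2l.
  have a3 : 0 <= h ^+ 2 * K by rewrite mulr_ge0// (le_trans s0).
  by lra.
apply: (@le_trans _ _ (expR (- (2 * m * h) + 2 * K * h ^+ 2) ^+ k)).
  by rewrite lerXn2r ?nnegrE ?expR_ge0.
rewrite -expRM_natl -expRM_natl.
by rewrite ler_expR le_eqVlt; apply/orP; left; apply/eqP; ring.
Qed.

End OpNorm.

(** * The matrix exponential and the Lyapunov equation *)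

Section EntryNorm.
Variable R : realType.

Definition l1norm m n (M : 'M[R]_(m, n)) : R := \sum_i \sum_j `|M i j|.

Lemma l1norm_ge0 m n (M : 'M[R]_(m, n)) : 0 <= l1norm M.
Proof. by apply: sumr_ge0 => i _; apply: sumr_ge0. Qed.

Lemma entry_le_l1norm m n (M : 'M[R]_(m, n)) i j : `|M i j| <= l1norm M.
Proof.
rewrite /l1norm (bigD1 i)//= (bigD1 j)//= -addrA lerDl addr_ge0 ?sumr_ge0// => k _.
exact: sumr_ge0.
Qed.

Lemma l1normD m n (M N : 'M[R]_(m, n)) : l1norm (M + N) <= l1norm M + l1norm N.
Proof.
rewrite /l1norm -big_split; apply: ler_sum => i _.
by rewrite -big_split; apply: ler_sum => j _; rewrite mxE ler_normD.
Qed.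

Lemma l1normZ m n (a : R) (M : 'M[R]_(m, n)) : l1norm (a *: M) = `|a| * l1norm M.
Proof.
rewrite /l1norm mulr_sumr; apply: eq_bigr => i _.
by rewrite mulr_sumr; apply: eq_bigr => j _; rewrite mxE normrM.
Qed.

Lemma l1normN m n (M : 'M[R]_(m, n)) : l1norm (- M) = l1norm M.
Proof. by rewrite -scaleN1r l1normZ normrN normr1 mul1r. Qed.

Lemma l1normM m n p (M : 'M[R]_(m, n)) (N : 'M[R]_(n, p)) :
  l1norm (M *m N) <= l1norm M * l1norm N.
Proof.
rewrite /l1norm mulr_suml; apply: ler_sum => i _.
apply: (@le_trans _ _ (\sum_j \sum_k `|M i k| * `|N k j|)).
  apply: ler_sum => j _; rewrite mxE; apply: (le_trans (ler_norm_sum _ _ _)).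
  by apply: ler_sum => k _; rewrite normrM.
rewrite exchange_big mulr_suml /=; apply: ler_sum => k _.
rewrite -mulr_sumr ler_wpM2l// (bigD1 k)//= lerDl sumr_ge0// => l _.
exact: sumr_ge0.
Qed.

Lemma l1norm_tr m n (M : 'M[R]_(m, n)) : l1norm M^T = l1norm M.
Proof.
rewrite /l1norm exchange_big; apply: eq_bigr => i _; apply: eq_bigr => j _.
by rewrite mxE.
Qed.

End EntryNorm.

Section MatrixExponential.
Variables (R : realType) (d : nat).
Implicit Types A B : 'M[R]_d.

(** Domination by an exponential series is stable under formal
   differentiation, which is what term by term differentiation requires. *)
Let exp_bounded (M a : R) (c : nat -> R) := forall k, `|c k| <= M * a ^+ k / k`!%:R.

Let exp_bounded_cvg M a c x : exp_bounded M a c -> 0 <= M -> 0 <= a ->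
  cvgn (pseries c x).
Proof.
move=> cM M0 a0; apply: normed_cvg.
apply: (@series_le_cvg _ _ (fun k => M * exp_coeff (a * `|x|) k)) => //.
- by move=> k; exact: normr_ge0.
- by move=> k; rewrite mulr_ge0// exp_coeff_ge0// mulr_ge0.
- move=> k; rewrite /= normrM normrX /exp_coeff/= exprMn.
  rewrite [leRHS](_ : _ = M * a ^+ k / k`!%:R * `|x| ^+ k); last by ring.
  by rewrite ler_wpM2r// exprn_ge0.
- exact/is_cvg_seriesZ/is_cvg_series_exp_coeff.
Qed.

Let exp_bounded_diffs M a c : exp_bounded M a c ->
  exp_bounded (M * a) a (pseries_diffs c).
Proof.
move=> cM k; rewrite /pseries_diffs normrM ger0_norm//.
have k0 : k.+1%:R != 0 :> R by rewrite pnatr_eq0.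
have kf0 : k`!%:R != 0 :> R by rewrite pnatr_eq0 -lt0n fact_gt0.
rewrite [leRHS](_ : _ = k.+1%:R * (M * a ^+ k.+1 / k.+1`!%:R)).
  by rewrite ler_wpM2l.
rewrite factS natrM exprS; move: (k.+1%:R) (k`!%:R) k0 kf0 => u w u0 w0.
by field; rewrite ?u0 ?w0.
Qed.

Let coef A i j k := (A ^+ k) i j / k`!%:R.

Let coef_bounded A i j : exp_bounded (l1norm (1 : 'M[R]_d)) (l1norm A) (coef A i j).
Proof.
move=> k; rewrite /coef normrM [X in _ * X]ger0_norm ?invr_ge0// ler_wpM2r ?invr_ge0//.
apply: (le_trans (entry_le_l1norm _ _ _)).
elim: k => [|k IH]; first by rewrite !expr0 mulr1.
rewrite !exprS mulrCA; apply: (le_trans (l1normM _ _)).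
by rewrite ler_wpM2l ?l1norm_ge0.
Qed.

Let coef_cvg A i j x : cvgn (pseries (coef A i j) x).
Proof.
by apply: exp_bounded_cvg (coef_bounded _ _ _) _ _; exact: l1norm_ge0.
Qed.

Let diffs_coef A i j x :
  limn (pseries (pseries_diffs (coef A i j)) x) =
  \sum_l A i l * limn (pseries (coef A l j) x).
Proof.
apply/cvg_lim => //.
have -> : pseries (pseries_diffs (coef A i j)) x =
    (fun n => \sum_l A i l * pseries (coef A l j) x n).
  apply/funext => n; rewrite /pseries/= /series/=.
  under [RHS]eq_bigr do rewrite mulr_sumr.
  rewrite exchange_big; apply: eq_bigr => k _ /=.
  rewrite /pseries_diffs /coef exprS mxE factS natrM.
  rewrite mulr_suml mulr_sumr mulr_suml; apply: eq_bigr => l _.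
  have kf0 : k`!%:R != 0 :> R by rewrite pnatr_eq0 -lt0n fact_gt0.
  have k0 : k.+1%:R != 0 :> R by rewrite pnatr_eq0.
  move: (k.+1%:R) (k`!%:R) k0 kf0 => u w u0 w0.
  by field; rewrite ?u0 ?w0.
by apply: (cvg_big add_continuous) => l _; apply: cvgMr; exact: coef_cvg.
Qed.

Let scaled_exp A x k : (x *: A) ^+ k = x ^+ k *: A ^+ k.
Proof.
elim: k => [|k IH]; first by rewrite !expr0 scale1r.
by rewrite !exprS IH -!mulmxE -scalemxAl -scalemxAr scalerA.
Qed.

Let expmxE A x i j : expmx (x *: A) i j = limn (pseries (coef A i j) x).
Proof.
pose L := \matrix_(i, j) limn (pseries (coef A i j) x).
suff -> : expmx (x *: A) = L by rewrite mxE.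
rewrite /expmx; apply/cvg_lim; first exact: norm_hausdorff.
move=> V [/= V' nV' sV]; rewrite /nbhs/=.
near=> n; apply: sV => a b.
have -> : series (fun k : nat => (k`!%:R)^-1 *: (x *: A) ^+ k) n a b =
    pseries (coef A a b) x n.
  rewrite /pseries /series/= summxE; apply: eq_bigr => k _.
  by rewrite scaled_exp !mxE /coef; ring.
move: a b; near: n; apply: filter_forall => a; apply: filter_forall => b.
have := nV' a b; rewrite mxE => nVab.
have cv : pseries (coef A a b) x @ \oo --> limn (pseries (coef A a b) x).
  exact: coef_cvg.
exact: (cv _ nVab).
Unshelve. all: by end_near. Qed.

Lemma is_derive_bigsum (n : nat) (f : 'I_n -> R -> R) (x : R) (l : 'I_n -> R) :
  (forall i, is_derive x 1 (f i) (l i)) ->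
  is_derive x 1 (fun y => \sum_i f i y) (\sum_i l i).
Proof.
move=> fl; have := is_derive_sum fl.
rewrite (_ : \sum_(i < n) f i = fun y => \sum_i f i y)//.
by apply/funext => y; rewrite fct_sumE.
Qed.

(** Every entry of the exponential is a power series in the time. *)
Lemma is_derive_expmx A (x : R) i j :
  is_derive x 1 (fun y : R => expmx (y *: A) i j) ((A *m expmx (x *: A)) i j).
Proof.
under eq_fun do rewrite expmxE.
rewrite mxE; under eq_bigr do rewrite expmxE.
rewrite -diffs_coef.
have b0 := coef_bounded A i j; have b1 := exp_bounded_diffs b0.
have b2 := exp_bounded_diffs b1.
apply: (@pseries_snd_diffs _ _ (`|x| + 1)).
- by apply: exp_bounded_cvg b0 _ _; rewrite ?mulr_ge0 ?l1norm_ge0.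
- by apply: exp_bounded_cvg b1 _ _; rewrite ?mulr_ge0 ?l1norm_ge0.
- by apply: exp_bounded_cvg b2 _ _; rewrite ?mulr_ge0 ?l1norm_ge0.
- by rewrite [ltRHS]ger0_norm ?addr_ge0// ltrDl.
Qed.

Lemma expmx_tr A x : expmx (x *: A^T) = (expmx (x *: A))^T.
Proof.
have trX k : (A^T) ^+ k = (A ^+ k)^T.
  elim: k => [|k IH]; first by rewrite !expr0 trmx1.
  by rewrite exprSr IH exprS -!mulmxE trmx_mul.
apply/matrixP => i j; rewrite [RHS]mxE !expmxE; congr (limn (pseries _ x)).
by apply/funext => k; rewrite /coef trX mxE.
Qed.

Lemma expmx0 A : expmx (0 *: A) = 1%:M.
Proof.
apply/matrixP => i j; rewrite expmxE; apply/cvg_lim => //.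
apply: cvg_near_cst.
near=> n; have n0 : (0 < n)%N by near: n; exact: nbhs_infty_gt.
rewrite /pseries /series/= -(prednK n0) big_nat_recl//= big1 => [|k _].
  by rewrite addr0 /coef !expr0 mulr1 divr1.
by rewrite expr0n mulr0.
Unshelve. all: by end_near. Qed.

Lemma is_derive_expmx_form A (p : 'rV[R]_d) (v : 'cV[R]_d) (x : R) :
  is_derive x 1 (fun y : R => (p *m expmx (y *: A) *m v) 0 0)
    ((p *m A *m expmx (x *: A) *m v) 0 0).
Proof.
have E M : (p *m M *m v) 0 0 = \sum_i \sum_j (p 0 j * v i 0) * M j i.
  rewrite mxE; apply: eq_bigr => i _; rewrite mxE mulr_suml.
  by apply: eq_bigr => j _; rewrite mulrAC.
under eq_fun do rewrite E.
rewrite -(mulmxA p) E; apply: is_derive_bigsum => i; apply: is_derive_bigsum => j.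
have h := is_derive_expmx A x j i.
exact: is_deriveZ.
Qed.

End MatrixExponential.

Section ExponentialDecay.
Variable R : realType.
Notation mu := (@lebesgue_measure R).

Lemma is_derive_continuous (f g : R -> R) :
  (forall s : R, is_derive s 1 f (g s)) -> continuous f.
Proof.
move=> fg s; apply/differentiable_continuous/derivable1_diffP.
by apply: ex_derive; exact: fg.
Qed.

Lemma is_derive_expRM (k c s : R) :
  is_derive s 1 (fun t => k * expR (c * t)) (k * (c * expR (c * s))).
Proof.
have D : is_derive s 1 (fun t : R => c * t) (c * 1).
  exact: (is_deriveZ c (is_derive_id s 1)).
have := is_deriveZ k (is_derive1_comp (is_derive_expR (c * s)) D).
by rewrite mulr1 [expR _ * c]mulrC.
Qed.

Lemma cvg_expR_decay (K k : R) : 0 < k ->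
  K * expR (- k * s) @[s --> +oo] --> 0.
Proof.
move=> k0; rewrite -[X in _ --> X](mulr0 K); apply: cvgMr.
have h : k * s @[s --> +oo] --> +oo by apply: gt0_cvgMry => //; exact: cvg_id.
have := cvg_comp _ _ h (@cvgr_expR R).
by apply: cvg_trans; apply: near_eq_cvg; apply: nearW => s /=; rewrite mulNr.
Qed.

Let exp_decay_integral (K k : R) : 0 < k -> 0 <= K ->
  (\int[mu]_(s in `[0%R, +oo[) (K * expR (- k * s))%:E = (K / k)%:E)%E.
Proof.
move=> k0 K0.
pose F (s : R) := - (K / k) * expR (- k * s).
have dF (s : R) : is_derive s 1 F (K * expR (- k * s)).
  apply: (is_derive_eq (is_derive_expRM _ _ _)).
  by field; rewrite gt_eqF.
rewrite (@ge0_continuous_FTC2y _ _ F 0 0).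
- by rewrite /F mulr0 expR0 mulr1 -EFinB sub0r opprK.
- by move=> s _; rewrite mulr_ge0 ?expR_ge0.
- apply: continuous_subspaceT.
  exact: is_derive_continuous (is_derive_expRM _ _).
- exact: cvg_expR_decay.
- by move=> s _; apply: ex_derive; exact: dF.
- apply: cvg_at_right_filter; exact: (is_derive_continuous dF).
- by move=> s _; rewrite derive1E; apply: derive_val.
Qed.

Let continuous_measurable_EFin (D : set R) (f : R -> R) : continuous f ->
  measurable_fun D (fun s => (f s)%:E).
Proof.
move=> cf; apply: (@measurable_funTS _ _ _ _ D).
by apply/measurable_EFinP; exact: continuous_measurable_fun.
Qed.

Lemma exp_decay_integrable (f : R -> R) (K k : R) : 0 < k -> 0 <= K ->
  continuous f -> (forall s, 0 <= s -> `|f s| <= K * expR (- k * s)) ->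
  mu.-integrable `[0%R, +oo[ (EFin \o f).
Proof.
move=> k0 K0 cf fK.
apply: (@le_integrable _ _ _ mu _ _ _ (fun s => (K * expR (- k * s))%:E)) => //.
- exact: continuous_measurable_EFin.
- move=> s /=; rewrite in_itv/= andbT => s0.
  by rewrite lee_fin (le_trans (fK _ s0))// ler_norm.
apply/integrableP; split.
  apply: continuous_measurable_EFin.
  exact: is_derive_continuous (is_derive_expRM _ _).
under eq_integral do rewrite gee0_abs ?lee_fin ?mulr_ge0 ?expR_ge0//.
by rewrite exp_decay_integral// ltry.
Qed.

(** Adding K exp (- k s), which dominates |f|, makes the integrand nonnegative,
   so that the monotone form of the theorem applies on the half-line. *)
Lemma exp_decay_FTC (f F : R -> R) (K k : R) : 0 < k -> 0 <= K ->
  (forall s : R, is_derive s 1 F (f s)) -> continuous f ->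
  (forall s, 0 <= s -> `|f s| <= K * expR (- k * s)) ->
  (forall s, 0 <= s -> `|F s| <= K * expR (- k * s)) ->
  \int[mu]_(s in `[0, +oo[) f s = - F 0.
Proof.
move=> k0 K0 dF cf fK FK.
pose h (s : R) := K * expR (- k * s).
have ch : continuous h by exact: is_derive_continuous (is_derive_expRM _ _).
have intf := exp_decay_integrable k0 K0 cf fK.
have inth : mu.-integrable `[0, +oo[ (EFin \o h).
  apply: (exp_decay_integrable k0 K0 ch) => s _.
  by rewrite ger0_norm// mulr_ge0 ?expR_ge0.
pose G (s : R) := F s + - (K / k) * expR (- k * s).
have dG (s : R) : is_derive s 1 G (f s + h s).
  apply: (is_derive_eq (is_deriveD (dF s) (is_derive_expRM (- (K / k)) (- k) s))).
  by rewrite /h; congr (_ + _); field; rewrite gt_eqF.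
have cfh : continuous (fun s => f s + h s) by move=> s; exact: cvgD (cf s) (ch s).
have F0 : F s @[s --> +oo] --> 0.
  apply/cvgr0Pnorm_le => e e0; have := cvg_expR_decay K k0.
  move=> /cvgr0Pnorm_le/(_ _ e0) he.
  near=> s; apply: (@le_trans _ _ (K * expR (- k * s))).
    by apply: FK; near: s; exact: nbhs_pinfty_ge.
  by apply: (le_trans (ler_norm _)); near: s; exact: he.
have : \int[mu]_(s in `[0, +oo[) (f s + h s) = 0 - G 0.
  apply: Rintegral_ge0_continuous_FTC2y.
  - move=> s s0; have := fK s s0; rewrite ler_norml => /andP[+ _].
    by rewrite -subr_ge0 opprK.
  - exact: continuous_subspaceT.
  - rewrite -[X in _ --> X]addr0; apply: cvgD => //.
    exact: cvg_expR_decay.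
  - by move=> s _; apply: ex_derive; exact: dG.
  - by apply: cvg_at_right_filter; exact: (is_derive_continuous dG).
  - by move=> s _; rewrite derive1E; apply: derive_val.
rewrite RintegralD//.
have -> : \int[mu]_(s in `[0, +oo[) h s = K / k.
  by rewrite /Rintegral exp_decay_integral.
by rewrite /G mulr0 expR0 mulr1 sub0r => /eqP; rewrite opprD opprK -subr_eq addrK => /eqP.
Unshelve. all: by end_near. Qed.

Lemma Rintegral_bigsum (D : set R) (n : nat) (a : 'I_n -> R) (f : 'I_n -> R -> R) :
  measurable D -> (forall i, mu.-integrable D (EFin \o f i)) ->
  \int[mu]_(s in D) (\sum_i a i * f i s) = \sum_i a i * \int[mu]_(s in D) f i s.
Proof.
move=> mD; elim: n a f => [|n IH] a f intf.
  under eq_Rintegral do rewrite big_ord0.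
  by rewrite big_ord0 Rintegral_cst// mul0r.
under eq_Rintegral do rewrite big_ord_recl.
have inta i : mu.-integrable D (EFin \o (fun s => a i * f i s)).
  rewrite (_ : _ \o _ = (fun s => (a i)%:E * (EFin \o f i) s)%E); last first.
    by apply/funext => s /=; rewrite EFinM.
  exact: integrableZl.
rewrite RintegralD ?RintegralZl//; first by rewrite big_ord_recl IH.
have -> : EFin \o (fun x : R => \sum_(i < n) a (lift ord0 i) * f (lift ord0 i) x) =
    (fun x => \sum_(i < n) (a (lift ord0 i) * f (lift ord0 i) x)%:E)%E.
  by apply/funext => s /=; rewrite sumEFin.
by apply: integrable_sum => // i _; exact: inta.
Qed.

End ExponentialDecay.

Section Lyapunov.
Variables (R : realType) (d : nat) (A : 'M[R]_d) (P : 'M[R[i]]_d).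
Variables (tau : 'rV[R[i]]_d) (m : R).
Hypothesis hA : stable_diagonalizable A P tau m.
Local Open Scope complex_scope.

Let flow (s : R) : 'M[R]_d := expmx (s *: - A).

(** In the eigenbasis each complex coordinate w_i of the flow solves
   w_i' = - tau_i w_i, so |w_i|^2 exp (2 s Re tau_i) is constant. *)
Lemma flow_decay (v : 'cV[R]_d) (s : R) : 0 <= s ->
  l2norm (flow s *m v) <= cond_number P * expR (- m * s) * l2norm v.
Proof.
move=> s0; have [uP EA [_ lbm] m0] := hA.
case: (posnP d) => [d0|dpos].
  have E0 (w : 'cV[R]_d) : l2norm w = 0.
    by rewrite /l2norm big1 ?sqrtr0// => i; exfalso; move: (i) => [j]; rewrite d0.
  by rewrite !E0 mulr0.
have i0 := Ordinal dpos.
have [w defw] : exists w : R -> 'cV[R[i]]_d,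
    forall t, w t = invmx P *m map_mx (real_complex R) (flow t *m v) by eexists.
have wE t i : (w t i 0) = ((\row_j complex.Re (invmx P i j)) *m flow t *m v) 0 0
    +i* ((\row_j complex.Im (invmx P i j)) *m flow t *m v) 0 0.
  rewrite -!mulmxA defw !mxE; elim/big_ind3: _ => [//|a b c a' b' c' -> ->//|j _].
  rewrite [X in _ * X]mxE ![(\row__ _) _ _]mxE.
  case: (invmx P i j) ((flow t *m v) j 0) => a b y; apply/eqP.
  by rewrite eq_complex /= !mulr0 add0r subr0 !eqxx.
have PA : invmx P *m map_mx (real_complex R) A = diag_mx tau *m invmx P.
  have -> : map_mx (real_complex R) A = P *m diag_mx tau *m invmx P := EA.
  by rewrite -mulmxA mulKmx.
have w_decay i : complex.Re (w s i 0) ^+ 2 + complex.Im (w s i 0) ^+ 2 =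
    expR (- 2 * complex.Re (tau 0 i) * s) *
    (complex.Re (w 0 i 0) ^+ 2 + complex.Im (w 0 i 0) ^+ 2).
  pose p := \row_j complex.Re (invmx P i j); pose q := \row_j complex.Im (invmx P i j).
  pose al := complex.Re (tau 0 i); pose be := complex.Im (tau 0 i).
  have PAij j : \sum_k (invmx P i k) * (A k j)%:C = tau 0 i * invmx P i j.
    by have /matrixP/(_ i j) := PA; rewrite mul_diag_mx !mxE => <-; apply: eq_bigr => k _; rewrite mxE.
  have sumRe (I : finType) (F : I -> R[i]) : complex.Re (\sum_k F k) = \sum_k complex.Re (F k).
    by apply: (big_ind2 (fun (x : R[i]) y => complex.Re x = y)) => // -[x1 x2] x' [y1 y2] y' /= -> ->.
  have sumIm (I : finType) (F : I -> R[i]) : complex.Im (\sum_k F k) = \sum_k complex.Im (F k).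
    by apply: (big_ind2 (fun (x : R[i]) y => complex.Im x = y)) => // -[x1 x2] x' [y1 y2] y' /= -> ->.
  have pA : p *m A = al *: p - be *: q.
    apply/rowP => j; rewrite !mxE; have := congr1 (@complex.Re R) (PAij j).
    rewrite sumRe /al /be; case: (tau 0 i) => x y; case: (invmx P i j) => x' y' /= <-.
    by apply: eq_bigr => k _; rewrite mxE; case: (invmx P i k) => x1 y1 /=; rewrite mulr0 subr0.
  have qA : q *m A = be *: p + al *: q.
    apply/rowP => j; rewrite !mxE; have := congr1 (@complex.Im R) (PAij j).
    rewrite sumIm /al /be addrC; case: (tau 0 i) => x y; case: (invmx P i j) => x' y' /= <-.
    by apply: eq_bigr => k _; rewrite mxE; case: (invmx P i k) => x1 y1 /=; rewrite mulr0 add0r.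
  pose a (t : R) := (p *m flow t *m v) 0 0; pose b (t : R) := (q *m flow t *m v) 0 0.
  have da (t : R) : is_derive t 1 a (- (al * a t - be * b t)).
    apply: (is_derive_eq (is_derive_expmx_form (- A) p v t)).
    rewrite mulmxN !mulNmx pA !mulmxBl -!scalemxAl -/(flow t) /a /b.
    by move: (p *m flow t *m v) (q *m flow t *m v) => M N; rewrite !mxE.
  have db (t : R) : is_derive t 1 b (- (be * a t + al * b t)).
    apply: (is_derive_eq (is_derive_expmx_form (- A) q v t)).
    rewrite mulmxN !mulNmx qA !mulmxDl -!scalemxAl -/(flow t) /a /b.
    by move: (p *m flow t *m v) (q *m flow t *m v) => M N; rewrite !mxE.
  pose g (t : R) := (a t * a t + b t * b t) * (1 * expR (2 * al * t)).
  have g0 : g s = g 0.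
    apply: is_derive_0_is_cst => t.
    have D1 := is_deriveD (is_deriveM (da t) (da t)) (is_deriveM (db t) (db t)).
    have D2 := is_derive_expRM 1 (2 * al) t.
    apply: (is_derive_eq (is_deriveM D1 D2)).
    have -> : (a * a + b * b) t = a t * a t + b t * b t by [].
    move: (a t) (b t) => x y; rewrite /GRing.scale /=; ring.
  have aE t : complex.Re (w t i 0) = a t by rewrite wE.
  have bE t : complex.Im (w t i 0) = b t by rewrite wE.
  have key : a s ^+ 2 + b s ^+ 2 = expR (- 2 * al * s) * (a 0 ^+ 2 + b 0 ^+ 2).
    move: g0; rewrite /g; move: (a s) (b s) (a 0) (b 0) => x y x0 y0.
    rewrite (mulr0 (2 * al)) expR0 (mulr1 1) mulr1 -!expr2 => <-.
    rewrite mul1r mulrCA -expRD.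
    have -> : - 2 * al * s + 2 * al * s = 0 by ring.
    by rewrite expR0 mulr1.
  by move: key; rewrite -(aE s) -(bE s) -(aE 0) -(bE 0); exact.
rewrite -l2normC_real.
have -> : map_mx (real_complex R) (flow s *m v) = P *m w s.
  by rewrite defw mulKVmx.
have w0 : l2normC (w 0) <= op_norm (invmx P) * l2norm v.
  by rewrite defw /flow expmx0 mul1mx -l2normC_real op_normP.
apply: (le_trans (op_normP _ _)); rewrite /cond_number -!mulrA ler_wpM2l ?op_norm_ge0//.
rewrite mulrCA; apply: (@le_trans _ _ (expR (- m * s) * l2normC (w 0))); last first.
  by rewrite ler_wpM2l ?expR_ge0.
rewrite /l2normC -[expR _](@ger0_norm _ _ (expR_ge0 _)) -sqrtr_sqr -sqrtrM ?sqr_ge0//.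
apply: ler_wsqrtr; rewrite mulr_sumr; apply: ler_sum => i _.
rewrite w_decay ler_wpM2r ?addr_ge0 ?sqr_ge0// -expRM_natl ler_expR.
have mi : m <= complex.Re (tau 0 i) by apply: lbm; exists i.
by have := ler_wpM2r s0 mi; lra.
Qed.

Let cov (s : R) : 'M[R]_d := flow s *m (flow s)^T.

Let stationary_covE i j :
  stationary_cov A i j = \int[lebesgue_measure]_(s in `[0, +oo[) cov s i j.
Proof.
rewrite mxE; apply: eq_Rintegral => s _.
by rewrite !scaleNr -!scalerN -linearN /= expmx_tr.
Qed.

Lemma stationary_cov_sym : (stationary_cov A)^T = stationary_cov A.
Proof.
apply/matrixP => i j; rewrite mxE !stationary_covE; apply: eq_Rintegral => s _.
have symc : (cov s)^T = cov s by rewrite /cov trmx_mul trmxK.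
by rewrite -[in LHS]symc [LHS]mxE.
Qed.

Let derive_cov (s : R) i j : is_derive s 1 (fun t => cov t i j)
  ((- A *m cov s + cov s *m (- A)^T) i j).
Proof.
have -> : (fun t => cov t i j) = (fun t => \sum_k flow t i k * flow t j k).
  by apply/funext => t; rewrite mxE; apply: eq_bigr => k _; rewrite [_^T _ _]mxE.
apply: (is_derive_eq (is_derive_bigsum (fun k => is_deriveM
  (is_derive_expmx (- A) s i k) (is_derive_expmx (- A) s j k)))).
rewrite /cov -(mulmxA (flow s)) -trmx_mul (mulmxA (- A)) mxE !mxE -big_split.
apply: eq_bigr => k _ /=.
by rewrite /GRing.scale /= [_^T k j]mxE [_^T k j]mxE addrC [_ * flow s j k]mulrC.
Qed.

Let cov_bound : exists2 K, 0 <= K & forall s i j, 0 <= s ->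
  `|cov s i j| <= K * expR (- (2 * m) * s).
Proof.
exists (cond_number P ^+ 2 *+ d) => [|s i j s0]; first by rewrite mulrn_wge0// sqr_ge0.
have entry a b : `|flow s a b| <= cond_number P * expR (- m * s).
  have h := flow_decay (delta_mx b 0) s0.
  have n1 : l2norm (delta_mx b 0 : 'cV[R]_d) = 1.
    rewrite /l2norm (bigD1 b)//= big1 => [|k /negPf kb]; rewrite mxE ?eqxx.
      by rewrite expr1n addr0 sqrtr1.
    by rewrite kb expr0n.
  rewrite n1 mulr1 in h; apply: le_trans h.
  rewrite -ler_sqr ?nnegrE ?l2norm_ge0// real_normK ?num_real// l2norm_sqr.
  rewrite /sqnorm (bigD1 a)//= -colE mxE lerDl sumr_ge0// => k _; exact: sqr_ge0.
rewrite mxE (le_trans (ler_norm_sum _ _ _))//.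
apply: (@le_trans _ _ (\sum_(k < d) (cond_number P * expR (- m * s)) ^+ 2)).
  by apply: ler_sum => k _; rewrite [_^T _ _]mxE normrM expr2 ler_pM.
have -> : - (2 * m) * s = - m * s + - m * s by ring.
by rewrite expRD sumr_const card_ord exprMn (expr2 (expR _)) mulrnAl.
Qed.

Lemma cov_integrable i j :
  (@lebesgue_measure R).-integrable `[0%R, +oo[ (EFin \o (fun s => cov s i j)).
Proof.
have [K K0 covK] := cov_bound; have [_ _ _ m0] := hA.
apply: (@exp_decay_integrable _ _ K (2 * m)) => //; first by rewrite mulr_gt0.
  exact: is_derive_continuous (fun s => derive_cov s i j).
by move=> s; exact: covK.
Qed.

(** Integrate the derivative of e^{-sA} e^{-sA^T} over the half-line. *)
Theorem lyapunov_equation :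
  A *m stationary_cov A + stationary_cov A *m A^T = 1%:M.
Proof.
have [K K0 covK] := cov_bound; have [_ _ _ m0] := hA.
apply/matrixP => i j.
pose f (s : R) := (- A *m cov s + cov s *m (- A)^T) i j.
have fE s : f s = \sum_k - A i k * cov s k j + \sum_k - A j k * cov s i k.
  rewrite /f !mxE; congr (_ + _); apply: eq_bigr => k _.
    by rewrite [(- A) i k]mxE.
  by rewrite [_^T _ _]mxE [(- A) j k]mxE mulrC.
have cc a b : continuous (fun s => cov s a b).
  exact: is_derive_continuous (fun s => derive_cov s a b).
have cf : continuous f.
  have -> : f = (fun s => \sum_k - A i k * cov s k j + \sum_k - A j k * cov s i k).
    by apply/funext => s; rewrite fE.
  apply: (@is_derive_continuous _ _ (fun s =>
    \sum_k - A i k * (- A *m cov s + cov s *m (- A)^T) k j +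
    \sum_k - A j k * (- A *m cov s + cov s *m (- A)^T) i k)) => s.
  apply: is_deriveD; apply: is_derive_bigsum => k.
    exact: is_deriveZ (derive_cov s k j).
  exact: is_deriveZ (derive_cov s i k).
pose L := \sum_k `|A i k| + \sum_k `|A j k|.
have L0 : 0 <= L by rewrite addr_ge0 ?sumr_ge0.
have m2 : 0 < 2 * m by rewrite mulr_gt0.
have KL : 0 <= K * (1 + L) by rewrite mulr_ge0// addr_ge0.
have fK s : 0 <= s -> `|f s| <= K * (1 + L) * expR (- (2 * m) * s).
  move=> s0; rewrite fE (le_trans (ler_normD _ _))//.
  apply: (@le_trans _ _ (L * (K * expR (- (2 * m) * s)))); last first.
    by rewrite mulrCA mulrA ler_wpM2r ?expR_ge0// ler_wpM2l// lerDr.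
  rewrite mulrDl; apply: lerD; rewrite mulr_suml (le_trans (ler_norm_sum _ _ _))//;
    by apply: ler_sum => k _; rewrite normrM normrN ler_wpM2l// covK.
have cK s : 0 <= s -> `|cov s i j| <= K * (1 + L) * expR (- (2 * m) * s).
  move=> s0; apply: (le_trans (covK _ _ _ s0)).
  by rewrite ler_wpM2r ?expR_ge0// ler_peMr// lerDl.
have := exp_decay_FTC m2 KL (fun s => derive_cov s i j) cf fK cK.
have intsum (a : 'I_d -> R) (g : 'I_d -> R -> R) :
    (forall k, (@lebesgue_measure R).-integrable `[0%R, +oo[ (EFin \o g k)) ->
    (@lebesgue_measure R).-integrable `[0%R, +oo[
      (EFin \o (fun s => \sum_k a k * g k s)).
  move=> ig; have -> : EFin \o (fun s => \sum_k a k * g k s) =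
      (fun s => \sum_k (a k)%:E * (EFin \o g k) s)%E.
    by apply/funext => s /=; rewrite -sumEFin.
  by apply: integrable_sum => // k _; exact: integrableZl.
under eq_Rintegral do rewrite -/(f _) fE.
rewrite RintegralD//; last 2 first.
- by apply: intsum => k; exact: cov_integrable.
- by apply: intsum => k; exact: cov_integrable.
rewrite !Rintegral_bigsum//; last 2 first.
- by move=> k; exact: cov_integrable.
- by move=> k; exact: cov_integrable.
have -> : cov 0 = 1%:M by rewrite /cov /flow expmx0 mul1mx trmx1.
move=> /(congr1 -%R); rewrite opprK opprD -!sumrN => <-; rewrite !mxE; congr (_ + _).
  by apply: eq_bigr => k _; rewrite -stationary_covE mulNr opprK.
by apply: eq_bigr => k _; rewrite -stationary_covE mulNr opprK [_^T _ _]mxE mulrC.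
Qed.

End Lyapunov.

(** * Gaussian integrals on the line *)

Section GaussianIntegrals.
Variable R : realType.
Notation mu := (@lebesgue_measure R).

Lemma normal_integral (s : R) (f : R -> R) : s != 0 -> (forall x, 0 <= f x) ->
  measurable_fun setT f ->
  (\int[normal_prob 0 s]_x (f x)%:E = \int[mu]_x (f x * normal_pdf 0 s x)%:E)%E.
Proof.
move=> s0 f0 mf; have dom := normal_prob_dominates (0 : R) s.
rewrite -(Radon_Nikodym_SigmaFinite.change_of_variables dom) //; last exact/measurable_EFinP.
apply: ae_eq_integral => //.
- apply: emeasurable_funM; first exact/measurable_EFinP.
  by apply: measurable_int; exact: Radon_Nikodym_SigmaFinite.f_integrable.
- apply/measurable_EFinP/measurable_funM => //; exact: measurable_normal_pdf.
under [X in ae_eq _ _ _ X]eq_fun do rewrite EFinM.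
apply: ae_eqe_mul2l; apply: integral_ae_eq => //.
- exact: Radon_Nikodym_SigmaFinite.f_integrable.
- by apply/measurable_EFinP; exact: measurable_normal_pdf.
- by move=> E _ mE; rewrite -Radon_Nikodym_SigmaFinite.f_integral.
Qed.

Lemma normal_pdf_split (m s x : R) : s != 0 ->
  normal_pdf m s x = normal_peak s * normal_fun m s x.
Proof. by move=> s0; rewrite normal_pdfE. Qed.

Lemma normal_pdf_cst_integral (k m s : R) : 0 <= k ->
  (\int[mu]_x (k * normal_pdf m s x)%:E = k%:E)%E.
Proof.
move=> k0; under eq_integral do rewrite EFinM.
rewrite ge0_integralZl//=.
- by rewrite integral_normal_pdf mule1.
- by apply/measurable_EFinP; exact: measurable_normal_pdf.
- by move=> x _; rewrite lee_fin normal_pdf_ge0.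
Qed.

Let measurable_expR_lin (b : R) : measurable_fun setT (fun x : R => expR (b * x)).
Proof. by apply: measurableT_comp => //; exact: measurable_funM. Qed.

(** Completing the square. *)
Lemma normal_mgf (s b : R) : s != 0 ->
  (\int[normal_prob 0 s]_x (expR (b * x))%:E = (expR ((b * s) ^+ 2 / 2))%:E)%E.
Proof.
move=> s0; rewrite normal_integral//.
rewrite -(normal_pdf_cst_integral (b * s ^+ 2) s (expR_ge0 _)).
apply: eq_integral => x _; congr EFin.
rewrite !normal_pdf_split// mulrCA [RHS]mulrCA; congr (_ * _).
by rewrite /normal_fun -!expRD; congr expR; field.
Qed.

(** Up to a factor the integrand is another centred Gaussian density, whose
   variance is 1 / (1 - 2 c). *)
Lemma normal_exp_sqr (c : R) : c < 2^-1 ->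
  (\int[normal_prob 0 1]_x (expR (c * x ^+ 2))%:E = ((Num.sqrt (1 - 2 * c))^-1)%:E)%E.
Proof.
move=> c2; have c1 : 0 < 1 - 2 * c by lra.
pose s := (Num.sqrt (1 - 2 * c))^-1.
have s0 : 0 < s by rewrite invr_gt0 sqrtr_gt0.
rewrite normal_integral ?oner_eq0//; last first.
  by apply: measurableT_comp => //; exact: measurable_funM.
rewrite -(normal_pdf_cst_integral 0 s (ltW s0)).
apply: eq_integral => x _; congr EFin.
have s2 : s ^+ 2 = (1 - 2 * c)^-1 by rewrite exprVn sqr_sqrtr// ltW.
have pk : normal_peak 1 = s * normal_peak s.
  rewrite /normal_peak expr1n mul1r -mulrnAr sqrtrM ?sqr_ge0// sqrtr_sqr gtr0_norm//.
  by rewrite invfM mulVKf// gt_eqF.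
rewrite !normal_pdf_split ?oner_eq0 ?gt_eqF// pk mulrCA mulrA -!mulrA.
do 2 congr (_ * _).
rewrite /normal_fun -!expRD s2; congr expR; field.
by rewrite gt_eqF.
Qed.

Let integrable_scale (D : set R) (a : R) (g : R -> R) : measurable D ->
  mu.-integrable D (EFin \o g) -> mu.-integrable D (EFin \o (fun x => a * g x)).
Proof.
move=> mD ig; have -> : EFin \o (fun x => a * g x) = (fun x => a%:E * (EFin \o g) x)%E.
  by apply/funext.
exact: integrableZl.
Qed.

Section CharacteristicFunction.
Variable s : R.
Hypothesis s0 : s != 0.
Let p : R -> R := normal_pdf 0 s.

Let p0 x : 0 <= p x. Proof. exact: normal_pdf_ge0. Qed.
Let K := normal_peak s * expR (2 * s ^+ 2).
Let K0 : 0 <= K. Proof. by rewrite mulr_ge0 ?expR_ge0 ?normal_peak_ge0. Qed.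

Let p_decay x : p x <= K * expR (- 2 * x).
Proof.
rewrite /p normal_pdf_split// /K -mulrA -expRD ler_wpM2l ?normal_peak_ge0//.
rewrite /normal_fun ler_expR subr0.
(* Expanding this square yields the factor exp (2 s^2) of K. *)
have h : 0 <= (x / s - 2 * s) ^+ 2 := sqr_ge0 _.
have E : x ^+ 2 / (s ^+ 2 *+ 2) = 2^-1 * (x / s - 2 * s) ^+ 2 + 2 * x - 2 * s ^+ 2.
  by field.
by rewrite (mulNr (x ^+ 2)) E; lra.
Qed.

Let p_decay1 x : 0 <= x -> p x <= K * expR (- 1 * x).
Proof.
move=> x0; apply: (le_trans (p_decay x)); rewrite ler_wpM2l// ler_expR; lra.
Qed.

Let xp_decay x : 0 <= x -> x * p x <= K * expR (- 1 * x).
Proof.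
move=> x0; have -> : - 1 * x = x + - 2 * x by ring.
rewrite expRD [leRHS]mulrCA; apply: ler_pM => //.
by apply: le_trans (expR_ge1Dx x); lra.
Qed.

Let dp (x : R) : is_derive x 1 p (- (x / s ^+ 2) * p x).
Proof.
have -> : p = (fun x => normal_peak s * expR (- (s ^+ 2 *+ 2)^-1 * (x * x))).
  apply/funext => y; rewrite /p normal_pdf_split// /normal_fun subr0.
  by rewrite expr2 mulNr [_ * (s ^+ 2 *+ 2)^-1]mulrC mulNr.
have D1 : is_derive x 1 (fun x : R => x * x) (x + x).
  apply: (is_derive_eq (is_deriveM (is_derive_id x 1) (is_derive_id x 1))).
  by rewrite /GRing.scale /= !mulr1.
have D2 := is_deriveZ (- (s ^+ 2 *+ 2)^-1) D1.
have D3 := is_deriveZ (normal_peak s) (is_derive1_comp (is_derive_expR _) D2).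
apply: (is_derive_eq D3); rewrite /GRing.scale /=.
move: (expR _) (normal_peak s) => e q; field.
by rewrite s0.
Qed.

Let cp : continuous p. Proof. exact: is_derive_continuous dp. Qed.

Let dcos (b x : R) : is_derive x 1 (fun x => cos (b * x)) (- sin (b * x) * b).
Proof.
apply: (is_derive_eq (is_derive1_comp (is_derive_cos (b * x))
  (is_deriveZ b (is_derive_id x 1)))).
by rewrite /GRing.scale /= mulr1.
Qed.

Let dsin (b x : R) : is_derive x 1 (fun x => sin (b * x)) (cos (b * x) * b).
Proof.
apply: (is_derive_eq (is_derive1_comp (is_derive_sin (b * x))
  (is_deriveZ b (is_derive_id x 1)))).
by rewrite /GRing.scale /= mulr1.
Qed.

Let ccos b : continuous (fun x : R => cos (b * x)).
Proof. exact: is_derive_continuous (dcos b). Qed.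
Let csin b : continuous (fun x : R => sin (b * x)).
Proof. exact: is_derive_continuous (dsin b). Qed.

Let C b := \int[mu]_(x in `[0, +oo[) (cos (b * x) * p x).

Let int_p : mu.-integrable `[0%R, +oo[ (EFin \o p).
Proof.
apply: (exp_decay_integrable ltr01 K0 cp) => x x0.
by rewrite ger0_norm// p_decay1.
Qed.

Let int_cosp b : mu.-integrable `[0%R, +oo[ (EFin \o (fun x => cos (b * x) * p x)).
Proof.
apply: (exp_decay_integrable ltr01 K0) => [|x x0].
  by move=> x; apply: cvgM; [exact: ccos|exact: cp].
rewrite normrM (ger0_norm (p0 _)); apply: le_trans (p_decay1 x0).
by rewrite ler_piMl// cos_max.
Qed.

Let c_xsinp b : continuous (fun x : R => x * sin (b * x) * p x).
Proof.
move=> x; apply: cvgM; last exact: cp.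
by apply: cvgM; [exact: cvg_id|exact: csin].
Qed.

Let int_xsinp b : mu.-integrable `[0%R, +oo[
  (EFin \o (fun x => x * sin (b * x) * p x)).
Proof.
apply: (exp_decay_integrable ltr01 K0) => [|x x0]; first exact: c_xsinp.
rewrite !normrM (ger0_norm (p0 _)) (ger0_norm x0).
apply: le_trans (xp_decay x0); rewrite ler_wpM2r//.
by rewrite ler_piMr// sin_max.
Qed.

(** Integration by parts: (sin (b x) p)' = b cos (b x) p - s^-2 x sin (b x) p. *)
Let ibp b : \int[mu]_(x in `[0, +oo[) (x * sin (b * x) * p x) = s ^+ 2 * b * C b.
Proof.
pose f x := b * (cos (b * x) * p x) - (s ^+ 2)^-1 * (x * sin (b * x) * p x).
have dF (x : R) : is_derive x 1 (fun x => sin (b * x) * p x) (f x).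
  apply: (is_derive_eq (is_deriveM (dsin b x) (dp x))).
  by rewrite /f /GRing.scale /=; move: (sin _) (cos _) (p x) => u v w; field.
have cf : continuous f.
  move=> x; apply: cvgB; apply: cvgMr; last exact: c_xsinp.
  by apply: cvgM; [exact: ccos|exact: cp].
pose L := K * (1 + `|b| + (s ^+ 2)^-1).
have L0 : 0 <= L by rewrite mulr_ge0// !addr_ge0// invr_ge0 sqr_ge0.
have h1 x : 0 <= x -> `|f x| <= L * expR (- 1 * x).
  move=> x0; apply: (le_trans (ler_normB _ _)).
  rewrite !normrM (ger0_norm (p0 _)) (ger0_norm x0).
  rewrite (ger0_norm (_ : 0 <= (s ^+ 2)^-1)) ?invr_ge0 ?sqr_ge0//.
  apply: (@le_trans _ _ (`|b| * (K * expR (- 1 * x)) + (s ^+ 2)^-1 * (K * expR (- 1 * x)))).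
    apply: lerD; rewrite ler_wpM2l ?invr_ge0 ?sqr_ge0//.
      by apply: le_trans (p_decay1 x0); rewrite ler_piMl// cos_max.
    by apply: le_trans (xp_decay x0); rewrite ler_wpM2r// ler_piMr// sin_max.
  have : 0 <= K * expR (- 1 * x) by rewrite mulr_ge0 ?expR_ge0.
  rewrite /L; move: (expR _) => e; nra.
have h2 x : 0 <= x -> `|sin (b * x) * p x| <= L * expR (- 1 * x).
  move=> x0; rewrite normrM (ger0_norm (p0 _)).
  apply: (@le_trans _ _ (p x)); first by rewrite ler_piMl// sin_max.
  apply: (le_trans (p_decay1 x0)); rewrite ler_wpM2r ?expR_ge0// ler_peMr//.
  by rewrite -addrA lerDl addr_ge0// invr_ge0 sqr_ge0.
have := exp_decay_FTC ltr01 L0 dF cf h1 h2.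
rewrite mulr0 sin0 mul0r oppr0 RintegralB//; last 2 first.
- exact: (integrable_scale _ _ (int_cosp b)).
- exact: (integrable_scale _ _ (int_xsinp b)).
rewrite !RintegralZl// -/(C b) => /eqP; rewrite subr_eq0 => /eqP E.
have s2 : s ^+ 2 != 0 by rewrite expf_neq0.
by rewrite -mulrA E mulVKf.
Qed.

Let dC (b : R) : is_derive b 1 C (- (s ^+ 2 * b) * C b).
Proof.
pose f (b x : R) := cos (b * x) * p x.
have df (y x : R) : is_derive y 1 (f ^~ x) (- (x * sin (y * x) * p x)).
  have D1 : is_derive y 1 (fun y : R => cos (y * x)) (- sin (y * x) * x).
    have -> : (fun y : R => cos (y * x)) = (fun y => cos (x * y)).
      by apply/funext => z; rewrite mulrC.
    by rewrite [in sin _]mulrC; exact: dcos.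
  have -> : f ^~ x = (fun y => p x * cos (y * x)) by apply/funext => z; rewrite /f mulrC.
  apply: (is_derive_eq (is_deriveZ (p x) D1)).
  by rewrite /GRing.scale /=; ring.
have d1E y x : partial1of2 f y x = - (x * sin (y * x) * p x).
  by rewrite partial1of2E; apply: derive_val.
have bI : (`]b - 1, b + 1[%classic : set R) b by rewrite /= in_itv /= ; lra.
pose G (x : R) := K * expR (- 1 * x).
have G0 x : 0 <= G x by rewrite mulr_ge0 ?expR_ge0.
have intG : mu.-integrable `[0%R, +oo[ (EFin \o G).
  apply: (exp_decay_integrable ltr01 K0) => [|x x0]; last by rewrite ger0_norm.
  exact: is_derive_continuous (is_derive_expRM _ _).
have intf y : (`]b - 1, b + 1[%classic : set R) y ->
  mu.-integrable `[0%R, +oo[ (EFin \o f y) by move=> _; exact: int_cosp.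
have derf y x : (`]b - 1, b + 1[%classic : set R) y -> (`[0%R, +oo[%classic : set R) x ->
  derivable (f ^~ x) y 1 by move=> _ _; apply: ex_derive; exact: df.
have ub y x : (`]b - 1, b + 1[%classic : set R) y -> (`[0%R, +oo[%classic : set R) x ->
  `|partial1of2 f y x| <= G x.
  move=> _; rewrite /= in_itv /= andbT => x0; rewrite d1E normrN !normrM.
  rewrite (ger0_norm (p0 _)) (ger0_norm x0).
  by apply: le_trans (xp_decay x0); rewrite ler_wpM2r// ler_piMr// sin_max.
have mI : measurable (`[0%R, +oo[%classic : set R) by [].
have D := derivable_under_integral (mu := mu) mI bI intf derf G0 intG ub.
have E := differentiation_under_integral (mu := mu) mI bI intf derf G0 intG ub.
apply: (DeriveDef D); rewrite -derive1E E.
under eq_Rintegral do rewrite d1E -mulN1r.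
by rewrite RintegralZl// ibp; ring.
Qed.

(** Differentiating under the integral and integrating by parts, the half-line
   cosine transform C of the density solves C'(b) = - s^2 b C(b).  The added 1
   keeps the integrand nonnegative. *)
Lemma normal_char (b : R) :
  (\int[normal_prob 0 s]_x (1 + cos (b * x))%:E = (1 + expR (- ((b * s) ^+ 2 / 2)))%:E)%E.
Proof.
have cst : C b * expR (s ^+ 2 / 2 * (b * b)) = C 0 * expR (s ^+ 2 / 2 * (0 * 0)).
  pose g (b : R) := C b * expR (s ^+ 2 / 2 * (b * b)).
  apply: (@is_derive_0_is_cst _ g) => y.
  have D1 : is_derive y 1 (fun x : R => x * x) (y + y).
    apply: (is_derive_eq (is_deriveM (is_derive_id y 1) (is_derive_id y 1))).
    by rewrite /GRing.scale /= !mulr1.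
  have D2 := is_derive1_comp (is_derive_expR _) (is_deriveZ (s ^+ 2 / 2) D1).
  apply: (is_derive_eq (is_deriveM (dC y) D2)).
  rewrite /GRing.scale /=; move: (C y) => c.
  by move: (expR _) => e; field.
have f0 c x : 0 <= (1 + cos (c * x)) * p x.
  by rewrite mulr_ge0//; have := cos_geN1 (c * x); lra.
have half c : (\int[mu]_x ((1 + cos (c * x)) * p x)%:E = (2 * (C 0 + C c))%:E)%E.
  rewrite ge0_symfun_integralT//; last 2 first.
  - move=> x; apply: cvgM; last exact: cp.
    by apply: cvgD; [exact: cvg_cst|exact: ccos].
  - move=> x /=; rewrite mulrN cosN; congr (_ * _).
    by rewrite /p !normal_pdf_split// /normal_fun !subr0 sqrrN.
  rewrite -set_itvcy EFinM; congr (_ * _)%E.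
  rewrite -[LHS]fineK.
    congr EFin; rewrite -[LHS]/(Rintegral _ _ _) -RintegralD//.
    by apply: eq_Rintegral => x _; rewrite mul0r cos0; ring.
  have : mu.-integrable `[0%R, +oo[ (EFin \o (fun x => p x + cos (c * x) * p x)).
    exact: (integrableD _ int_p (int_cosp c)).
  move=> /(integrable_fin_num _); under eq_integral do rewrite /= -[X in (X + _)%R]mul1r -mulrDl.
  exact.
have C0 : C 0 = 2^-1.
  have : (2 * (C 0 + C 0))%:E = 2%:E :> \bar R.
    rewrite -half -[RHS](normal_pdf_cst_integral 0 s (@ler0n R 2)).
    by apply: eq_integral => x _; rewrite mul0r cos0.
  by move=> -[]; lra.
rewrite normal_integral//; last first.
  apply: continuous_measurable_fun => x.
  by apply: cvgD; [exact: cvg_cst|exact: ccos].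
rewrite half; congr EFin.
have -> : C b = C 0 * expR (- ((b * s) ^+ 2 / 2)).
  apply: (mulIf (_ : expR (s ^+ 2 / 2 * (b * b)) != 0)); first by rewrite gt_eqF ?expR_gt0.
  rewrite cst -[RHS]mulrA -expRD !mulr0; by congr (_ * expR _); field.
by rewrite C0; field.
Qed.

End CharacteristicFunction.

End GaussianIntegrals.

(** * Quadratic forms in Gaussian families *)

Section BoundedIntegrals.
Context d (T : measurableType d) (R : realType) (P : probability T R).

Lemma bounded_integrable (K : R) (f : T -> R) :
  measurable_fun setT f -> (forall x, `|f x| <= K) ->
  P.-integrable setT (EFin \o f).
Proof.
move=> mf fK; apply: measurable_bounded_integrable => //.
  by rewrite (le_lt_trans (probability_le1 P measurableT))// ltry.
exists K; split; first by rewrite num_real.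
by move=> y Ky x _; rewrite /= (le_trans (fK x))// ltW.
Qed.

Lemma integral_cst1 (k : R) : (\int[P]_x k%:E = k%:E)%E.
Proof. by rewrite integral_cst//= probability_setT mule1. Qed.

End BoundedIntegrals.

Section ScalarBounds.
Variable R : realType.

Lemma measurable_cos : measurable_fun setT (@cos R).
Proof. by apply: continuous_measurable_fun; exact: continuous_cos. Qed.

Lemma normal_cos (s b : R) : s != 0 ->
  (\int[normal_prob 0 s]_x (cos (b * x))%:E = (expR (- ((b * s) ^+ 2 / 2)))%:E)%E.
Proof.
move=> s0; have mc : measurable_fun setT (fun x : R => cos (b * x)).
  by apply: measurableT_comp; [exact: measurable_cos|exact: measurable_funM].
have ic : (normal_prob 0 s).-integrable setT (EFin \o (fun x : R => cos (b * x))).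
  by apply: (@bounded_integrable _ _ _ _ 1) => // x; exact: cos_max.
have := normal_char s0 b.
under eq_integral do rewrite EFinD.
rewrite integralD//=; last first.
  by apply: (@bounded_integrable _ _ _ _ 1 (cst 1)) => // x; rewrite normr1.
rewrite integral_cst1 EFinD.
have := integrable_fin_num measurableT ic; rewrite /comp.
by case: (\int[_]_x _)%E => // r _ [] /addrI ->.
Qed.

Lemma ge0_derive_le (g g' : R -> R) (x : R) :
  (forall t : R, is_derive t 1 g (g' t)) -> (forall t, 0 <= t -> 0 <= g' t) ->
  0 <= x -> g 0 <= g x.
Proof.
move=> dg g0 x0; rewrite -subr_ge0.
have cg : {within `[0, x], continuous g}.
  by apply: continuous_subspaceT; exact: is_derive_continuous dg.
have [c + ->] := @MVT_segment _ g g' 0 x x0 (fun t _ => dg t) cg.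
by rewrite in_itv/= => /andP[c0 _]; rewrite mulr_ge0 ?g0// subr_ge0.
Qed.

Lemma le_sinh (t : R) : 0 <= t -> t <= (expR t - expR (- t)) / 2.
Proof.
move=> t0; rewrite -subr_ge0.
pose g (t : R) := (1 * expR (1 * t) + (-1) * expR (-1 * t)) + (- 2) * t.
pose g' (t : R) := (1 * (1 * expR (1 * t)) + (-1) * (-1 * expR (-1 * t))) + (- 2) * 1.
have dg (x : R) : is_derive x 1 g (g' x).
  exact: is_deriveD (is_deriveD (is_derive_expRM 1 1 x) (is_derive_expRM (-1) (-1) x))
    (is_deriveZ (-2) (is_derive_id x 1)).
have g'0 (x : R) : 0 <= x -> 0 <= g' x.
  move=> _; have := expR_ge1Dx x; have := expR_ge1Dx (- x).
  by rewrite /g' !mul1r !mulN1r; lra.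
have := ge0_derive_le dg g'0 t0.
by rewrite /g !mulr0 !mul1r !mulN1r expR0; lra.
Qed.

(** With y = 1 / (1 - 2 u), twice the logarithm of the claim reads
   ln y <= (y - 1 / y) / 2, which is [le_sinh] at ln y. *)
Lemma inv_sqrt_le_upper (u : R) : 0 <= u -> 2 * u < 1 ->
  (Num.sqrt (1 - 2 * u))^-1 <= expR (u + u ^+ 2 / (1 - 2 * u)).
Proof.
move=> u0 u1; have c0 : 0 < 1 - 2 * u by lra.
set y := (1 - 2 * u)^-1.
have y1 : 1 <= y by rewrite invf_ge1; lra.
have y0 : 0 < y by lra.
rewrite -ler_sqr ?nnegrE ?expR_ge0 ?invr_ge0 ?sqrtr_ge0//.
rewrite exprVn sqr_sqrtr ?(ltW c0)// -/y -expRM_natl.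
rewrite -{1}[y]lnK// ler_expR.
apply: (le_trans (le_sinh (ln_ge0 y1))).
rewrite expRN lnK// /y invrK le_eqVlt; apply/orP; left; apply/eqP; field.
by rewrite gt_eqF.
Qed.

(** With w = 2 u, the square of the claim reads 1 <= (1 + w) exp (- w + w^2 / 2);
   the right-hand side has derivative w^2 exp (- w + w^2 / 2). *)
Lemma inv_sqrt_le_lower (u : R) : 0 <= u ->
  (Num.sqrt (1 + 2 * u))^-1 <= expR (- u + u ^+ 2).
Proof.
move=> u0; have c0 : 0 < 1 + 2 * u by lra.
rewrite -ler_sqr ?nnegrE ?expR_ge0 ?invr_ge0 ?sqrtr_ge0//.
rewrite exprVn sqr_sqrtr ?(ltW c0)// -expRM_natl.
rewrite -(ler_pM2l c0) mulfV ?gt_eqF//.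
pose q (w : R) := - w + w * w / 2.
pose g (w : R) := (1 + w) * expR (q w).
pose g' (w : R) := (1 + w) * (expR (q w) * (- 1 + (w + w) / 2)) + expR (q w) * (0 + 1).
have dg (x : R) : is_derive x 1 g (g' x).
  have D1 : is_derive x 1 (fun x : R => x * x) (x + x).
    apply: (is_derive_eq (is_deriveM (is_derive_id x 1) (is_derive_id x 1))).
    by rewrite /GRing.scale /= !mulr1.
  have D2 : is_derive x 1 q (- 1 + (x + x) / 2).
    have -> : q = (fun x => - x) + (2^-1 \*: (fun x : R => x * x)).
      by apply/funext => w; rewrite /q mulrC.
    apply: (is_derive_eq (is_deriveD (is_deriveNid x 1) (is_deriveZ 2^-1 D1))).
    by rewrite /GRing.scale /= mulrC.
  have D3 := is_derive1_comp (is_derive_expR (q x)) D2.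
  have D4 := is_deriveD (is_derive_cst (1 : R) (x : R) (1 : R)) (is_derive_id x 1).
  exact: (is_derive_eq (is_deriveM D4 D3)).
have g'0 x : 0 <= x -> 0 <= g' x.
  move=> x0; rewrite /g'; have := expR_ge0 (q x); move: (expR _) => e e0.
  have -> : (1 + x) * (e * (-1 + (x + x) / 2)) + e * (0 + 1) = x ^+ 2 * e by field.
  by rewrite mulr_ge0 ?sqr_ge0.
have u20 : 0 <= 2 * u by lra.
have := ge0_derive_le dg g'0 u20.
rewrite /g /q addr0 mul1r !mul0r oppr0 addr0 expR0 => /le_trans; apply.
by rewrite le_eqVlt; apply/orP; left; apply/eqP; congr (_ * expR _); field.
Qed.

End ScalarBounds.

Section HubbardStratonovich.
Context disp (T : measurableType disp) (R : realType) (P : probability T R).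
Variables (n : nat) (Z : nat -> T -> R) (l : nat -> R).
Hypothesis mZ : forall i, measurable_fun setT (Z i).
Notation gamma := (normal_prob (0 : R) 1).

Let lin (b : nat -> R) w := \sum_(i < n) b i * Z i w.
Let sq m w := \sum_(i < m) Z i w ^+ 2.
Let var (b : nat -> R) := \sum_(i < n) l i * b i ^+ 2.
Let upd (b : nat -> R) m c i := if i == m then c else b i.

Let sum_upd (f : nat -> R -> R) b m c : (m < n)%N -> f m 0 = 0 -> b m = 0 ->
  \sum_(i < n) f i (upd b m c i) = \sum_(i < n) f i (b i) + f m c.
Proof.
move=> mn fm0 bm0.
rewrite (bigD1 (Ordinal mn))//= [in RHS](bigD1 (Ordinal mn))//= bm0 fm0 add0r addrC.
rewrite /upd eqxx; congr (_ + _); apply: eq_bigr => i /negPf im.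
by rewrite (_ : (i : nat) == m = false)// -[RHS]im.
Qed.

Let lin_upd b m c w : (m < n)%N -> b m = 0 ->
  lin (upd b m c) w = lin b w + c * Z m w.
Proof.
by move=> mn bm; rewrite /lin (sum_upd (f := fun i x => x * Z i w))// mul0r.
Qed.

Let var_upd b m c : (m < n)%N -> b m = 0 ->
  var (upd b m c) = var b + l m * c ^+ 2.
Proof.
by move=> mn bm; rewrite /var (sum_upd (f := fun i x => l i * x ^+ 2))// expr0n mulr0.
Qed.

Let upd_below b m c i : (forall j, (j < m.+1)%N -> b j = 0) -> (i < m)%N ->
  upd b m c i = 0.
Proof.
by move=> b0 im; rewrite /upd ltn_eqF// b0// (ltn_trans im).
Qed.

Let mlin b : measurable_fun setT (lin b).
Proof. by apply: measurable_sum => i; exact: measurable_funM. Qed.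

Let msq m : measurable_fun setT (sq m).
Proof. by apply: measurable_sum => i; exact: measurable_funX. Qed.

(** exp (s z^2) is the average over a standard Gaussian g of
   exp (sqrt (2 s) g z): each squared coordinate is traded for a random linear
   form, and only the moment generating functions of linear forms remain. *)
Lemma mgf_sum_squares_pos (s : R) : 0 <= s -> (forall i, (i < n)%N -> 2 * (l i * s) < 1) ->
  (forall b, (\int[P]_w (expR (lin b w))%:E = (expR (var b / 2))%:E)%E) ->
  (\int[P]_w (expR (s * sq n w))%:E =
   (\prod_(i < n) (Num.sqrt (1 - 2 * (l i * s)))^-1)%:E)%E.
Proof.
move=> s0 ls H.
(* The coordinates below m enter through their squares only, the other ones
   through the linear form b only. *)
suff step m b : (m <= n)%N -> (forall j, (j < m)%N -> b j = 0) ->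
    (\int[P]_w (expR (lin b w + s * sq m w))%:E =
     (expR (var b / 2) * \prod_(i < m) (Num.sqrt (1 - 2 * (l i * s)))^-1)%:E)%E.
  have := step n (fun=> 0) (leqnn _) (fun _ _ => erefl).
  rewrite /var big1 ?mul0r ?expR0 ?mul1r => [|i _]; last by rewrite expr0n mulr0.
  move=> <-; apply: eq_integral => w _; congr ((expR _)%:E).
  by rewrite /lin big1 ?add0r// => i _; rewrite mul0r.
elim: m b => [|m IH] b mn b0.
  rewrite big_ord0 mulr1 -H; apply: eq_integral => w _.
  by rewrite /sq big_ord0 mulr0 addr0.
pose t := Num.sqrt (2 * s).
have t2 : t ^+ 2 = 2 * s by rewrite sqr_sqrtr// mulr_ge0.
have bm : b m = 0 by exact: b0.
pose F (z : T * R) : R := expR (lin b z.1 + s * sq m z.1) * expR (t * Z m z.1 * z.2).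
have mF : measurable_fun setT F.
  apply: measurable_funM; apply: measurableT_comp => //.
    apply: (measurableT_comp (f := fun w => lin b w + s * sq m w)) => //.
    by apply: measurable_funD => //; exact: measurable_funM.
  apply: measurable_funM => //; apply: measurable_funM => //.
  exact: (measurableT_comp (mZ m)).
have inner w : (\int[gamma]_g (F (w, g))%:E = (expR (lin b w + s * sq m.+1 w))%:E)%E.
  under eq_integral do rewrite /F /= EFinM.
  rewrite ge0_integralZl//=; last first.
    by apply/measurable_EFinP; apply: measurableT_comp => //; exact: measurable_funM.
  rewrite normal_mgf ?oner_eq0// -EFinM -expRD; congr ((expR _)%:E).
  by rewrite /sq big_ord_recr/= mulr1 exprMn t2; field.
under eq_integral do rewrite -inner.
have swap : (\int[P]_w \int[gamma]_g (F (w, g))%:E =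
    \int[gamma]_g \int[P]_w (F (w, g))%:E)%E.
  have F0 z : (0 <= (EFin \o F) z)%E by rewrite lee_fin mulr_ge0 ?expR_ge0.
  have mEF : measurable_fun setT (EFin \o F) by exact/measurable_EFinP.
  exact: (fubini_tonelli (m1 := P) (m2 := gamma) (EFin \o F) mEF F0).
rewrite swap.
have outer g : (\int[P]_w (F (w, g))%:E =
    (expR (var b / 2) * \prod_(i < m) (Num.sqrt (1 - 2 * (l i * s)))^-1)%:E *
    (expR (l m * s * g ^+ 2))%:E)%E.
  have FE w : F (w, g) = expR (lin (upd b m (t * g)) w + s * sq m w).
    by rewrite /F /= -expRD lin_upd//; congr expR; ring.
  under eq_integral do rewrite FE.
  rewrite IH ?(ltnW mn)//; last by move=> j; exact: upd_below.
  rewrite -EFinM var_upd// mulrDl expRD exprMn t2 mulrAC; congr EFin.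
  by congr (_ * expR _); field.
under eq_integral do rewrite outer.
have c0 : (0 <= (expR (var b / 2) * \prod_(i < m) (Num.sqrt (1 - 2 * (l i * s)))^-1)%:E :> \bar R)%E.
  by rewrite lee_fin mulr_ge0 ?expR_ge0// prodr_ge0// => i _; rewrite invr_ge0 sqrtr_ge0.
rewrite ge0_integralZl//=; last first.
  by apply/measurable_EFinP; apply: measurableT_comp => //; exact: measurable_funM.
rewrite normal_exp_sqr; last by have := ls m mn; lra.
by rewrite -EFinM [in RHS]big_ord_recr /= [in RHS]mulrA.
Qed.

(** exp (- s z^2) is the average over a standard Gaussian g of
   cos (sqrt (2 s) g z); a product of cosines is linearized at each step. *)
Lemma mgf_sum_squares_neg (s : R) : 0 <= s -> (forall i, (i < n)%N -> 0 <= l i) ->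
  (forall b, (\int[P]_w (cos (lin b w))%:E = (expR (- (var b / 2)))%:E)%E) ->
  (\int[P]_w (expR (- s * sq n w))%:E =
   (\prod_(i < n) (Num.sqrt (1 + 2 * (l i * s)))^-1)%:E)%E.
Proof.
move=> s0 l0 H.
have sq0 m w : 0 <= sq m w by apply: sumr_ge0 => i _; exact: sqr_ge0.
have eb m w : `|expR (- s * sq m w)| <= 1.
  rewrite ger0_norm ?expR_ge0// -expR0 ler_expR.
  by rewrite mulNr oppr_le0 mulr_ge0.
have mcl m b : measurable_fun setT (fun w => expR (- s * sq m w) * cos (lin b w)).
  apply: measurable_funM; last exact: (measurableT_comp (@measurable_cos R)).
  by apply: measurableT_comp => //; exact: measurable_funM.
suff step m b : (m <= n)%N -> (forall j, (j < m)%N -> b j = 0) ->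
    (\int[P]_w (expR (- s * sq m w) * cos (lin b w))%:E =
     (expR (- (var b / 2)) * \prod_(i < m) (Num.sqrt (1 + 2 * (l i * s)))^-1)%:E)%E.
  have := step n (fun=> 0) (leqnn _) (fun _ _ => erefl).
  rewrite /var big1 ?mul0r ?oppr0 ?expR0 ?mul1r => [|i _]; last by rewrite expr0n mulr0.
  move=> <-; apply: eq_integral => w _; congr (_%:E).
  by rewrite /lin big1 ?cos0 ?mulr1// => i _; rewrite mul0r.
elim: m b => [|m IH] b mn b0.
  rewrite big_ord0 mulr1 -H; apply: eq_integral => w _.
  by rewrite /sq big_ord0 mulr0 expR0 mul1r.
pose t := Num.sqrt (2 * s).
have t2 : t ^+ 2 = 2 * s by rewrite sqr_sqrtr// mulr_ge0.
have bm : b m = 0 by exact: b0.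
pose F (z : T * R) : R :=
  (expR (- s * sq m z.1) * cos (lin b z.1)) * cos (t * Z m z.1 * z.2).
have mF : measurable_fun setT F.
  apply: measurable_funM; first exact: (measurableT_comp (mcl m b)).
  apply: (measurableT_comp (@measurable_cos R)).
  apply: measurable_funM => //; apply: measurable_funM => //.
  exact: (measurableT_comp (mZ m)).
have bF z : `|F z| <= 1.
  by rewrite /F !normrM !mulr_ile1 ?mulr_ge0// cos_max.
have mFl w : measurable_fun setT (fun g => cos (t * Z m w * g)).
  by apply: (measurableT_comp (@measurable_cos R)); exact: measurable_funM.
have inner w : (\int[gamma]_g (F (w, g))%:E =
    (expR (- s * sq m.+1 w) * cos (lin b w))%:E)%E.
  under eq_integral do rewrite /F /= EFinM.
  rewrite integralZl//=; last first.
    exact: (bounded_integrable gamma (mFl w) (fun g => cos_max (t * Z m w * g))).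
  rewrite normal_cos ?oner_eq0// -EFinM mulrAC -expRD; congr EFin; congr (expR _ * _).
  by rewrite /sq big_ord_recr/= mulr1 exprMn t2; field.
under eq_integral do rewrite -inner.
have iF : (P \x gamma)%E.-integrable setT (EFin \o F).
  apply/integrable12ltyP; first exact/measurable_EFinP.
  apply: (@le_lt_trans _ _ (\int[P]_x \int[gamma]_y 1%:E)%E); last first.
    by under eq_integral do rewrite integral_cst1; rewrite integral_cst1 ltry.
  apply: ge0_le_integral => //.
  - by move=> x _; exact: integral_ge0.
  - have mAF : measurable_fun setT (fun z => `|(EFin \o F) z|%E).
      by apply: measurableT_comp => //; exact/measurable_EFinP.
    have AF0 z : (0 <= `|(EFin \o F) z|)%E by [].
    exact: (measurable_fun_fubini_tonelli_F (m2 := gamma) _ mAF AF0).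
  - move=> x _; apply: ge0_le_integral => //.
    + apply: measurableT_comp => //; apply/measurable_EFinP.
      exact: (measurableT_comp mF).
    + by move=> y _; rewrite lee_fin.
have swap : (\int[P]_w \int[gamma]_g (F (w, g))%:E =
    \int[gamma]_g \int[P]_w (F (w, g))%:E)%E by exact: (Fubini iF).
rewrite swap.
have outer g : (\int[P]_w (F (w, g))%:E =
    (expR (- (var b / 2)) * \prod_(i < m) (Num.sqrt (1 + 2 * (l i * s)))^-1)%:E *
    (expR (- (l m * s) * g ^+ 2))%:E)%E.
  pose h c w := 2^-1 * (expR (- s * sq m w) * cos (lin (upd b m c) w)).
  have ih c : P.-integrable setT (EFin \o h c).
    apply: (@bounded_integrable _ _ _ _ 1); first exact: measurable_funM.
    move=> w; rewrite !normrM !mulr_ile1 ?mulr_ge0//; last exact: cos_max.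
    by rewrite ger0_norm ?invr_ge0// invf_le1// ler1n.
  have FE w : F (w, g) = h (t * g) w + h (- (t * g)) w.
    rewrite /h !lin_upd// !cosD (mulNr (t * g)) sinN cosN /F /=.
    have -> : t * Z m w * g = t * g * Z m w by ring.
    by field.
  under eq_integral do rewrite FE EFinD.
  rewrite integralD//=; [|exact: ih..].
  have hE c : (\int[P]_w (h c w)%:E = (2^-1 * (expR (- (var (upd b m c) / 2)) *
      \prod_(i < m) (Num.sqrt (1 + 2 * (l i * s)))^-1))%:E)%E.
    under eq_integral do rewrite EFinM.
    rewrite integralZl//=; last first.
      apply: (bounded_integrable P (mcl m (upd b m c)) (K := 1)) => w.
      by rewrite normrM mulr_ile1// cos_max.
    by rewrite IH ?(ltnW mn)//; move=> j; exact: upd_below.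
  rewrite !hE -!EFinD -EFinM; congr (_%:E).
  have -> : - (var b / 2) = - (var (upd b m (t * g)) / 2) + l m * s * g ^+ 2.
    by rewrite var_upd// exprMn t2; field.
  have ee : expR (l m * s * g ^+ 2) * expR (- (l m * s) * g ^+ 2) = 1.
    by rewrite -expRD mulNr subrr expR0.
  rewrite !var_upd// sqrrN expRD; move: ee.
  move: (expR (- _)) (expR (l m * s * _)) (expR (- _ * _)) (\prod_(_ < _) _) => x y z p yz.
  have -> : x * y * p * z = x * p * (y * z) by ring.
  by rewrite yz; field.
under eq_integral do rewrite outer.
have c0 : (0 <= (expR (- (var b / 2)) * \prod_(i < m) (Num.sqrt (1 + 2 * (l i * s)))^-1)%:E :> \bar R)%E.
  by rewrite lee_fin mulr_ge0 ?expR_ge0// prodr_ge0// => i _; rewrite invr_ge0 sqrtr_ge0.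
rewrite ge0_integralZl//=; last first.
  by apply/measurable_EFinP; apply: measurableT_comp => //; exact: measurable_funM.
have lms : 0 <= l m * s by rewrite mulr_ge0// l0.
rewrite normal_exp_sqr; last by lra.
by rewrite -EFinM [in RHS]big_ord_recr /= [in RHS]mulrA mulrN opprK.
Qed.

End HubbardStratonovich.

Section GaussianVector.
Context disp (T : measurableType disp) (R : realType) (P : probability T R).
Variables (n : nat) (y : 'I_n -> T -> R) (S : 'M[R]_n).
Hypothesis my : forall i, measurable_fun setT (y i).
Hypothesis Ssym : S^T = S.
Let quad (a : 'cV[R]_n) := (a^T *m S *m a) 0 0.
Hypothesis yexp : forall a : 'cV[R]_n,
  (\int[P]_w (expR (\sum_i a i 0 * y i w))%:E = (expR (quad a / 2))%:E)%E.
Hypothesis ycos : forall a : 'cV[R]_n,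
  (\int[P]_w (cos (\sum_i a i 0 * y i w))%:E = (expR (- (quad a / 2)))%:E)%E.

(** The characteristic function exp (- quad a / 2) is at most 1. *)
Lemma gaussian_cov_ge0 (a : 'cV[R]_n) : 0 <= quad a.
Proof.
have mf : measurable_fun setT (fun w => cos (\sum_i a i 0 * y i w)).
  apply: (measurableT_comp (@measurable_cos R)).
  by apply: measurable_sum => i; exact: measurable_funM.
have : ((expR (- (quad a / 2)))%:E <= 1%:E)%E.
  rewrite -ycos -(integral_cst1 P 1); apply: le_integral => //.
  - exact: (bounded_integrable P mf (fun w => cos_max _)).
  - by apply: (bounded_integrable P (f := cst 1) (K := 1)) => // w; rewrite normr1.
  - by move=> w _; rewrite lee_fin cos_le1.
by rewrite lee_fin -[X in _ <= X]expR0 ler_expR oppr_le0; lra.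
Qed.

(** The form quad is nonnegative at e_i + e_j and at e_i - e_j. *)
Lemma gaussian_cov_offdiag i j : 2 * `|S i j| <= S i i + S j j.
Proof.
have q (e : R) : e ^+ 2 = 1 -> 0 <= S i i + S j j + 2 * e * S i j.
  move=> e2; have := gaussian_cov_ge0 (delta_mx i 0 + e *: delta_mx j 0).
  have trE : (delta_mx i 0 + e *: delta_mx j 0 : 'cV[R]_n)^T =
      delta_mx 0 i + e *: delta_mx 0 j.
    by apply/matrixP => a b; rewrite !mxE ![(b == _) && _]andbC.
  rewrite /quad trE !mulmxDl !mulmxDr -!scalemxAl -!scalemxAr.
  rewrite -!rowE -!colE !mxE.
  have -> : S j i = S i j by rewrite -[in LHS]Ssym mxE.
  by rewrite mulrA -expr2 e2; lra.
have q1 := q 1 (expr1n _ _); have N1 : (-1 : R) ^+ 2 = 1 by ring.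
have q2 := q (-1) N1.
by case: (ger0P (S i j)) => _; move: q1 q2; lra.
Qed.

Variable lam : R.
Hypothesis rows : forall i, \sum_j `|S i j| <= lam.

(** Gershgorin: read the eigenvector equation at the coordinate of largest
   modulus. *)
Let eigen_le r : eigenvalue S r -> r <= lam.
Proof.
move=> /eigenvalueP[v vS v0].
have [i0 vi0] : exists i, v 0 i != 0 by apply/rV0Pn.
pose i := [arg max_(i > i0) `|v 0 i|]%O.
have imax j : `|v 0 j| <= `|v 0 i|.
  by rewrite /i; case: arg_maxP => // k _; exact.
have vi : 0 < `|v 0 i| by apply: lt_le_trans (imax i0); rewrite normr_gt0.
have /rowP/(_ i) := vS; rewrite !mxE => E.
rewrite -(ler_pM2r vi); apply: (@le_trans _ _ `|r * v 0 i|).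
  by rewrite normrM ler_wpM2r// ler_norm.
rewrite -E; apply: (le_trans (ler_norm_sum _ _ _)).
apply: (@le_trans _ _ (\sum_j `|v 0 i| * `|S i j|)).
  apply: ler_sum => j _; rewrite normrM -[in S j i]Ssym mxE.
  by rewrite ler_wpM2r.
by rewrite -mulr_sumr mulrC ler_wpM2r.
Qed.

(** In an orthonormal eigenbasis of S the coordinates are uncorrelated, with the
   eigenvalues l_i as variances.  Each factor (1 - 2 s l_i)^(-1/2) is compared to
   exp (s l_i + s^2 l_i^2 / (1 - 2 s lam)): the first-order terms add up to
   s tr S, the second-order ones to the squared Frobenius norm. *)
Lemma gaussian_chi2_mgf (s : R) : 0 <= s ->
  (2 * (s * lam) < 1 ->
   (\int[P]_w (expR (s * (\sum_i y i w ^+ 2 - \tr S)))%:E <=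
   (expR (s ^+ 2 * (\sum_i \sum_j S i j ^+ 2) / (1 - 2 * (s * lam))))%:E)%E) /\
  (\int[P]_w (expR (- s * (\sum_i y i w ^+ 2 - \tr S)))%:E <=
   (expR (s ^+ 2 * (\sum_i \sum_j S i j ^+ 2)))%:E)%E.
Proof.
move=> s0; have [U [lr [UU ES]]] := real_spectral Ssym.
have UTU := mulmx1C UU.
(* Rotated coordinates and variances, extended by 0 to all of nat. *)
pose Z (k : nat) w := oapp (fun j => \sum_i U j i * y i w) 0 (insub k : option 'I_n).
pose l (k : nat) := oapp (fun j => lr 0 j) 0 (insub k : option 'I_n).
have ZE (j : 'I_n) w : Z j w = \sum_i U j i * y i w by rewrite /Z valK.
have lE (j : 'I_n) : l j = lr 0 j by rewrite /l valK.
have mZ k : measurable_fun setT (Z k).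
  rewrite /Z; case: insub => [j|] //=.
  by apply: measurable_sum => i; exact: measurable_funM.
have quadE (b : nat -> R) : quad (U^T *m \col_(i < n) b i) = \sum_(i < n) l i * b i ^+ 2.
  rewrite /quad trmx_mul trmxK ES -!mulmxA (mulmxA U) UU mul1mx (mulmxA U) UU mul1mx.
  by rewrite mulmxA quad_diag; apply: eq_bigr => i _; rewrite mxE lE.
have linE (b : nat -> R) w : \sum_(i < n) b i * Z i w =
    \sum_i (U^T *m \col_(i < n) b i) i 0 * y i w.
  under eq_bigr do rewrite ZE mulr_sumr.
  rewrite exchange_big; apply: eq_bigr => i _ /=.
  by rewrite mxE mulr_suml; apply: eq_bigr => j _; rewrite !mxE; ring.
have sqE w : \sum_(i < n) Z i w ^+ 2 = \sum_i y i w ^+ 2.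
  have := orthogonal_sqnorm (\col_i y i w) UU; rewrite /sqnorm.
  under [X in _ = X -> _]eq_bigr do rewrite mxE.
  move=> <-; apply: eq_bigr => j _; rewrite ZE mxE; congr (_ ^+ 2).
  by apply: eq_bigr => i _; rewrite mxE.
have l0 i : (i < n)%N -> 0 <= l i.
  move=> lin; have := gaussian_cov_ge0 (U^T *m delta_mx (Ordinal lin) 0).
  rewrite /quad trmx_mul trmxK ES -!mulmxA (mulmxA U) UU mul1mx (mulmxA U) UU mul1mx.
  rewrite trmx_delta mul_diag_mx -rowE !mxE eqxx mulr1.
  by rewrite -lE.
have llam i : (i < n)%N -> l i <= lam.
  move=> lin; rewrite (_ : l i = lr 0 (Ordinal lin)); last by rewrite -lE.
  by apply: eigen_le; exact: spectral_eigenvalue ES.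
have trE : \tr S = \sum_(i < n) l i.
  rewrite ES mxtrace_mulC mulmxA UU mul1mx mxtrace_diag.
  by apply: eq_bigr => i _; rewrite lE.
have frobE : \sum_i \sum_j S i j ^+ 2 = \sum_(i < n) l i ^+ 2.
  transitivity (\tr (S *m S)).
    apply: eq_bigr => i _; rewrite mxE; apply: eq_bigr => j _.
    by rewrite -[in S j i]Ssym mxE expr2.
  have -> : S *m S = U^T *m (diag_mx lr *m diag_mx lr) *m U.
    by rewrite {1 2}ES !mulmxA -(mulmxA _ U) UU mulmx1.
  rewrite mxtrace_mulC (mulmxA U) UU mul1mx mulmx_diag mxtrace_diag.
  by apply: eq_bigr => i _; rewrite mxE lE expr2.
have Hexp (b : nat -> R) : (\int[P]_w (expR (\sum_(i < n) b i * Z i w))%:E =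
    (expR ((\sum_(i < n) l i * b i ^+ 2) / 2))%:E)%E.
  by under eq_integral do rewrite linE; rewrite yexp quadE.
have Hcos (b : nat -> R) : (\int[P]_w (cos (\sum_(i < n) b i * Z i w))%:E =
    (expR (- ((\sum_(i < n) l i * b i ^+ 2) / 2)))%:E)%E.
  by under eq_integral do rewrite linE; rewrite ycos quadE.
have mq c : measurable_fun setT (fun w => (expR (c * \sum_i y i w ^+ 2))%:E).
  apply/measurable_EFinP; apply: measurableT_comp => //; apply: measurable_funM => //.
  by apply: measurable_sum => i; exact: measurable_funX.
have shift c : (\int[P]_w (expR (c * (\sum_i y i w ^+ 2 - \tr S)))%:E =
    (expR (- c * \tr S))%:E * \int[P]_w (expR (c * \sum_(i < n) Z i w ^+ 2))%:E)%E.
  under [X in (_ * X)%E]eq_integral do rewrite sqE.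
  have k0 : 0 <= expR (- c * \tr S) by exact: expR_ge0.
  rewrite -(ge0_integralZl_EFin _ _ _ (mq c) k0)//.
  by apply: eq_integral => w _; rewrite -EFinM -expRD; congr (expR _)%:E; ring.
split => [s1|].
  rewrite shift.
  rewrite (mgf_sum_squares_pos (l := l) mZ s0); last 2 first.
  - move=> i lin; apply: le_lt_trans s1; rewrite ler_wpM2l// mulrC ler_wpM2l//.
    exact: llam.
  - by move=> b; exact: Hexp.
  rewrite -EFinM lee_fin.
  have c0 : 0 < 1 - 2 * (s * lam) by lra.
  apply: (@le_trans _ _ (expR (- s * \tr S) * \prod_(i < n)
      expR (s * l i + s ^+ 2 * l i ^+ 2 / (1 - 2 * (s * lam))))).
    rewrite ler_wpM2l ?expR_ge0//; apply: ler_prod => i _.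
    rewrite invr_ge0 sqrtr_ge0/=.
    have li0 := l0 i (ltn_ord i); have lil := llam i (ltn_ord i).
    have ls : l i * s <= s * lam by rewrite mulrC ler_wpM2l.
    apply: le_trans (inv_sqrt_le_upper _ _) _; rewrite ?mulr_ge0//; first by lra.
    rewrite ler_expR (mulrC (l i) s) exprMn lerD2l ler_wpM2l ?mulr_ge0 ?sqr_ge0//.
    by rewrite lef_pV2 ?posrE//; lra.
  rewrite -expR_sum -expRD ler_expR big_split/= -mulr_sumr trE frobE.
  rewrite le_eqVlt; apply/orP; left; apply/eqP.
  rewrite mulNr addrA addNr add0r mulr_sumr mulr_suml.
  by apply: eq_bigr.
rewrite shift opprK.
rewrite (mgf_sum_squares_neg (l := l) mZ s0 l0); last by move=> b; exact: Hcos.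
rewrite -EFinM lee_fin.
apply: (@le_trans _ _ (expR (s * \tr S) * \prod_(i < n)
    expR (- (s * l i) + s ^+ 2 * l i ^+ 2))).
  rewrite ler_wpM2l ?expR_ge0//; apply: ler_prod => i _.
  rewrite invr_ge0 sqrtr_ge0/=.
  have li0 := l0 i (ltn_ord i).
  apply: le_trans (inv_sqrt_le_lower _) _; rewrite ?mulr_ge0//.
  by rewrite ler_expR (mulrC (l i) s) exprMn.
rewrite -expR_sum -expRD ler_expR big_split/= sumrN -!mulr_sumr trE frobE.
by rewrite addrA subrr add0r.
Qed.

End GaussianVector.

(** * Gaussian laws and independence *)

Section Law.
Context disp (T : measurableType disp) (R : realType) (P : probability T R).

Let rv d' (T' : measurableType d') (U : T -> T') (mU : measurable_fun setT U) :
  {RV P >-> T'} := HB.pack U (isMeasurableFun.Build _ _ _ _ U mU).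

Section CenteredNormal.
Variables (U : T -> R) (v : R).
Hypotheses (mU : measurable_fun setT U) (v0 : 0 <= v).
Hypothesis lawU : forall B, measurable B -> P [set w | B (U w)] = centered_normal v B.

Let law_integral (f : R -> \bar R) : measurable_fun setT f -> (forall x, 0 <= f x)%E ->
  (\int[P]_w f (U w) = if (v == 0)%R then f 0%R else \int[normal_prob 0 (Num.sqrt v)]_x f x)%E.
Proof.
move=> mf f0.
pose X := rv (T' := measurableTypeR R) mU.
have E : (\int[P]_w f (U w) = \int[distribution P X]_x f x)%E.
  by rewrite (@ge0_integral_distribution _ _ _ (measurableTypeR R) _ P X).
rewrite E; case: ifPn => [v00|v00].
  rewrite (@eq_measure_integral _ (measurableTypeR R) _ _ (\d_ (0 : measurableTypeR R))).
    by rewrite integral_dirac//= diracT mul1e.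
  by move=> A mA _; rewrite /= -[LHS]/(P [set w | A (U w)]) lawU// /centered_normal v00.
apply: eq_measure_integral => A mA _.
by rewrite /= -[LHS]/(P [set w | A (U w)]) lawU// /centered_normal (negbTE v00).
Qed.

Let sqrt_v0 : v != 0 -> Num.sqrt v != 0.
Proof. by move=> v00; rewrite gt_eqF// sqrtr_gt0 lt_def v00. Qed.

Lemma centered_normal_mgf : (\int[P]_w (expR (U w))%:E = (expR (v / 2))%:E)%E.
Proof.
rewrite (law_integral (f := EFin \o expR)) /=; last 2 first.
- exact/measurable_EFinP.
- by move=> x; rewrite lee_fin expR_ge0.
case: ifPn => [/eqP ->|v00]; first by rewrite mul0r expR0.
under eq_integral do rewrite -[X in expR X]mul1r.
by rewrite normal_mgf ?sqrt_v0// mul1r sqr_sqrtr.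
Qed.

(** The added 1 keeps the integrand nonnegative. *)
Lemma centered_normal_cos : (\int[P]_w (cos (U w))%:E = (expR (- (v / 2)))%:E)%E.
Proof.
have m1 : measurable_fun setT (fun x : R => 1 + cos x).
  by apply: measurable_funD => //; exact: measurable_cos.
have : (\int[P]_w (1 + cos (U w))%:E = (1 + expR (- (v / 2)))%:E)%E.
  rewrite (law_integral (f := EFin \o (fun x => 1 + cos x))) /=; last 2 first.
  - exact/measurable_EFinP.
  - by move=> x; rewrite lee_fin; have := cos_geN1 x; lra.
  case: ifPn => [/eqP ->|v00]; first by rewrite mul0r oppr0 expR0 cos0.
  under eq_integral do rewrite -[X in cos X]mul1r.
  by rewrite normal_char ?sqrt_v0// mul1r sqr_sqrtr.
have mc : measurable_fun setT (cos \o U).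
  by apply: measurableT_comp => //; exact: measurable_cos.
have ic := bounded_integrable P mc (fun w => cos_max (U w)).
under eq_integral do rewrite EFinD.
rewrite integralD//=; last first.
  by apply: (bounded_integrable P (f := cst 1) (K := 1)) => // w; rewrite normr1.
rewrite integral_cst1 EFinD.
have := integrable_fin_num measurableT ic; rewrite /comp.
by case: (\int[_]_x _)%E => // r _ [] /addrI ->.
Qed.

End CenteredNormal.

Lemma same_law_integral (U V : T -> R) (f : R -> R) :
  measurable_fun setT U -> measurable_fun setT V -> measurable_fun setT f ->
  (forall x, `|f x| <= 1) ->
  (forall B, measurable B -> P [set w | B (U w)] = P [set w | B (V w)]) ->
  (\int[P]_w (f (U w))%:E = \int[P]_w (f (V w))%:E)%E.
Proof.
move=> mU mV mf f1 UV.
have E (W : T -> R) (mW : measurable_fun setT W) :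
    (\int[P]_w (f (W w))%:E = \int[distribution P (rv mW)]_x (f x)%:E)%E.
  rewrite (integral_distribution (f := EFin \o f))//.
    exact/measurable_EFinP.
  exact: (bounded_integrable P (measurableT_comp mf mW) (fun w => f1 (W w))).
rewrite (E _ mU) (E _ mV); apply: eq_measure_integral => A mA _.
exact: UV.
Qed.

Section Independence.
Variables U V : T -> R.
Hypotheses (mU : measurable_fun setT U) (mV : measurable_fun setT V).
Hypothesis UV : forall A B, measurable A -> measurable B ->
  P ([set w | A (U w)] `&` [set w | B (V w)]) =
  (P [set w | A (U w)] * P [set w | B (V w)])%E.

(** The joint law of an independent pair is the product of its marginals, so
   the Fubini-Tonelli theorem applies. *)
Lemma indep_integral_ge0 (f g : R -> R) :
  measurable_fun setT f -> measurable_fun setT g ->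
  (forall x, 0 <= f x) -> (forall x, 0 <= g x) ->
  (\int[P]_w (f (U w) * g (V w))%:E =
   (\int[P]_w (f (U w))%:E) * (\int[P]_w (g (V w))%:E))%E.
Proof.
move=> mf mg f0 g0.
have mUV : measurable_fun setT (fun w => (U w, V w)) by exact: measurable_fun_pair.
pose F (z : R * R) := (f z.1 * g z.2)%:E.
have mF : measurable_fun setT F.
  apply/measurable_EFinP; apply: measurable_funM.
    exact: (measurableT_comp mf).
  exact: (measurableT_comp mg).
have F0 z : (0 <= F z)%E by rewrite lee_fin mulr_ge0.
pose PU := distribution P (rv mU); pose PV := distribution P (rv mV).
have -> : (\int[P]_w (f (U w) * g (V w))%:E = \int[(PU \x PV)%E]_z F z)%E.
  have := ge0_integral_distribution (rv mUV) mF F0; rewrite /= => E.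
  transitivity (\int[distribution P (rv mUV)]_x F x)%E; first by rewrite E.
  apply: eq_measure_integral => A mA _; apply/esym.
  by apply: product_measure_unique => // B C mB mC; exact: UV.
rewrite (fubini_tonelli1 (m1 := PU) (m2 := PV) F mF F0).
have EU : (\int[P]_w (f (U w))%:E = \int[PU]_x (f x)%:E)%E.
  rewrite (ge0_integral_distribution (rv mU) (f := EFin \o f))//.
  exact/measurable_EFinP.
have EV : (\int[P]_w (g (V w))%:E = \int[PV]_x (g x)%:E)%E.
  rewrite (ge0_integral_distribution (rv mV) (f := EFin \o g))//.
  exact/measurable_EFinP.
rewrite EU EV -ge0_integralZr//; last 3 first.
- exact/measurable_EFinP.
- by move=> x _; rewrite lee_fin.
- by apply: integral_ge0 => x _; rewrite lee_fin.
apply: eq_integral => x _; rewrite /fubini_F /F /=.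
under eq_integral do rewrite EFinM.
rewrite ge0_integralZl//; first exact/measurable_EFinP.
  by move=> y _; rewrite lee_fin.
by rewrite lee_fin.
Qed.

(** The nonnegative case applied to 1 + f and 1 + g; the other terms of the
   expansion are known. *)
Lemma indep_integral_bounded (f g : R -> R) (a b : R) :
  measurable_fun setT f -> measurable_fun setT g ->
  (forall x, `|f x| <= 1) -> (forall x, `|g x| <= 1) ->
  (\int[P]_w (f (U w))%:E = a%:E)%E -> (\int[P]_w (g (V w))%:E = b%:E)%E ->
  (\int[P]_w (f (U w) * g (V w))%:E = (a * b)%:E)%E.
Proof.
move=> mf mg f1 g1 Ea Eb.
have mfU : measurable_fun setT (f \o U) by exact: measurableT_comp.
have mgV : measurable_fun setT (g \o V) by exact: measurableT_comp.
have i1 : P.-integrable setT (EFin \o cst 1).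
  by apply: (bounded_integrable P (K := 1)) => // w; rewrite normr1.
have iF : P.-integrable setT (EFin \o (f \o U))
  by exact: (bounded_integrable P mfU (fun w => f1 (U w))).
have iG : P.-integrable setT (EFin \o (g \o V))
  by exact: (bounded_integrable P mgV (fun w => g1 (V w))).
have iFG : P.-integrable setT (EFin \o (fun w => f (U w) * g (V w))).
  apply: (bounded_integrable P (K := 1)); first exact: measurable_funM.
  by move=> w; rewrite normrM mulr_ile1.
have f0 x : 0 <= 1 + f x by have := f1 x; rewrite ler_norml => /andP[+ _]; lra.
have g0 x : 0 <= 1 + g x by have := g1 x; rewrite ler_norml => /andP[+ _]; lra.
have m1f : measurable_fun setT (fun x => 1 + f x) by exact: measurable_funD.
have m1g : measurable_fun setT (fun x => 1 + g x) by exact: measurable_funD.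
have := indep_integral_ge0 m1f m1g f0 g0.
have -> : (\int[P]_w (1 + f (U w))%:E = (1 + a)%:E)%E.
  under eq_integral do rewrite /= EFinD.
  by rewrite integralD//= integral_cst1 Ea.
have -> : (\int[P]_w (1 + g (V w))%:E = (1 + b)%:E)%E.
  under eq_integral do rewrite /= EFinD.
  by rewrite integralD//= integral_cst1 Eb.
have -> : (\int[P]_w ((1 + f (U w)) * (1 + g (V w)))%:E =
    (1 + a + b)%:E + \int[P]_w (f (U w) * g (V w))%:E)%E.
  transitivity (\int[P]_w ((1%:E + (f (U w))%:E) + ((g (V w))%:E) + (f (U w) * g (V w))%:E))%E.
    by apply: eq_integral => w _; rewrite -!EFinD; congr EFin; rewrite /=; ring.
  rewrite integralD//; last by apply: integrableD => //; apply: integrableD.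
  rewrite integralD//; last exact: integrableD.
  by rewrite integralD// integral_cst1 Ea Eb.
have := integrable_fin_num measurableT iFG; rewrite /comp.
case: (\int[_]_x _)%E => // r _ [] E; congr EFin; lra.
Qed.

End Independence.

End Law.

(** * The Euler scheme driven by the Brownian increments *)

Section BorelVectors.
Variables (R : realType) (d : nat).

Lemma continuous_linear_form (u : 'cV[R]_d) :
  continuous (fun x : 'cV[R]_d => (u^T *m x) 0 0).
Proof.
have -> : (fun x : 'cV[R]_d => (u^T *m x) 0 0) = (fun x => \sum_i u i 0 * x i 0).
  by apply/funext => x; rewrite mxE; apply: eq_bigr => i _; rewrite mxE.
move=> x.
apply: (@cvg_big _ _ _ _ _ add_continuous _ (nbhs x) _ _ _ (nbhs_filter x)) => i _.
by apply: cvgMr; exact: coord_continuous.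
Qed.

Lemma borel_vec_linear_form (u : 'cV[R]_d) (B : set R) : measurable B ->
  borel_vec [set x : 'cV[R]_d | B ((u^T *m x) 0 0)].
Proof.
move=> mB; pose G := [set U : set 'cV[R]_d | open U].
have mf : measurable_fun setT
    ((fun x => (u^T *m x) 0 0) : g_sigma_algebraType G -> measurableTypeR R).
  apply: (@measurability _ _ (g_sigma_algebraType G) (measurableTypeR R) setT _ (@RGenOpens.G R)).
    exact: RGenOpens.measurableE.
  move=> _ [_ [a [b ->]] <-]; rewrite setTI; apply: sub_sigma_algebra.
  apply: open_comp; last exact: interval_open.
  by move=> x _; exact: continuous_linear_form.
by have := mf measurableT B mB; rewrite setTI.
Qed.

End BorelVectors.

Section EulerScheme.
Variables (R : realType) (d : nat) (disp : measure_display).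
Variables (Omega : measurableType disp) (P : probability Omega R).
Variables (F : R -> set (set Omega)) (W X : R -> Omega -> 'cV[R]_d).
Variables (A C : 'M[R]_d) (h : R).
Hypotheses (hF : filtration F) (hB : brownian_motion P F W).
Hypotheses (adX : adapted F X) (gX0 : centered_gaussian P (X 0) C).
Hypotheses (Csym : C^T = C) (C0 : forall u : 'cV[R]_d, 0 <= (u^T *m C *m u) 0 0).
Hypothesis h0 : 0 < h.

Definition euler_step : 'M[R]_d := 1 - h *: A.

Fixpoint euler (k : nat) (w : Omega) : 'cV[R]_d :=
  if k is k'.+1
  then euler_step *m euler k' w + (W (k'.+1%:R * h) w - W (k'%:R * h) w)
  else X 0 w.

Fixpoint euler_cov (k : nat) : 'M[R]_d :=
  if k is k'.+1 then euler_step *m euler_cov k' *m euler_step^T + h%:M else C.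

(** The covariance between the states of the scheme at steps k and l when the
   initial covariance is C: the later state is the earlier one propagated by
   the step matrix, plus independent noise. *)
Definition euler_crosscov (k l : nat) : 'M[R]_d :=
  if (l <= k)%N then euler_step ^+ (k - l) *m euler_cov l
  else (euler_step ^+ (l - k) *m euler_cov k)^T.

Let G := euler_step.
Let K := euler_crosscov.

Lemma euler_cov_sym k : (euler_cov k)^T = euler_cov k.
Proof.
elim: k => [//|k IH] /=.
by rewrite linearD /= !trmx_mul trmxK IH tr_scalar_mx mulmxA.
Qed.

Let K_tr k l : (K k l)^T = K l k.
Proof.
rewrite /K /euler_crosscov; case: ltngtP => [||->]; rewrite ?trmxK//.
by rewrite subnn expr0 mul1mx euler_cov_sym.
Qed.

Let K_Sl m l : (l <= m)%N -> K m.+1 l = G *m K m l.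
Proof.
by move=> lm; rewrite /K /euler_crosscov lm leqW// subSn// exprS -mulmxE mulmxA.
Qed.

Let K_Sr m l : (l <= m)%N -> K l m.+1 = K l m *m G^T.
Proof. by move=> lm; rewrite -K_tr K_Sl// trmx_mul K_tr. Qed.

Let K_SS m : K m.+1 m.+1 = G *m K m m *m G^T + h%:M.
Proof. by rewrite /K /euler_crosscov !leqnn !subnn !expr0 !mul1mx. Qed.

(** Measurability with respect to the past is phrased through the generated
   measurable type, so that the closure properties of real functions apply. *)
Let Fmeas (t : R) (f : Omega -> R) :=
  measurable_fun setT (f : g_sigma_algebraType (F t) -> measurableTypeR R).

Let FmeasP t f : 0 <= t -> (forall B, measurable B -> F t (f @^-1` B)) <-> Fmeas t f.
Proof.
move=> t0; have [sa _ _] := hF; have E := sigma_algebra_id (sa t t0).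
split=> [FB _ B mB|mf B mB].
  by rewrite setTI; apply: sub_sigma_algebra; exact: FB.
by rewrite -E; have := mf measurableT B mB; rewrite setTI.
Qed.

Let Fmeas_le s t f : 0 <= s -> s <= t -> Fmeas s f -> Fmeas t f.
Proof.
move=> s0 st /(FmeasP _ s0) mf; apply/(FmeasP _ (le_trans s0 st)) => B mB.
by have [_ _ /(_ s t s0 st)] := hF; apply; exact: mf.
Qed.

Let Fmeas_measurable t f : 0 <= t -> Fmeas t f -> measurable_fun setT f.
Proof.
move=> t0 /(FmeasP _ t0) mf _ B mB; rewrite setTI.
by have [_ /(_ t t0) + _] := hF; apply; exact: mf.
Qed.

Let adapted_form Y t (u : 'cV[R]_d) : adapted F Y -> 0 <= t ->
  Fmeas t (fun w => (u^T *m Y t w) 0 0).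
Proof.
move=> aY t0; apply/(FmeasP _ t0) => B mB.
exact: (aY t _ t0 (borel_vec_linear_form u mB)).
Qed.

Let th_ge0 k : 0 <= k%:R * h. Proof. by rewrite mulr_ge0// ltW. Qed.

Lemma euler_form_Fmeas k (u : 'cV[R]_d) :
  Fmeas (k%:R * h) (fun w => (u^T *m euler k w) 0 0).
Proof.
elim: k u => [|k IH] u.
  by rewrite mul0r; exact: adapted_form.
have kk : k%:R * h <= k.+1%:R * h by rewrite ler_wpM2r ?ler_nat// ltW.
have -> : (fun w => (u^T *m euler k.+1 w) 0 0) =
  (fun w => ((G^T *m u)^T *m euler k w) 0 0 +
     ((u^T *m W (k.+1%:R * h) w) 0 0 - (u^T *m W (k%:R * h) w) 0 0)).
  apply/funext => w; rewrite /= mulmxDr mulmxBr trmx_mul trmxK mulmxA.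
  by rewrite mxE; congr (_ + _); rewrite !mxE.
have [aW _ _ _ _] := hB.
apply: measurable_funD; first exact: Fmeas_le (IH _).
apply: measurable_funB; first exact: adapted_form.
by apply: Fmeas_le kk _ => //; exact: adapted_form.
Qed.

Lemma euler_form_measurable k (u : 'cV[R]_d) :
  measurable_fun setT (fun w => (u^T *m euler k w) 0 0).
Proof. exact: (Fmeas_measurable (th_ge0 k) (@euler_form_Fmeas k u)). Qed.

Let increment_law m (e : 'cV[R]_d) B : measurable B ->
  P [set w | B ((e^T *m (W (m.+1%:R * h) w - W (m%:R * h) w)) 0 0)] =
  centered_normal ((e^T *m h%:M *m e) 0 0) B.
Proof.
move=> mB; have [_ _ _ gW _] := hB.
have lt : m%:R * h < m.+1%:R * h by rewrite ltr_pM2r// ltr_nat.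
have E : m.+1%:R * h - m%:R * h = h by rewrite -mulrBl -natrB// subSnn mul1r.
have := gW _ _ (th_ge0 m) lt e B mB.
by rewrite E.
Qed.

(** Each step adds an independent Gaussian increment: a linear form of the
   scheme up to time m + 1 is one up to time m plus a form of the increment. *)
Theorem euler_forms_gaussian m n (t : 'I_n -> nat) (c : 'I_n -> 'cV[R]_d) :
  (forall i, (t i <= m)%N) ->
  let L w := \sum_i ((c i)^T *m euler (t i) w) 0 0 in
  let q := \sum_i \sum_j ((c i)^T *m euler_crosscov (t i) (t j) *m c j) 0 0 in
  (\int[P]_w (expR (L w))%:E = (expR (q / 2))%:E)%E /\
  (\int[P]_w (cos (L w))%:E = (expR (- (q / 2)))%:E)%E.
Proof.
elim: m t c => [|m IH] t c tm L q.
  have t0 i : t i = 0%N by apply/eqP; rewrite -leqn0.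
  pose e := \sum_i c i.
  have eT : e^T = \sum_i (c i)^T by rewrite /e linear_sum.
  have LE w : L w = (e^T *m X 0 w) 0 0.
    rewrite /L eT mulmx_suml summxE; apply: eq_bigr => i _.
    by rewrite t0.
  have qE : q = (e^T *m C *m e) 0 0.
    rewrite eT !mulmx_suml summxE; apply: eq_bigr => i _.
    rewrite mulmx_sumr summxE; apply: eq_bigr => j _.
    by rewrite !t0 /euler_crosscov leqnn subnn expr0 mul1mx.
  have mL : measurable_fun setT (fun w => (e^T *m X 0 w) 0 0).
    exact: (@euler_form_measurable 0 e).
  rewrite qE; split; under eq_integral do rewrite LE.
    by apply: centered_normal_mgf => // B mB; exact: gX0.
  by apply: centered_normal_cos => // B mB; exact: gX0.
(* The states at step m + 1 are rewritten in terms of those at step m: c'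
   absorbs the transposed step matrix and e collects the coefficients of the
   new increment. *)
pose t' i := minn (t i) m.
pose top i := t i == m.+1.
pose c' i := if top i then G^T *m c i else c i.
pose e := \sum_(i | top i) c i.
have t'm i : (t' i <= m)%N by exact: geq_minr.
have ntop i : ~~ top i -> (t i <= m)%N /\ t' i = t i.
  move=> ti; have tim : (t i <= m)%N by rewrite -ltnS ltn_neqAle ti tm.
  by rewrite /t' (minn_idPl tim).
have topE i : top i -> t i = m.+1 /\ t' i = m.
  by move=> /eqP ti; rewrite /t' ti; split=> //; apply/minn_idPr.
have [Eexp Ecos] := IH t' c' t'm.
set L' := fun w => \sum_i ((c' i)^T *m euler (t' i) w) 0 0.
set q' := \sum_i \sum_j ((c' i)^T *m euler_crosscov (t' i) (t' j) *m c' j) 0 0.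
rewrite -/q' in Eexp Ecos.
have eT : e^T = \sum_(i | top i) (c i)^T by rewrite /e linear_sum.
pose xi w := W (m.+1%:R * h) w - W (m%:R * h) w.
pose V w := (e^T *m xi w) 0 0.
have LE w : L w = L' w + V w.
  rewrite /V eT mulmx_suml summxE [X in _ + X]big_mkcond -big_split.
  apply: eq_bigr => i _ /=; rewrite /c'; case: ifPn => [/topE[-> ->]|/ntop[_ ->]].
    by rewrite /= mulmxDr trmx_mul trmxK mulmxA mxE.
  by rewrite addr0.
have qE : q = q' + (e^T *m h%:M *m e) 0 0.
  have -> : (e^T *m h%:M *m e) 0 0 =
      \sum_i \sum_j (if top i && top j then ((c i)^T *m h%:M *m c j) 0 0 else 0).
    rewrite eT !mulmx_suml summxE big_mkcond; apply: eq_bigr => i _ /=.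
    case: (top i) => /=; last by rewrite big1.
    by rewrite mulmx_sumr summxE big_mkcond.
  rewrite -big_split; apply: eq_bigr => i _ /=; rewrite -big_split.
  apply: eq_bigr => j _ /=; rewrite -/(K _ _) -/(K _ _) /c'.
  case: ifPn => [/topE[-> ->]|/ntop[ti ->]] /=; case: ifPn => [/topE[-> ->]|/ntop[tj ->]].
  - by rewrite K_SS mulmxDr mulmxDl mxE trmx_mul trmxK !mulmxA.
  - by rewrite K_Sl// trmx_mul trmxK !mulmxA addr0.
  - by rewrite K_Sr// !mulmxA addr0.
  - by rewrite addr0.
clearbody e.
have FL' : Fmeas (m%:R * h) L'.
  apply: measurable_sum => i.
  apply: Fmeas_le (@euler_form_Fmeas _ _) => //.
  by rewrite ler_wpM2r ?ler_nat// ltW.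
have mL' := Fmeas_measurable (th_ge0 m) FL'.
have mV : measurable_fun setT V.
  have [aW _ _ _ _] := hB.
  have -> : V = (fun w => (e^T *m W (m.+1%:R * h) w) 0 0 - (e^T *m W (m%:R * h) w) 0 0).
    by apply/funext => w; rewrite /V /xi mulmxBr !mxE.
  by apply: measurable_funB; apply: Fmeas_measurable (adapted_form _ aW (th_ge0 _)); exact: th_ge0.
have v0 : 0 <= (e^T *m h%:M *m e) 0 0.
  by rewrite -scalemx1 -scalemxAr mulmx1 -scalemxAl mxE -sqnormE mulr_ge0 ?sqnorm_ge0// ltW.
have indep A' B : measurable A' -> measurable B ->
    P ([set w | A' (L' w)] `&` [set w | B (V w)]) =
    (P [set w | A' (L' w)] * P [set w | B (V w)])%E.
  move=> mA mB; have [_ _ _ _ iW] := hB.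
  have lt : m%:R * h < m.+1%:R * h by rewrite ltr_pM2r// ltr_nat.
  apply: (iW _ _ (th_ge0 m) lt _ [set x | B ((e^T *m x) 0 0)]).
    exact: ((FmeasP _ (th_ge0 m)).2 FL').
  exact: borel_vec_linear_form.
have lawV := increment_law m e.
have Vexp := centered_normal_mgf mV v0 lawV.
have Vcos := centered_normal_cos mV v0 lawV.
have msin : measurable_fun setT (@sin R).
  by apply: continuous_measurable_fun; exact: continuous_sin.
have mcos := @measurable_cos R.
(* The increment has a symmetric law: this removes the sine product from the
   expansion of cos (L' + V). *)
have Vsin : (\int[P]_w (sin (V w))%:E = 0%:E)%E.
  have mN : measurable_fun setT (fun w => - V w) by exact: measurable_funN.
  have eN : (- e)^T = - e^T by exact: linearN.
  have NE w : - V w = ((- e)^T *m xi w) 0 0 by rewrite eN mulNmx [RHS]mxE.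
  have := @same_law_integral _ _ _ P V (fun w => - V w) (@sin R) mV mN msin (@sin_max R).
  have lawN B : measurable B -> P [set w | B (V w)] = P [set w | B (- V w)].
    move=> mB; rewrite lawV//.
    have -> : [set w | B (- V w)] = [set w | B (((- e)^T *m xi w) 0 0)].
      by apply/funext => w /=; rewrite NE.
    rewrite [RHS](increment_law m (- e) mB); congr (centered_normal _ B).
    by rewrite eN mulNmx mulNmx mulmxN opprK.
  move=> /(_ lawN); under [X in _ = X -> _]eq_integral do rewrite sinN EFinN.
  have iV : P.-integrable setT (EFin \o (@sin R \o V)).
    exact: (bounded_integrable P (measurableT_comp msin mV) (fun w => sin_max (V w))).
  rewrite integralN//=; last exact: integrable_add_def iV.
  have := integrable_fin_num measurableT iV; rewrite /comp.
  case: (\int[_]_x _)%E => // r _ [] E; congr EFin; lra.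
split; under eq_integral do rewrite LE.
  under eq_integral do rewrite expRD.
  rewrite (indep_integral_ge0 mL' mV indep (f := expR) (g := expR))//.
  by rewrite Eexp Vexp -EFinM -expRD qE mulrDl.
have isL : P.-integrable setT (EFin \o (@sin R \o L')).
  exact: (bounded_integrable P (measurableT_comp msin mL') (fun w => sin_max (L' w))).
have [a Ea] : exists a : R, (\int[P]_w (sin (L' w))%:E = a%:E)%E.
  have := integrable_fin_num measurableT isL; rewrite /comp.
  by case: (\int[_]_x _)%E => // r _; exists r.
under eq_integral do rewrite cosD EFinB.
have ip (f g : R -> R) : measurable_fun setT f -> measurable_fun setT g ->
    (forall x, `|f x| <= 1) -> (forall x, `|g x| <= 1) ->
    P.-integrable setT (fun w => (f (L' w) * g (V w))%:E).
  move=> mf mg f1 g1; apply: (bounded_integrable P (K := 1)) => [|w].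
    apply: measurable_funM; first exact: (measurableT_comp mf).
    exact: (measurableT_comp mg).
  by rewrite normrM mulr_ile1.
rewrite integralB//; last 2 first.
- by apply: ip => // x; exact: cos_max.
- by apply: ip => // x; exact: sin_max.
rewrite (indep_integral_bounded mL' mV indep mcos mcos (@cos_max R) (@cos_max R) Ecos Vcos).
rewrite (indep_integral_bounded mL' mV indep msin msin (@sin_max R) (@sin_max R) Ea Vsin).
by rewrite mulr0 sube0 -expRD qE mulrDl opprD.
Qed.

End EulerScheme.

(** * Pathwise convergence of the Euler scheme *)

Section UniformContinuity.
Variable R : realType.
Notation mu := (@lebesgue_measure R).

Lemma uniformly_continuous_segment (f : R -> R) (T e : R) : continuous f -> 0 < e ->
  exists2 del, 0 < del & forall s t, 0 <= s <= T -> `|s - t| <= del ->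
    `|f s - f t| <= e.
Proof.
move=> cf e0; have cpt : compact (`[0, T]%classic : set R) by exact: segment_compact.
have e2 : 0 < e / 2 by rewrite divr_gt0.
pose Q (del s : R) := forall t, `|s - t| <= del -> `|f s - f t| <= e.
have : \forall del \near (0 : R)^'+, `[0, T]%classic `<=` Q del.
  apply: ((compact_near_coveringP _).1 cpt) => x _.
  have /cvgrPdist_le/(_ _ e2)/nbhs_ballP[r /= r0 xr] := cf x.
  have r2 : 0 < r / 2 by rewrite divr_gt0.
  exists ([set s | `|x - s| < r / 2], [set del | del < r / 2]) => /=.
    split; first by apply/nbhs_ballP; exists (r / 2).
    exact: nbhs_right_lt.
  move=> [s del] /= [xs dr] t st.
  have h1 : `|f x - f s| <= e / 2 by apply: xr; rewrite /ball /= ; lra.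
  have h2 : `|f x - f t| <= e / 2.
    apply: xr; rewrite /ball /=.
    by have := ler_normD (x - s) (s - t); rewrite subrKA; lra.
  by have := ler_distD (f x) (f s) (f t); rewrite (distrC (f s) (f x)); lra.
move=> h; near ((0 : R)^'+) => del.
have d0 : 0 < del by near: del; exact: nbhs_right_gt.
exists del => // s t sT; have hd : `[0, T]%classic `<=` Q del by near: del.
by apply: hd; rewrite /= in_itv.
Unshelve. all: by end_near. Qed.

Lemma continuous_segment_integrable (g : R -> R) (a b : R) : continuous g ->
  mu.-integrable `[a, b] (EFin \o g).
Proof.
move=> cg; apply: continuous_compact_integrable; first exact: segment_compact.
exact: continuous_subspaceT.
Qed.

Lemma increment_integral_le (g : R -> R) (s t c b : R) : continuous g ->
  0 <= s -> s <= t -> (forall u, s <= u <= t -> `|g u - c| <= b) ->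
  `|\int[mu]_(u in `[0, t]) g u - \int[mu]_(u in `[0, s]) g u - (t - s) * c|
    <= (t - s) * b.
Proof.
move=> cg s0 st gb.
have lenE : fine (mu `]s, t]) = t - s.
  rewrite lebesgue_measure_itv /= lte_fin; case: ltP => // ts.
  have -> : t - s = 0 by lra.
  by [].
have int0 := continuous_segment_integrable 0 t cg.
rewrite Rintegral_itvB//.
have sub : `]s, t] `<=` `[0, t].
  by apply: subset_itvScc; rewrite ?bnd_simp.
have ints : mu.-integrable `]s, t] (EFin \o g).
  by apply: integrableS int0.
have intc k : mu.-integrable `]s, t] (EFin \o cst k).
  have ck : continuous (cst k : R -> R) by move=> x; exact: cvg_cst.
  by apply: integrableS (continuous_segment_integrable 0 t ck).
have -> : (t - s) * c = \int[mu]_(u in `]s, t]) (cst c u).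
  by rewrite Rintegral_cst// lenE mulrC.
rewrite -RintegralB//.
have intd : mu.-integrable `]s, t] (EFin \o (fun u => g u - cst c u)).
  exact: (integrableB _ ints (intc c)).
apply: (le_trans (le_normr_Rintegral _ intd)) => //.
have -> : (t - s) * b = \int[mu]_(u in `]s, t]) (cst b u).
  by rewrite Rintegral_cst// lenE mulrC.
apply: le_Rintegral => //.
  by have := integrable_abse intd.
move=> u; rewrite /= in_itv/= => /andP[su ut]; apply: gb.
by rewrite (ltW su).
Qed.

End UniformContinuity.

Section EulerConvergence.
Variables (R : realType) (d : nat).
Variables (disp : measure_display) (Omega : measurableType disp).
Variables (W X : R -> Omega -> 'cV[R]_d) (A : 'M[R]_d) (w : Omega).
Hypothesis contX : {within `[0, +oo[, continuous (fun t => X t w)}.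
Hypothesis eqX : forall t, 0 <= t ->
  X t w = X 0 w - (\col_i \int[lebesgue_measure]_(s in `[0, t]) (A *m X s w) i 0)
          + W t w.

(** The positive part: freezing the path at its initial value for negative times
   makes it continuous on the whole line. *)
Let pos (t : R) := (t + `|t|) / 2.
Let pos_id t : 0 <= t -> pos t = t.
Proof. by move=> t0; rewrite /pos ger0_norm//; lra. Qed.
Let pos_ge0 t : 0 <= pos t.
Proof. by rewrite /pos; have := ler_norm (- t); rewrite normrN; lra. Qed.
Let cpos : continuous pos.
Proof.
move=> t; apply: cvgMl; apply: cvgD; first exact: cvg_id.
exact: norm_continuous.
Qed.

Let x (t : R) : 'cV[R]_d := X (pos t) w.

Let cx : continuous x.
Proof.
move=> t; have /subspace_continuousP/(_ (pos t)) := contX.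
rewrite /= in_itv/= andbT => /(_ (pos_ge0 t)) c.
have cp : pos s @[s --> t] --> within `[0, +oo[ (nbhs (pos t)).
  move=> V nV.
  have near_t : \forall s \near t, (`[0, +oo[%classic : set R) (pos s) -> V (pos s).
    exact: (@cpos t _ nV).
  suff : \forall s \near t, V (pos s) by [].
  by apply: filterS near_t => s; apply; rewrite /= in_itv/= andbT.
exact: (cvg_comp _ _ cp c).
Qed.

Let cxi (i : 'I_d) : continuous (fun t => x t i 0).
Proof.
move=> t; apply: (@continuous_comp _ _ _ x (fun M : 'cV[R]_d => M i 0)).
  exact: cx.
exact: coord_continuous.
Qed.

Let cAx (i : 'I_d) : continuous (fun t => (A *m x t) i 0).
Proof.
have -> : (fun t => (A *m x t) i 0) = (fun t => \sum_j A i j * x t j 0).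
  by apply/funext => t; rewrite mxE.
move=> t.
apply: (@cvg_big _ _ _ _ _ add_continuous _ (nbhs t) _ _ _ (nbhs_filter t)) => j _.
by apply: cvgMr; exact: cxi.
Qed.

Lemma uniformly_continuous_path (T e : R) : 0 < e ->
  exists2 del, 0 < del & forall s t, 0 <= s <= T -> 0 <= t -> `|s - t| <= del ->
    l1norm (X s w - X t w) <= e.
Proof.
move=> e0; pose e' := e / (d%:R + 1).
have e'0 : 0 < e' by rewrite divr_gt0// ltr_wpDl.
have /choice [del h] : forall i : 'I_d, exists del, 0 < del /\
    forall s t, 0 <= s <= T -> `|s - t| <= del -> `|x s i 0 - x t i 0| <= e'.
  by move=> i; have [del d0 h] := uniformly_continuous_segment T (@cxi i) e'0; exists del.
exists (\big[Num.min/1]_i del i) => [|s t sT t0 st].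
  elim/big_ind: _ => [||i _]; first exact: ltr01.
    by move=> a b a0 b0; rewrite lt_min a0.
  by have [] := h i.
rewrite /l1norm; apply: (@le_trans _ _ (\sum_(i < d) e')).
  apply: ler_sum => i _; rewrite big_ord1 !mxE.
  have [_ /(_ s t sT)] := h i; rewrite /x !pos_id//; last by case/andP: sT.
  apply; apply: (le_trans st); exact: bigmin_le_cond.
rewrite sumr_const card_ord -[e' *+ d]mulr_natr /e' -mulrA ler_piMr ?ltW//.
by rewrite mulrC ltr_pdivrMr ?ltr_wpDl// mul1r ltrDl.
Qed.

(** One step of the scheme misses the drift by its oscillation over the step. *)
Let one_step (s t e : R) : 0 <= s -> s <= t ->
  (forall u, s <= u <= t -> l1norm (X u w - X s w) <= e) ->
  l1norm (X t w - (X s w - (t - s) *: (A *m X s w) + (W t w - W s w)))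
    <= d%:R * ((t - s) * (l1norm A * e)).
Proof.
move=> s0 st h; have t0 := le_trans s0 st.
rewrite /l1norm mulr_natl -[X in _ *+ X]card_ord -sumr_const.
apply: ler_sum => i _; rewrite big_ord1.
have intE r : 0 <= r -> \int[lebesgue_measure]_(u in `[0, r]) (A *m X u w) i 0 =
    \int[lebesgue_measure]_(u in `[0, r]) (A *m x u) i 0.
  move=> r0; apply: eq_Rintegral => u; rewrite inE/= in_itv/= => /andP[u0 _].
  by rewrite /x pos_id.
have gb u : s <= u <= t -> `|(A *m x u) i 0 - (A *m X s w) i 0| <= l1norm A * e.
  move=> /andP[su ut]; rewrite /x pos_id; last exact: le_trans su.
  have -> : (A *m X u w) i 0 - (A *m X s w) i 0 = (A *m (X u w - X s w)) i 0.
    by rewrite mulmxBr; move: (A *m _) (A *m _) => M N; rewrite !mxE.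
  apply: (le_trans (entry_le_l1norm _ _ _)); apply: (le_trans (l1normM _ _)).
  by rewrite ler_wpM2l ?l1norm_ge0// h// su.
apply: le_trans (increment_integral_le (@cAx i) s0 st gb).
rewrite le_eqVlt; apply/orP; left; apply/eqP; rewrite -normrN; congr `|_|.
have Et := congr1 (fun v : 'cV[R]_d => v i 0) (eqX t0).
have Es := congr1 (fun v : 'cV[R]_d => v i 0) (eqX s0).
move: Et Es; move: (A *m X s w) => M.
rewrite !mxE !intE// => -> ->; ring.
Qed.

Let eul (h : R) (k : nat) : 'cV[R]_d := euler W X A h k w.

(** Discrete Gronwall inequality: the local errors are amplified by a factor
   1 + h |A| at each step. *)
Let error_bound (h e T : R) k : 0 < h -> 0 <= e -> k%:R * h <= T ->
  (forall s t, 0 <= s <= T -> 0 <= t -> `|s - t| <= h -> l1norm (X s w - X t w) <= e) ->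
  l1norm (X (k%:R * h) w - eul h k)
    <= k%:R * (d%:R * (h * (l1norm A * e))) * (1 + h * l1norm A) ^+ k.
Proof.
move=> h0 e0 kT H; have hA : 0 <= h * l1norm A by rewrite mulr_ge0 ?l1norm_ge0// ltW.
elim: k kT => [|k IH] kT.
  by rewrite /= !mul0r subrr /l1norm big1// => i _; rewrite big1// => j _; rewrite mxE normr0.
have k0 : 0 <= k%:R * h by rewrite mulr_ge0// ltW.
have kk : k%:R * h <= k.+1%:R * h by rewrite ler_wpM2r ?ler_nat// ltW.
have kh : k.+1%:R * h - k%:R * h = h by rewrite -mulrBl -natrB// subSnn mul1r.
have {}IH := IH (le_trans kk kT).
have step : l1norm (X (k.+1%:R * h) w - (X (k%:R * h) w - h *: (A *m X (k%:R * h) w)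
    + (W (k.+1%:R * h) w - W (k%:R * h) w))) <= d%:R * (h * (l1norm A * e)).
  have Hu u : k%:R * h <= u <= k.+1%:R * h -> l1norm (X u w - X (k%:R * h) w) <= e.
    move=> /andP[u1 u2]; apply: H => //; first by rewrite (le_trans k0 u1) (le_trans u2 kT).
    by rewrite ger0_norm ?subr_ge0//; lra.
  by have := one_step k0 kk Hu; rewrite kh.
set D := d%:R * _ in step IH *.
have D0 : 0 <= D by rewrite mulr_ge0// mulr_ge0 ?(ltW h0)// mulr_ge0// l1norm_ge0.
set Xk1 := X (k.+1%:R * h) w in step *; set Xk := X (k%:R * h) w in step IH *.
have -> : Xk1 - eul h k.+1 =
    (Xk1 - (Xk - h *: (A *m Xk) + (W (k.+1%:R * h) w - W (k%:R * h) w)))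
    + ((Xk - eul h k) + (- h) *: (A *m (Xk - eul h k))).
  rewrite /eul /= /euler_step mulmxBl mul1mx -scalemxAl mulmxBr scalerBr scaleNr.
  move: (A *m Xk) (A *m euler W X A h k w) (W _ w) (W _ w) (euler W X A h k w) => M N V V' Y.
  by apply/matrixP => i j; rewrite !mxE; ring.
apply: (le_trans (l1normD _ _)).
have e1 : l1norm ((Xk - eul h k) + (- h) *: (A *m (Xk - eul h k)))
    <= (1 + h * l1norm A) * l1norm (Xk - eul h k).
  apply: (le_trans (l1normD _ _)); rewrite l1normZ normrN gtr0_norm// mulrDl mul1r lerD2l.
  by rewrite -mulrA ler_wpM2l ?l1normM// ltW.
have q1 : 1 <= (1 + h * l1norm A) ^+ k.+1 by rewrite exprn_ege1// lerDl.
have e2 := ler_wpM2l (addr_ge0 ler01 hA) IH.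
apply: (le_trans (lerD step (le_trans e1 e2))).
have -> : k.+1%:R * D * (1 + h * l1norm A) ^+ k.+1 =
    D * (1 + h * l1norm A) ^+ k.+1 + (1 + h * l1norm A) * (k%:R * D * (1 + h * l1norm A) ^+ k).
  by rewrite -(natr1 k) exprS; ring.
by rewrite lerD2r ler_peMr.
Qed.

(** The number of steps is of order 1 / h, so the amplification stays below
   exp (|A| T), while the local errors are h times the oscillation of the path
   at scale h. *)
Lemma euler_path_cvg (D : R) (i : nat) : 0 < D ->
  (fun N : nat => l1norm (X (i%:R * D) w - euler W X A (D / N.+1%:R) (i * N.+1) w)) @ \oo --> 0.
Proof.
move=> D0; apply/cvgr0Pnorm_le => eps eps0.
set a := l1norm A; set T := i%:R * D.
have T0 : 0 <= T by rewrite mulr_ge0// ltW.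
pose c := T * (d%:R * a) * expR (a * T).
have a0 : 0 <= a by exact: l1norm_ge0.
have c0 : 0 <= c by apply: mulr_ge0; [apply: mulr_ge0 => //; exact: mulr_ge0|exact: expR_ge0].
pose e := eps / (c + 1).
have c1 : 0 < c + 1 by rewrite ltr_wpDl.
have e0 : 0 < e by rewrite divr_gt0.
have [del del0 H] := uniformly_continuous_path T e0.
near=> N.
have N0 : 0 < N.+1%:R :> R by [].
set h := D / N.+1%:R.
have h0 : 0 < h by rewrite divr_gt0.
have hd : h <= del.
  rewrite ler_pdivrMr// -ler_pdivrMl// mulrC.
  have : D / del <= N%:R by near: N; exact: nbhs_infty_ger.
  by move/le_trans; apply; rewrite ler_nat.
have kT : (i * N.+1)%:R * h = T.
  by rewrite /h natrM -mulrA [N.+1%:R * _]mulrC divfK ?gt_eqF.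
have := @error_bound h e T (i * N.+1) h0 (ltW e0).
rewrite kT lexx => /(_ isT (fun s t sT t0 st => H s t sT t0 (le_trans st hd))) B.
rewrite ger0_norm ?l1norm_ge0//; apply: (le_trans B).
have hA : 0 <= h * a by rewrite mulr_ge0 ?l1norm_ge0// ltW.
have pow : (1 + h * a) ^+ (i * N.+1) <= expR (a * T).
  apply: (@le_trans _ _ (expR (h * a) ^+ (i * N.+1))).
    by rewrite lerXn2r ?nnegrE ?expR_ge0 ?expR_ge1Dx// addr_ge0.
  by rewrite -expRM_natl mulrA kT mulrC.
apply: (@le_trans _ _ (c * e)).
  have -> : (i * N.+1)%:R * (d%:R * (h * (a * e))) = T * (d%:R * a) * e.
    by rewrite -kT; ring.
  rewrite /c [X in _ <= X]mulrAC; apply: ler_wpM2l => //.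
  by apply: mulr_ge0; [apply: mulr_ge0 => //; exact: mulr_ge0|exact: ltW].
by rewrite /e mulrCA ler_piMr ?(ltW eps0)// ler_pdivrMr// mul1r lerDl.
Unshelve. all: by end_near. Qed.

End EulerConvergence.

(** * Covariance of the scheme as the mesh vanishes *)

Section EulerCovariance.
Variables (R : realType) (d : nat).
Variables (A : 'M[R]_d) (P : 'M[R[i]]_d) (tau : 'rV[R[i]]_d) (m lmin lmax : R).
Hypotheses (hA : stable_diagonalizable A P tau m)
  (hE : extreme_eigenvalues (stationary_cov A) lmin lmax) (lmin0 : 0 < lmin).

Lemma stable_cond_number_ge1 : 1 <= cond_number P.
Proof. by have [Pu _ [[i0 _ _] _] _] := hA; exact: cond_number_ge1. Qed.

Let C := stationary_cov A.
Let Csym : C^T = C. Proof. exact: stationary_cov_sym. Qed.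
Let a := l1norm A.
Let a0 : 0 <= a. Proof. exact: l1norm_ge0. Qed.

Lemma stationary_cov_psd (u : 'cV[R]_d) : 0 <= (u^T *m C *m u) 0 0.
Proof.
have [U [l [UU ES]]] := real_spectral Csym.
have -> : (u^T *m C *m u) 0 0 = ((U *m u)^T *m diag_mx l *m (U *m u)) 0 0.
  by rewrite ES trmx_mul !mulmxA.
rewrite quad_diag; apply: sumr_ge0 => j _; rewrite mulr_ge0 ?sqr_ge0//.
apply: (le_trans (ltW lmin0)); have [[_ lb] _] := hE.
by apply: lb => /=; exact: spectral_eigenvalue ES.
Qed.

Let l1norm_step (h : R) (M : 'M[R]_d) : 0 <= h ->
  l1norm (euler_step A h *m M) <= (1 + h * a) * l1norm M.
Proof.
move=> h0; rewrite /euler_step mulmxBl mul1mx -scalemxAl mulrDl mul1r.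
apply: (le_trans (l1normD _ _)); rewrite l1normN l1normZ ger0_norm//.
by rewrite lerD2l -mulrA ler_wpM2l ?l1normM.
Qed.

Let l1norm_steps (h : R) k (M : 'M[R]_d) : 0 <= h ->
  l1norm (euler_step A h ^+ k *m M) <= (1 + h * a) ^+ k * l1norm M.
Proof.
move=> h0; elim: k => [|k IH]; first by rewrite !expr0 mul1mx mul1r.
rewrite !exprS -mulmxE -mulmxA -mulrA; apply: (le_trans (l1norm_step _ h0)).
by rewrite ler_wpM2l// addr_ge0// mulr_ge0.
Qed.

(** The Lyapunov equation cancels the first-order term of one step. *)
Let step_stationary (h : R) :
  euler_step A h *m C *m (euler_step A h)^T + h%:M = C + h ^+ 2 *: (A *m C *m A^T).
Proof.
have L := lyapunov_equation hA; rewrite -/C in L.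
have -> : h%:M = h *: (A *m C) + h *: (C *m A^T) by rewrite -scalerDr L scalemx1.
have gT : (euler_step A h)^T = 1 - h *: A^T by rewrite linearB/= trmx1 linearZ.
rewrite gT /euler_step mulmxBl mul1mx mulmxBr mulmx1 mulmxBl -!scalemxAl -!scalemxAr.
rewrite scalerA -expr2; move: (A *m C) (C *m A^T) (A *m C *m A^T) => M N Q.
by apply/matrixP => i j; rewrite !mxE; ring.
Qed.

(** By [step_stationary] one step adds an error of order h^2, and multiplies the
   earlier ones by at most (1 + h |A|)^2: over a bounded time the gap is of
   order h. *)
Lemma euler_cov_close (h : R) l : 0 <= h ->
  l1norm (euler_cov A C h l - C) <=
    l%:R * (h ^+ 2 * l1norm (A *m C *m A^T)) * (1 + h * a) ^+ (2 * l).
Proof.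
move=> h0; elim: l => [|l IH].
  by rewrite /= subrr !mul0r /l1norm big1// => i _; rewrite big1// => j _; rewrite mxE normr0.
set c := h ^+ 2 * _ in IH *; have c0 : 0 <= c by rewrite mulr_ge0 ?sqr_ge0 ?l1norm_ge0.
have q1 : 1 <= 1 + h * a by rewrite lerDl mulr_ge0.
have q0 : 0 <= 1 + h * a by exact: le_trans q1.
have -> : euler_cov A C h l.+1 - C =
    euler_step A h *m (euler_cov A C h l - C) *m (euler_step A h)^T
    + h ^+ 2 *: (A *m C *m A^T).
  rewrite -[euler_cov A C h l.+1]/
    (euler_step A h *m euler_cov A C h l *m (euler_step A h)^T + h%:M).
  have := step_stationary h; move: (euler_step A h) => G; rewrite mulmxBr mulmxBl.
  move: (G *m C *m G^T) (G *m euler_cov A C h l *m G^T) (h ^+ 2 *: _) (h%:M).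
  move=> M N Q H /(canRL (addrK _)) ->.
  by apply/matrixP => i j; rewrite !mxE; ring.
apply: (le_trans (l1normD _ _)); rewrite l1normZ ger0_norm ?sqr_ge0// -/c.
have e1 : l1norm (euler_step A h *m (euler_cov A C h l - C) *m (euler_step A h)^T)
    <= (1 + h * a) * ((1 + h * a) * l1norm (euler_cov A C h l - C)).
  rewrite -l1norm_tr trmx_mul trmxK; apply: (le_trans (l1norm_step _ h0)).
  by rewrite ler_wpM2l// l1norm_tr l1norm_step.
have e2 := ler_wpM2l q0 (ler_wpM2l q0 IH).
apply: (le_trans (lerD (le_trans e1 e2) (lexx _))).
have -> : l.+1%:R * c * (1 + h * a) ^+ (2 * l.+1) =
    (1 + h * a) * ((1 + h * a) * (l%:R * c * (1 + h * a) ^+ (2 * l)))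
     + c * (1 + h * a) ^+ (2 * l.+1).
  by rewrite -(natr1 l) mulnS !exprS; ring.
by rewrite lerD2l ler_peMr// exprn_ege1.
Qed.

Let q Delta := expR (- (m * Delta)).

Lemma quad_le_l1norm (v : 'cV[R]_d) (M : 'M[R]_d) :
  `|(v^T *m M *m v) 0 0| <= l1norm v ^+ 2 * l1norm M.
Proof.
apply: (le_trans (entry_le_l1norm _ _ _)); apply: (le_trans (l1normM _ _)).
have -> : l1norm v ^+ 2 * l1norm M = l1norm v^T * l1norm M * l1norm v.
  by rewrite l1norm_tr; ring.
by rewrite ler_wpM2r ?l1norm_ge0// l1normM.
Qed.

Lemma euler_crosscov_tr (h : R) k l :
  (euler_crosscov A C h k l)^T = euler_crosscov A C h l k.
Proof.
rewrite /euler_crosscov; case: ltngtP => [||->]; rewrite ?trmxK//.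
by rewrite subnn expr0 mul1mx euler_cov_sym.
Qed.

Lemma quad_crosscov_sym (v : 'cV[R]_d) (h : R) k l :
  (v^T *m euler_crosscov A C h k l *m v) 0 0 = (v^T *m euler_crosscov A C h l k *m v) 0 0.
Proof.
rewrite -[in RHS]euler_crosscov_tr.
have -> : v^T *m (euler_crosscov A C h k l)^T *m v = (v^T *m euler_crosscov A C h k l *m v)^T.
  by rewrite !trmx_mul trmxK mulmxA.
by rewrite [RHS]mxE.
Qed.

(** Up to an error of order h, both states have covariance C, and
   [euler_contraction] applies to the vector C v, of norm at most lmax. *)
Lemma euler_crosscov_limit (v : 'cV[R]_d) (Delta eps : R) n : l2norm v = 1 ->
  0 < Delta -> 0 < eps -> \forall N \near \oo, forall i j, (i < n)%N -> (j < n)%N ->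
    let S := (v^T *m euler_crosscov A C (Delta / N.+1%:R) (i * N.+1) (j * N.+1) *m v) 0 0 in
    `|S| <= lmax * (cond_number P * q Delta ^+ (i - j + (j - i))) + eps /\
    (i = j -> `|S - (v^T *m C *m v) 0 0| <= eps).
Proof.
move=> v1 D0 eps0; have [K K0 contr] := euler_contraction hA.
have lmax0 : 0 <= lmax by have [[h1 h2] [h3 _]] := hE; exact: le_trans (ltW lmin0) (h2 _ h3).
set p0 := cond_number P.
have p00 : 0 <= p0 by apply: le_trans stable_cond_number_ge1.
pose T := n%:R * Delta; have T0 : 0 <= T by rewrite mulr_ge0// ltW.
pose c := l1norm (A *m C *m A^T); have c0 : 0 <= c by exact: l1norm_ge0.
pose M := l1norm v ^+ 2 * (expR (a * T) ^+ 3 * (T * c)).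
pose err (h : R) := lmax * p0 * (expR (K * T * h) - 1) + M * h.
have err_cvg : err h @[h --> 0] --> 0.
  have E : err 0 = 0 by rewrite /err !mulr0 expR0 subrr mulr0 addr0.
  rewrite -[X in _ --> X]E; apply: cvgD; apply: cvgMr; last exact: cvg_id.
  apply: cvgB; last exact: cvg_cst.
  apply: (@continuous_comp _ _ _ (fun h : R => K * T * h) (@expR R)); last exact: continuous_expR.
  by apply: cvgMr; exact: cvg_id.
have hN_cvg : (Delta / N.+1%:R) @[N --> \oo] --> (0 : R).
  rewrite -[X in _ --> X](mulr0 Delta); apply: cvgMr; exact: cvg_harmonic.
have err_near : \forall N \near \oo, err (Delta / N.+1%:R) <= eps.
  have /cvgrPdist_le/(_ _ eps0) := cvg_comp _ _ hN_cvg err_cvg.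
  by apply: filterS => N /=; rewrite sub0r normrN => /(le_trans (ler_norm _)).
apply: filterS err_near => N; set h := Delta / N.+1%:R => err_le i j iN jN.
have h0 : 0 < h by exact: divr_gt0.
have hNE k : (k * N.+1)%:R * h = k%:R * Delta.
  by rewrite /h natrM -mulrA [N.+1%:R * _]mulrC divfK ?gt_eqF.
have pow k : (k <= n)%N -> (1 + h * a) ^+ (k * N.+1) <= expR (a * T).
  move=> kn; apply: (@le_trans _ _ (expR (h * a) ^+ (k * N.+1))).
    by rewrite lerXn2r ?nnegrE ?expR_ge0 ?expR_ge1Dx// addr_ge0// mulr_ge0// ltW.
  rewrite -expRM_natl mulrA hNE mulrC ler_expR ler_wpM2l// ler_wpM2r ?ler_nat//.
  exact: ltW.
have close l k : (l < n)%N -> (k <= n)%N ->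
    `|(v^T *m (euler_step A h ^+ (k * N.+1) *m (euler_cov A C h (l * N.+1) - C)) *m v) 0 0|
    <= M * h.
  move=> ln kn; apply: (le_trans (quad_le_l1norm _ _)).
  have -> : M * h = l1norm v ^+ 2 * (expR (a * T) ^+ 3 * (T * (c * h))) by rewrite /M; ring.
  apply: ler_wpM2l; first exact: sqr_ge0.
  apply: (le_trans (l1norm_steps _ _ (ltW h0))).
  have e := euler_cov_close (l * N.+1) (ltW h0); rewrite -/c in e.
  have -> : expR (a * T) ^+ 3 * (T * (c * h)) = expR (a * T) * (T * (h * c) * expR (a * T) ^+ 2).
    by ring.
  apply: ler_pM; rewrite ?exprn_ge0 ?l1norm_ge0 ?pow//.
    by rewrite addr_ge0// mulr_ge0// ltW.
  apply: (le_trans e); apply: ler_pM.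
  - by rewrite mulr_ge0// mulr_ge0// sqr_ge0.
  - by rewrite exprn_ge0// addr_ge0// mulr_ge0// ltW.
  - have -> : (l * N.+1)%:R * (h ^+ 2 * c) = ((l * N.+1)%:R * h) * (h * c) by ring.
    rewrite hNE ler_wpM2r//; first by rewrite mulr_ge0// ltW.
    by apply: ler_wpM2r; [exact: ltW|rewrite ler_nat ltnW].
  - rewrite mulnC exprM lerXn2r ?nnegrE ?expR_ge0 ?exprn_ge0 ?pow ?(ltnW ln)//;
    by rewrite addr_ge0// mulr_ge0// ltW.
have main k l : (l <= k)%N -> (k < n)%N ->
    `|(v^T *m euler_crosscov A C h (k * N.+1) (l * N.+1) *m v) 0 0|
    <= lmax * (p0 * q Delta ^+ (k - l)) + eps.
  move=> lk kn; rewrite /euler_crosscov leq_mul2r lk orbT -mulnBl.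
  set G := euler_step A h ^+ _; set Cl := euler_cov _ _ _ _.
  have -> : (v^T *m (G *m Cl) *m v) 0 0 =
      (v^T *m (G *m (C *m v))) 0 0 + (v^T *m (G *m (Cl - C)) *m v) 0 0.
    rewrite [in X in _ + X]mulmxBr [in X in _ + X]mulmxBr [in X in _ + X]mulmxBl.
    by rewrite [X in _ + X]mxE [X in _ + (_ + X)]mxE addrC !mulmxA subrK.
  apply: (le_trans (ler_normD _ _)).
  have e1 := close l (k - l)%N (leq_ltn_trans lk kn) (leq_trans (leq_subr _ _) (ltnW kn)).
  have e2 : `|(v^T *m (G *m (C *m v))) 0 0| <= lmax * p0 * (q Delta ^+ (k - l) * expR (K * T * h)).
    apply: (le_trans (dot_le_l2norm _ _)); rewrite v1 mul1r.
    apply: (le_trans (contr h _ _ (ltW h0))).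
    have -> : m * h * ((k - l) * N.+1)%:R = m * Delta * (k - l)%:R.
      by rewrite -mulrA [h * _]mulrC hNE; ring.
    have -> : K * h ^+ 2 * ((k - l) * N.+1)%:R = K * ((k - l)%:R * Delta) * h.
      by rewrite -hNE; ring.
    have -> : lmax * p0 * (q Delta ^+ (k - l) * expR (K * T * h)) =
        p0 * (q Delta ^+ (k - l) * expR (K * T * h)) * lmax by ring.
    apply: ler_pM; rewrite ?l2norm_ge0//.
    - by rewrite mulr_ge0// expR_ge0.
    - rewrite ler_wpM2l// expRD /q -expRM_natr mulNr ler_wpM2l ?expR_ge0//.
      rewrite ler_expR ler_wpM2r ?(ltW h0)// ler_wpM2l// ler_wpM2r ?(ltW D0)// ler_nat.
      exact: leq_trans (leq_subr _ _) (ltnW kn).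
    - by have := rayleigh_l2norm_le v Csym hE (ltW lmin0); rewrite v1 mulr1.
  apply: (le_trans (lerD e2 e1)).
  have Q1 : q Delta ^+ (k - l) <= 1.
    have [_ _ _ m0] := hA.
    rewrite exprn_ile1 ?expR_ge0// -expR0 ler_expR lerNl oppr0 mulr_ge0 ?ltW//.
  have E1 : 0 <= expR (K * T * h) - 1.
    by rewrite subr_ge0 -expR0 ler_expR !mulr_ge0// ltW.
  have : lmax * p0 * (q Delta ^+ (k - l) * (expR (K * T * h) - 1))
      <= lmax * p0 * (expR (K * T * h) - 1).
    by apply: ler_wpM2l; [exact: mulr_ge0|exact: ler_piMl].
  move: err_le; rewrite /err; lra.
have le_dist k l : (l <= k)%N -> (k - l + (l - k))%N = (k - l)%N.
  by rewrite -subn_eq0 => /eqP ->; rewrite addn0.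
split; last first.
  move=> ij; rewrite -ij /euler_crosscov leqnn subnn expr0 mul1mx.
  have := close i 0%N iN (leq0n n); rewrite mul0n expr0 mul1mx mulmxBr mulmxBl.
  move: (v^T *m euler_cov _ _ _ _ *m v) (v^T *m C *m v) => U V.
  have -> : (U - V) 0 0 = U 0 0 - V 0 0 by rewrite !mxE.
  move=> h1; apply: (le_trans h1).
  apply: le_trans err_le; rewrite /err lerDr; apply: mulr_ge0; first exact: mulr_ge0.
  by rewrite subr_ge0 -expR0 ler_expR; apply: mulr_ge0 (ltW h0); exact: mulr_ge0.
case/orP: (leq_total j i) => ij.
  by rewrite le_dist//; exact: main.
by rewrite quad_crosscov_sym addnC le_dist//; exact: main.
Qed.

End EulerCovariance.

(** * Exponential moments of the sampled quadratic form *)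

Section ExponentialMoments.
Context (R : realType) (disp : measure_display) (Omega : measurableType disp).
Variable P : probability Omega R.

Let mexpR (g : Omega -> R) : measurable_fun setT g ->
  measurable_fun setT (fun w => (expR (g w))%:E).
Proof.
by move=> mg; apply/measurable_EFinP; apply: measurableT_comp mg; exact: measurable_expR.
Qed.

Lemma fatou_expR (f : nat -> Omega -> R) (g : Omega -> R) (B : \bar R) :
  (forall N, measurable_fun setT (f N)) -> measurable_fun setT g ->
  {ae P, forall w, f N w @[N --> \oo] --> g w} ->
  (\forall N \near \oo, \int[P]_w (expR (f N w))%:E <= B)%E ->
  (\int[P]_w (expR (g w))%:E <= B)%E.
Proof.
move=> mf mg fg fB; pose F N w := (expR (f N w))%:E.
have mF N : measurable_fun setT (F N) by exact: mexpR.
have F0 N w : [set: Omega] w -> (0 <= F N w)%E by rewrite lee_fin expR_ge0.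
have liminfB : (limn_einf (fun N => \int[P]_w F N w) <= B)%E.
  rewrite limn_einf_lim; apply: lime_le; first exact: is_cvg_einfs.
  near=> N; apply: (@le_trans _ _ (\int[P]_w F N w)%E).
    by apply: ereal_inf_lbound; exists N => //=.
  by near: N.
apply: le_trans liminfB; apply: le_trans (fatou P measurableT mF F0).
rewrite le_eqVlt; apply/orP; left; apply/eqP; apply: ge0_ae_eq_integral => //.
- exact: mexpR.
- under eq_fun do rewrite limn_einf_lim.
  apply: (emeasurable_fun_cvg (fun N w => einfs (F ^~ w) N)).
    by move=> N; exact: measurable_fun_einfs.
  by move=> w _; exact: is_cvg_einfs.
- move=> w _; rewrite limn_einf_lim; apply: lime_ge; first exact: is_cvg_einfs.
  by apply: nearW => N; apply: le_ereal_inf_tmp => _ [k /= _ <-]; exact: F0.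
apply: filterS fg => w fgw _.
have cE : F N w @[N --> \oo] --> (expR (g w))%:E.
  apply: cvg_EFin; first exact: nearW.
  exact: (continuous_cvg _ (@continuous_expR R (g w)) fgw).
by have [-> _] := cvg_limn_einf_sup cE.
Unshelve. all: by end_near. Qed.

Lemma chernoff_tail (Z : Omega -> R) (s a b : R) : measurable_fun setT Z -> 0 < s ->
  (\int[P]_w (expR (s * Z w))%:E <= (expR b)%:E)%E ->
  (P [set w | (a < Z w)%R] <= (expR (b - s * a))%:E)%E.
Proof.
move=> mZ s0 H.
pose m := isMeasurableFun.Build _ _ _ _ Z mZ; pose X : {RV P >-> R} := HB.pack Z m.
have := chernoff X a s0.
have -> : ('M_P X s = \int[P]_w (expR (s * Z w))%:E)%E.
  rewrite /mmt_gen_fun unlock; apply: eq_integral => w _ /=.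
  by rewrite mulrC.
move=> h; apply: (@le_trans _ _ (P [set w | (a <= Z w)%R])).
  apply: le_measure; rewrite ?inE/=; last by move=> w /=; exact: ltW.
  - by rewrite -[X in measurable X]setTI; apply: measurable_fun_ltr.
  - by rewrite -[X in measurable X]setTI; apply: measurable_fun_ler.
apply: (le_trans h); rewrite expRD EFinM; apply: lee_pmul => //.
by apply: integral_ge0 => w _; rewrite lee_fin expR_ge0.
Qed.

End ExponentialMoments.

Section SampledProcess.
Variables (R : realType) (d : nat) (disp : measure_display).
Variables (Omega : measurableType disp) (P : probability Omega R).
Variables (F : R -> set (set Omega)) (W X : R -> Omega -> 'cV[R]_d).
Variables (A : 'M[R]_d) (P0 : 'M[R[i]]_d) (tau : 'rV[R[i]]_d) (m lmin lmax : R).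
Hypotheses (hX : stationary_ou P F A W X) (hA : stable_diagonalizable A P0 tau m)
  (hE : extreme_eigenvalues (stationary_cov A) lmin lmax) (lmin0 : 0 < lmin).

Let C := stationary_cov A.
Let Csym : C^T = C. Proof. exact: stationary_cov_sym. Qed.
Let hF : filtration F. Proof. by case: hX. Qed.
Let hB : brownian_motion P F W. Proof. by case: hX. Qed.
Let adX : adapted F X. Proof. by case: hX => _ _ [] . Qed.
Let gX0 : centered_gaussian P (X 0) C. Proof. by case: hX. Qed.
Let psd := stationary_cov_psd hE lmin0.

Lemma ou_form_measurable (u : 'cV[R]_d) t : 0 <= t ->
  measurable_fun setT (fun w => (u^T *m X t w) 0 0).
Proof.
move=> t0 _ B mB; rewrite setTI; have [_ /(_ t t0) + _] := hF; apply.
exact: (adX t0 (borel_vec_linear_form u mB)).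
Qed.

Section UnitVector.
Variables (v : 'cV[R]_d) (Delta : R) (n : nat).
Hypotheses (v1 : l2norm v = 1) (D0 : 0 < Delta) (n0 : (0 < n)%N).

Let h (N : nat) := Delta / N.+1%:R.
Let h0 N : 0 < h N. Proof. exact: divr_gt0. Qed.
Let y (N : nat) (i : 'I_n) (w : Omega) : R := (v^T *m euler W X A (h N) (i * N.+1) w) 0 0.
Let S (N : nat) : 'M[R]_n :=
  \matrix_(i, j) (v^T *m euler_crosscov A C (h N) (i * N.+1) (j * N.+1) *m v) 0 0.

Let my N i : measurable_fun setT (y N i).
Proof. exact: (euler_form_measurable A hF hB adX (h0 N)). Qed.

Let Ssym N : (S N)^T = S N.
Proof. by apply/matrixP => i j; rewrite mxE [LHS]mxE [RHS]mxE; exact: quad_crosscov_sym. Qed.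

Let y_gaussian N (a : 'cV[R]_n) :
  (\int[P]_w (expR (\sum_i a i 0 * y N i w))%:E
     = (expR ((a^T *m S N *m a) 0 0 / 2))%:E)%E /\
  (\int[P]_w (cos (\sum_i a i 0 * y N i w))%:E
     = (expR (- ((a^T *m S N *m a) 0 0 / 2)))%:E)%E.
Proof.
have tm (i : 'I_n) : (i * N.+1 <= n * N.+1)%N by rewrite leq_mul2r ltnW ?orbT.
have := euler_forms_gaussian A hF hB adX gX0 Csym psd (h0 N) (fun i => a i 0 *: v) tm.
have -> : \sum_(i < n) \sum_(j < n) ((a i 0 *: v)^T *m euler_crosscov A C (h N) (i * N.+1) (j * N.+1)
    *m (a j 0 *: v)) 0 0 = (a^T *m S N *m a) 0 0.
  rewrite mxE exchange_big; apply: eq_bigr => j _ /=.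
  rewrite mxE mulr_suml; apply: eq_bigr => i _.
  have -> : (a i 0 *: v)^T = a i 0 *: v^T by exact: linearZ.
  rewrite [S N i j]mxE [a^T 0 i]mxE -?scalemxAl -?scalemxAl -scalemxAr scalerA [LHS]mxE.
  by move: ((v^T *m _ *m v) 0 0) => q; ring.
have E w : \sum_(i < n) ((a i 0 *: v)^T *m euler W X A (h N) (i * N.+1) w) 0 0
    = \sum_i a i 0 * y N i w.
  apply: eq_bigr => i _; have -> : (a i 0 *: v)^T = a i 0 *: v^T by exact: linearZ.
  by rewrite -scalemxAl mxE.
by move=> [<- <-]; split; apply: eq_integral => w _; rewrite -E.
Qed.

Let yexp N a := (y_gaussian N a).1.
Let ycos N a := (y_gaussian N a).2.

(** The value 1 comes from the Cauchy-Schwarz inequality, the other one from the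
   contraction of the flow. *)
Definition decay_corr (k : nat) := Num.min 1 (cond_number P0 * expR (- (m * Delta)) ^+ k).
Let rho (i j : 'I_n) := lmax * decay_corr (i - j + (j - i)).

Let lmax0 : 0 <= lmax.
Proof. by have [[h1 h2] [h3 _]] := hE; exact: le_trans (ltW lmin0) (h2 _ h3). Qed.

Let quad_le : (v^T *m C *m v) 0 0 <= lmax.
Proof. by have := rayleigh_le v Csym hE; rewrite -l2norm_sqr v1 expr1n mulr1. Qed.

Let S_near eps : 0 < eps -> \forall N \near \oo, forall i j,
  `|S N i j| <= rho i j + eps /\ `|S N i i - (v^T *m C *m v) 0 0| <= eps.
Proof.
move=> eps0; have := euler_crosscov_limit hA hE lmin0 n v1 D0 eps0.
apply: filterS => N H.
have diag i : `|S N i i - (v^T *m C *m v) 0 0| <= eps.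
  by rewrite mxE; have [_] := H i i (ltn_ord i) (ltn_ord i); apply.
move=> i j; split=> //.
rewrite /rho /decay_corr minr_pMr// addr_minl le_min mulr1; apply/andP; split.
  have := gaussian_cov_offdiag (my N) (Ssym N) (ycos N) i j.
  have /ler_normlW b1 := diag i; have /ler_normlW b2 := diag j.
  by have := quad_le; lra.
by rewrite mxE; have [] := H i j (ltn_ord i) (ltn_ord j).
Qed.

Let Z w := \sum_(i < n) (v^T *m X (i%:R * Delta) w) 0 0 ^+ 2 - n%:R * (v^T *m C *m v) 0 0.

Let mZ : measurable_fun setT Z.
Proof.
apply: measurable_funB; last exact: measurable_cst.
apply: measurable_sum => i; apply: measurable_funX; apply: ou_form_measurable.
by rewrite mulr_ge0// ltW.
Qed.

Let ZN N w := \sum_i y N i w ^+ 2 - \tr (S N).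

Let mZN N : measurable_fun setT (ZN N).
Proof.
apply: measurable_funB; last exact: measurable_cst.
by apply: measurable_sum => i; apply: measurable_funX.
Qed.

Let tr_cvg : \tr (S N) @[N --> \oo] --> n%:R * (v^T *m C *m v) 0 0.
Proof.
have -> : n%:R * (v^T *m C *m v) 0 0 = \sum_(i < n) (v^T *m C *m v) 0 0.
  by rewrite sumr_const card_ord mulr_natl.
rewrite /mxtrace; apply: (@cvg_big _ _ _ _ _ add_continuous _ \oo _ _ _ _) => i _.
apply/cvgrPdist_le => eps eps0; apply: filterS (S_near eps0) => N /(_ i i)[_].
by rewrite distrC.
Qed.

Let Z_cvg : {ae P, forall w, ZN N w @[N --> \oo] --> Z w}.
Proof.
have [_ _ [_ cX eX] _] := hX.
apply: filterS2 cX eX => w cw ew.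
apply: cvgB; last exact: tr_cvg.
apply: (@cvg_big _ _ _ _ _ add_continuous _ \oo _ _ _ _) => i _.
have yc : y N i w @[N --> \oo] --> (v^T *m X (i%:R * Delta) w) 0 0.
  have E := euler_path_cvg cw ew i D0.
  apply/cvgrPdist_le => eps eps0.
  have c1 : 0 < l1norm v + 1 by rewrite ltr_wpDl ?l1norm_ge0.
  have /cvgr0Pnorm_le/(_ _ (divr_gt0 eps0 c1)) := E.
  apply: filterS => N; rewrite ger0_norm ?l1norm_ge0// => e.
  have -> : (v^T *m X (i%:R * Delta) w) 0 0 - y N i w =
      (v^T *m (X (i%:R * Delta) w - euler W X A (h N) (i * N.+1) w)) 0 0.
    by rewrite mulmxBr [RHS]mxE [X in _ = _ + X]mxE.
  apply: (le_trans (entry_le_l1norm _ _ _)); apply: (le_trans (l1normM _ _)).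
  rewrite l1norm_tr; apply: (@le_trans _ _ ((l1norm v + 1) * (eps / (l1norm v + 1)))).
    by apply: ler_pM; rewrite ?l1norm_ge0// lerDl.
  by rewrite mulrC divfK// gt_eqF.
by rewrite expr2; under eq_fun do rewrite expr2; exact: cvgM.
Qed.

(** The strict inequalities leave room for the error between the covariances of
   the scheme and their limits; the bound obtained for the scheme then passes to
   the limit by the lemma of Fatou. *)
Lemma sampled_chi2_mgf lam0 lam F0 F1 s :
  (forall i, \sum_j rho i j <= lam0) -> lam0 < lam ->
  \sum_i \sum_j rho i j ^+ 2 <= F0 -> F0 < F1 -> 0 <= s ->
  (2 * (s * lam) < 1 ->
    (\int[P]_w (expR (s * Z w))%:E <= (expR (s ^+ 2 * F1 / (1 - 2 * (s * lam))))%:E)%E) /\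
  (\int[P]_w (expR (- s * Z w))%:E <= (expR (s ^+ 2 * F1))%:E)%E.
Proof.
move=> rows lam01 frob F01 s0.
have rho0 i j : 0 <= rho i j.
  apply: mulr_ge0 => //; rewrite le_min ler01 mulr_ge0 ?exprn_ge0 ?expR_ge0//.
  by apply: le_trans (stable_cond_number_ge1 hA).
(* Row sums change by at most n eps, and the sum of squares by at most
   n^2 (2 lmax + 1) eps when eps <= 1. *)
pose eps := Num.min 1 (Num.min ((lam - lam0) / n%:R) ((F1 - F0) / (n%:R ^+ 2 * (2 * lmax + 1)))).
have nR : 0 < n%:R :> R by rewrite ltr0n.
have l1 : 0 < 2 * lmax + 1 by have := lmax0; lra.
have eps0 : 0 < eps.
  by rewrite !lt_min ltr01 !divr_gt0 ?subr_gt0 ?mulr_gt0 ?exprn_gt0.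
have eps1 : eps <= 1 by rewrite ge_min lexx.
have eps2 : n%:R * eps <= lam - lam0.
  by rewrite mulrC -ler_pdivlMr// !ge_min lexx ?orbT.
have eps3 : n%:R ^+ 2 * (2 * lmax + 1) * eps <= F1 - F0.
  by rewrite mulrC -ler_pdivlMr ?mulr_gt0 ?exprn_gt0// !ge_min lexx ?orbT.
have bounds : \forall N \near \oo, (forall i, \sum_j `|S N i j| <= lam) /\
    \sum_i \sum_j S N i j ^+ 2 <= F1.
  apply: filterS (S_near eps0) => N H; split=> [i|].
    apply: (@le_trans _ _ (\sum_j (rho i j + eps))).
      by apply: ler_sum => j _; have [] := H i j.
    rewrite big_split/= sumr_const card_ord -[eps *+ n]mulr_natl.
    by have := rows i; lra.
  apply: (@le_trans _ _ (\sum_i \sum_j (rho i j ^+ 2 + (2 * lmax + 1) * eps))).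
    apply: ler_sum => i _; apply: ler_sum => j _; have [Hij _] := H i j.
    have r0 := rho0 i j.
    have rl : rho i j <= lmax by rewrite /rho ler_piMr// ge_min lexx.
    rewrite -real_normK ?num_real//; apply: (@le_trans _ _ ((rho i j + eps) ^+ 2)).
      by rewrite lerXn2r ?nnegrE// addr_ge0// ltW.
    nra.
  under eq_bigr do rewrite big_split/= sumr_const card_ord.
  rewrite big_split/= sumr_const card_ord -mulrnA -[_ *+ (n * n)]mulr_natl natrM.
  by have := frob; move: eps3; rewrite expr2 mulrA; lra.
split=> [slam|].
  apply: (fatou_expR (f := fun N w => s * ZN N w)).
  - by move=> N; apply: measurable_funM => //; exact: measurable_cst.
  - by apply: measurable_funM => //; exact: measurable_cst.
  - by apply: filterS Z_cvg => w; exact: cvgMr.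
  apply: filterS bounds => N [Brow Bfrob].
  have [/(_ slam) mgf _] := gaussian_chi2_mgf (my N) (Ssym N) (yexp N) (ycos N) Brow s0.
  apply: (le_trans mgf); rewrite lee_fin ler_expR ler_wpM2r ?invr_ge0 ?subr_ge0 ?(ltW slam)//.
  by rewrite ler_wpM2l ?sqr_ge0.
apply: (fatou_expR (f := fun N w => - s * ZN N w)).
- by move=> N; apply: measurable_funM => //; exact: measurable_cst.
- by apply: measurable_funM => //; exact: measurable_cst.
- by apply: filterS Z_cvg => w; exact: cvgMr.
apply: filterS bounds => N [Brow Bfrob].
have [_ mgf] := gaussian_chi2_mgf (my N) (Ssym N) (yexp N) (ycos N) Brow s0.
by apply: (le_trans mgf); rewrite lee_fin ler_expR ler_wpM2l ?sqr_ge0.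
Qed.

End UnitVector.

End SampledProcess.

(** * Geometric sums of correlations *)

Section GeometricSums.
Variable R : realType.

Lemma expR_ge_quadratic (u : R) : 0 <= u -> 1 + u + u ^+ 2 / 2 <= expR u.
Proof.
move=> u0; pose g (t : R) := expR t - (t + 2^-1 * (t * t)).
have dg (t : R) : is_derive t 1 g (expR t - (1 + t)).
  have E : is_derive t 1 g (expR t - (1 + 2^-1 * (t * 1 + t * 1))).
    exact: is_deriveB (is_derive_expR t) (is_deriveD (is_derive_id t 1)
      (is_deriveZ 2^-1 (is_deriveM (is_derive_id t 1) (is_derive_id t 1)))).
  by have -> : 1 + t = 1 + 2^-1 * (t * 1 + t * 1) by field.
have g'0 (t : R) : 0 <= t -> 0 <= expR t - (1 + t) by rewrite subr_ge0 expR_ge1Dx.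
by have := ge0_derive_le dg g'0 u0; rewrite /g expR0 !mulr0; lra.
Qed.

(** The sum is at most 1 / (1 - exp (- u)), and exp u >= 1 + u + u^2 / 2.  The
   correction - 1 / (2 + u) to the leading term 1 / u leaves the strict room
   needed for small u. *)
Lemma geo_sum_le (u : R) n : 0 < u ->
  \sum_(k < n) expR (- u) ^+ k <= 1 + u^-1 - (2 + u)^-1.
Proof.
move=> u0; set q := expR (- u); have q0 : 0 < q by exact: expR_gt0.
have qE : q * expR u = 1 by rewrite /q -expRD addrC subrr expR0.
have E := expR_ge_quadratic (ltW u0).
have q1 : q < 1 by rewrite /q -expR0 ltr_expR oppr_lt0.
have geo : (\sum_(k < n) q ^+ k) * (1 - q) <= 1.
  have := subrX1 q n => e.
  have -> : (\sum_(k < n) q ^+ k) * (1 - q) = 1 - q ^+ n by rewrite -[RHS]opprB e; ring.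
  by rewrite gerBl exprn_ge0 ?ltW.
have B : 1 <= (1 + u^-1 - (2 + u)^-1) * (1 - q).
  have D0 : 0 < u + u ^+ 2 / 2 by rewrite addr_gt0// divr_gt0 ?exprn_gt0.
  have -> : 1 + u^-1 - (2 + u)^-1 = (1 + u + u ^+ 2 / 2) / (u + u ^+ 2 / 2).
    have u2 : 2 + u != 0 by rewrite gt_eqF// addr_gt0.
    have un : u != 0 by rewrite gt_eqF.
    field; rewrite un u2 /=; apply/andP; split => //.
    by rewrite gt_eqF// addr_gt0 ?mulr_gt0 ?exprn_gt0.
  rewrite mulrAC ler_pdivlMr// mul1r.
  have : q * (1 + u + u ^+ 2 / 2) <= 1 by rewrite -[leRHS]qE; apply: ler_wpM2l; first exact: ltW.
  lra.
rewrite -(@ler_pM2r _ (1 - q)) ?subr_gt0//; exact: le_trans geo B.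
Qed.

(** On a row of an n by n matrix each distance k > 0 occurs at most twice. *)
Lemma dist_row_sum_le (f : nat -> R) (p q : R) n (i : 'I_n) :
  (forall k, 0 <= f k) -> f 0%N <= 1 -> (forall k, f k <= p * q ^+ k) ->
  \sum_(j < n) f (i - j + (j - i))%N <= 1 + 2 * p * (\sum_(k < n) q ^+ k - 1).
Proof.
move=> f0 f1 fp; case: n i => [[]//|n] i.
have tail : \sum_(k < n) f k.+1 <= p * (\sum_(k < n.+1) q ^+ k - 1).
  rewrite big_ord_recl expr0 addrC addKr mulr_sumr; apply: ler_sum => k _; exact: fp.
have mono a b : (a <= b)%N -> \sum_(k < a) f k.+1 <= \sum_(k < b) f k.+1.
  move=> ab; rewrite -!(big_mkord xpredT (fun k => f k.+1)) [leRHS](big_cat_nat (n := a))//=.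
  by rewrite lerDl sumr_ge0.
have li : (i <= n)%N by rewrite -ltnS.
rewrite -(big_mkord xpredT (fun j => f (i - j + (j - i))%N)) (big_cat_nat (n := i))//=; last exact: ltnW.
have -> : \sum_(0 <= j < i) f (i - j + (j - i))%N = \sum_(k < i) f k.+1.
  rewrite big_nat_rev big_mkord; apply: eq_bigr => j _; congr f.
  by have := ltn_ord j; lia.
have -> : \sum_(i <= j < n.+1) f (i - j + (j - i))%N = f 0%N + \sum_(k < n - i) f k.+1.
  rewrite -[X in \sum_(X <= _ < _) _]add0n big_addn subSn// big_mkord big_ord_recl.
  by congr (f _ + _); [rewrite /= add0n subnn|apply: eq_bigr => j _; congr f; rewrite lift0; lia].
have := mono _ _ li; have := mono _ _ (leq_subr i n).
lra.
Qed.

End GeometricSums.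

(** * The deviation inequality *)

Section Deviation.
Variables (R : realType) (d : nat) (disp : measure_display).
Variables (Omega : measurableType disp) (P : probability Omega R).
Variables (F : R -> set (set Omega)) (W X : R -> Omega -> 'cV[R]_d).
Variables (A : 'M[R]_d) (P0 : 'M[R[i]]_d) (tau : 'rV[R[i]]_d) (m lmin lmax : R).
Hypotheses (hX : stationary_ou P F A W X) (hA : stable_diagonalizable A P0 tau m)
  (hE : extreme_eigenvalues (stationary_cov A) lmin lmax) (lmin0 : 0 < lmin).

Lemma empirical_form (v : 'cV[R]_d) T n w : (0 < n)%N ->
  (v^T *m (empirical_cov X T n w - stationary_cov A) *m v) 0 0 =
  n%:R^-1 * (\sum_(i < n) (v^T *m X (i%:R * (T / n%:R)) w) 0 0 ^+ 2
             - n%:R * (v^T *m stationary_cov A *m v) 0 0).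
Proof.
move=> n0; have nn : n%:R != 0 :> R by rewrite pnatr_eq0 -lt0n.
rewrite mulrBr mulrA mulVf// mul1r mulmxBr mulmxBl.
move: (stationary_cov A) => C; rewrite [LHS]mxE [X in _ + X]mxE; congr (_ - _).
rewrite /empirical_cov -scalemxAr -scalemxAl mxE; congr (_ * _).
rewrite big_add1 big_mkord mulmx_sumr mulmx_suml summxE; apply: eq_bigr => i _ /=.
move: (X _ w) => x.
have -> : v^T *m (x *m x^T) *m v = (v^T *m x) *m (v^T *m x)^T.
  by rewrite trmx_mul trmxK !mulmxA.
by rewrite mxE big_ord1 [X in _ * X]mxE expr2.
Qed.

(** Chernoff bounds for both signs, with the exponent s = x / (2 K): it satisfies
   1 - 2 s lam = F / K when F + lam x = K. *)
Theorem deviation_bound (T : R) (n : nat) (x lam0 F0 K : R) :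
  0 < T -> (0 < n)%N -> 0 < x ->
  let rho (i j : 'I_n) := lmax * decay_corr P0 m (T / n%:R) (i - j + (j - i)) in
  0 <= lam0 -> 0 <= F0 -> (forall i, \sum_j rho i j <= lam0) ->
  (forall i, \sum_j rho i j ^+ 2 <= F0) -> F0 + lam0 * x < K ->
  (sup_deviation P A X T n x <= (2 * expR (- (n%:R * x ^+ 2 / (4 * K))))%:E)%E.
Proof.
move=> T0 n0 x0 rho l0 f0 rows frob FK.
have nR : 0 < n%:R :> R by rewrite ltr0n.
have D0 : 0 < T / n%:R by rewrite divr_gt0.
(* The gap in F0 + lam0 * x < K is spread so that F1 + lam * x = K. *)
pose del := (K - (F0 + lam0 * x)) / (1 + x).
have x1 : 0 < 1 + x by rewrite addr_gt0.
have del0 : 0 < del by rewrite divr_gt0// subr_gt0.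
pose lam := lam0 + del; pose F1 := F0 + del.
have KE : F1 + lam * x = K.
  have : del * (1 + x) = K - (F0 + lam0 * x) by rewrite divfK// gt_eqF.
  by rewrite /F1 /lam; lra.
have K0 : 0 < K by apply: le_lt_trans FK; rewrite addr_ge0// mulr_ge0// ltW.
have F10 : 0 < F1 by rewrite ltr_wpDl.
have lam_gt0 : 0 < lam by rewrite ltr_wpDl.
apply: ge_ereal_sup => _ [v v1 <-].
pose Z w := \sum_(i < n) (v^T *m X (i%:R * (T / n%:R)) w) 0 0 ^+ 2
             - n%:R * (v^T *m stationary_cov A *m v) 0 0.
have mZ : measurable_fun setT Z.
  apply: measurable_funB; last exact: measurable_cst.
  apply: measurable_sum => i; apply: measurable_funX; apply: (ou_form_measurable hX).
  by rewrite mulr_ge0// ltW.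
have mNZ : measurable_fun setT (fun w => - Z w) by exact: measurable_funN.
pose s := x / (2 * K).
have s0 : 0 < s by rewrite divr_gt0 ?mulr_gt0.
have frobn : \sum_i \sum_j rho i j ^+ 2 <= n%:R * F0.
  apply: (@le_trans _ _ (\sum_(i < n) F0)); first by apply: ler_sum => i _; exact: frob.
  by rewrite sumr_const card_ord mulr_natl.
have F01 : n%:R * F0 < n%:R * F1 by rewrite ltr_pM2l// ltrDl.
have lam01 : lam0 < lam by rewrite ltrDl.
have [up dn] := sampled_chi2_mgf hX hA hE lmin0 v1 D0 n0 rows lam01 frobn F01 (ltW s0).
have sK : 1 - 2 * (s * lam) = F1 / K.
  have -> : F1 = K - lam * x by rewrite -KE addrK.
  by rewrite /s; field; rewrite gt_eqF.
have slam : 2 * (s * lam) < 1 by rewrite -subr_gt0 sK divr_gt0.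
have {}up := chernoff_tail (n%:R * x) mZ s0 (up slam).
have {}dn : (P [set w | (n%:R * x < - Z w)%R] <= (expR (s ^+ 2 * (n%:R * F1) - s * (n%:R * x)))%:E)%E.
  apply: (chernoff_tail _ mNZ s0); apply: le_trans dn.
  by under eq_integral do rewrite mulrN -mulNr.
have e1 : s ^+ 2 * (n%:R * F1) / (1 - 2 * (s * lam)) - s * (n%:R * x) = - (n%:R * x ^+ 2 / (4 * K)).
  by rewrite sK /s; field; rewrite !gt_eqF.
have e2 : s ^+ 2 * (n%:R * F1) - s * (n%:R * x) <= - (n%:R * x ^+ 2 / (4 * K)).
  rewrite -e1 lerD2r; apply: ler_peMr.
    by apply: mulr_ge0; [exact: sqr_ge0|apply: mulr_ge0; exact: ltW].
  by rewrite sK invf_div ler_pdivlMr// mul1r -KE lerDl mulr_ge0// ltW.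
rewrite e1 in up.
have mU : measurable [set w | (n%:R * x < Z w)%R].
  by rewrite -[X in measurable X]setTI; apply: measurable_fun_ltr.
have mD : measurable [set w | (n%:R * x < - Z w)%R].
  by rewrite -[X in measurable X]setTI; apply: measurable_fun_ltr.
have -> : [set w | x < `|(v^T *m (empirical_cov X T n w - stationary_cov A) *m v) 0 0|]
   = [set w | (n%:R * x < Z w)%R] `|` [set w | (n%:R * x < - Z w)%R].
  apply/funext => w; apply/propext; rewrite /= empirical_form// -/(Z w).
  rewrite normrM gtr0_norm ?invr_gt0// mulrC ltr_pdivlMr// mulrC ltr_normr.
  by split=> /orP.
apply: (le_trans (measureU2 _ mU mD)).
rewrite mulr2n mulrDl mul1r EFinD; apply: leeD => //.
by apply: (le_trans dn); rewrite lee_fin ler_expR.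
Qed.

End Deviation.

Section CorrelationDecay.
Variables (R : realType) (d : nat) (P0 : 'M[R[i]]_d) (m lmax Delta : R) (n : nat).
Let p0 := cond_number P0.
Let q := expR (- (m * Delta)).
Hypotheses (p1 : 1 <= p0) (lmax0 : 0 < lmax).

Let q0 : 0 <= q. Proof. exact: expR_ge0. Qed.
Let p00 : 0 <= p0. Proof. exact: le_trans p1. Qed.

Let corr_ge0 k : 0 <= decay_corr P0 m Delta k.
Proof. by rewrite le_min ler01 mulr_ge0// exprn_ge0. Qed.

Let corr_le1 k : decay_corr P0 m Delta k <= 1.
Proof. by rewrite ge_min lexx. Qed.

Let corr_le k : decay_corr P0 m Delta k <= p0 * q ^+ k.
Proof. by rewrite ge_min lexx orbT. Qed.

Let rho (i j : 'I_n) := lmax * decay_corr P0 m Delta (i - j + (j - i)).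

Lemma corr_row_sum i :
  \sum_j rho i j <= lmax * (1 + 2 * p0 * (\sum_(k < n) q ^+ k - 1)).
Proof.
rewrite -mulr_sumr; apply: ler_wpM2l; first exact: ltW.
exact: (dist_row_sum_le i corr_ge0 (corr_le1 0) corr_le).
Qed.

(** The entries are at most lmax, so squares are at most lmax times entries. *)
Lemma corr_row_frob i :
  \sum_j rho i j ^+ 2 <= lmax * (lmax * (1 + 2 * p0 * (\sum_(k < n) q ^+ k - 1))).
Proof.
apply: le_trans (ler_wpM2l (ltW lmax0) (corr_row_sum i)); rewrite mulr_sumr.
apply: ler_sum => j _; rewrite expr2 /rho; apply: ler_wpM2r.
  by rewrite mulr_ge0// ltW.
by rewrite ler_piMr// ltW.
Qed.

(** For a condition number equal to one the squared correlations again decay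
   geometrically, at twice the rate. *)
Lemma corr_row_frob_normal i : p0 = 1 ->
  \sum_j rho i j ^+ 2 <= lmax ^+ 2 * (1 + 2 * 1 * (\sum_(k < n) (q ^+ 2) ^+ k - 1)).
Proof.
move=> pE; rewrite /rho; under eq_bigr do rewrite exprMn.
rewrite -mulr_sumr; apply: ler_wpM2l; first exact: sqr_ge0.
apply: (dist_row_sum_le (f := fun k => decay_corr P0 m Delta k ^+ 2)) => [k||k].
- exact: sqr_ge0.
- by rewrite exprn_ile1.
rewrite mul1r -exprM mulnC exprM lerXn2r ?nnegrE ?exprn_ge0//.
by have := corr_le k; rewrite pE mul1r.
Qed.

End CorrelationDecay.

Theorem proposition3p3 (R : realType) (d : nat) (disp : measure_display)
    (Omega : measurableType disp) (P : probability Omega R)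
    (F : R -> set (set Omega)) (W X : R -> Omega -> 'cV[R]_d)
    (A0 : 'M[R]_d) (P0 : 'M[R[i]]_d) (tau : 'rV[R[i]]_d) (m lmin lmax : R)
    (hX : stationary_ou P F A0 W X)
    (hA : stable_diagonalizable A0 P0 tau m)
    (hB_nondeg : stationary_cov A0 \in unitmx)
    (hB_eig : extreme_eigenvalues (stationary_cov A0) lmin lmax)
    (hB_pos : 0 < lmin) (hB_lt : lmin < lmax) :
  let p0 := cond_number P0 in
  let H0 x := m / (8 * p0 * lmax) * (x ^+ 2 / (x + lmax)) in
  (forall (T : R) (n : nat) (x : R), 0 < T -> (0 < n)%N -> 0 < x ->
     let Delta := T / n%:R in
     (sup_deviation P A0 X T n x <=
      (2 * expR (- (x ^+ 2 * n%:R * (1 - expR (- (m * Delta)))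
                    * (x + lmax)^-1
                    / (8 * p0 * lmax
                       * (1 - expR (- (n.+1%:R * m * Delta)))))))%:E)%E)
  /\
  (forall (T : nat -> R) (x : R), (forall n, 0 < T n) ->
     (T n / n%:R @[n --> \oo] --> 0) -> 0 < x ->
     \forall n \near \oo,
       let Delta := T n / n%:R in
       (sup_deviation P A0 X (T n) n x
        <= (2 * expR (- (n%:R * Delta * H0 x)))%:E)%E).
Proof.
move=> p0 H0.
have p1 : 1 <= p0 by exact: stable_cond_number_ge1 hA.
have p00 : 0 < p0 by exact: lt_le_trans p1.
have l0 : 0 < lmax by exact: lt_trans hB_lt.
have [_ _ _ m0] := hA.
have G1 (q : R) n : 0 <= q -> (0 < n)%N -> 1 <= \sum_(k < n) q ^+ k.
  by case: n => // n q0 _; rewrite big_ord_recl expr0 lerDl sumr_ge0// => k _; rewrite exprn_ge0.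
have lam_ge0 (q : R) n : 0 <= q -> (0 < n)%N ->
    0 <= lmax * (1 + 2 * p0 * (\sum_(k < n) q ^+ k - 1)).
  move=> q0 n0; rewrite mulr_ge0 ?(ltW l0)// addr_ge0// mulr_ge0 ?subr_ge0 ?G1//.
  by rewrite mulr_ge0// ltW.
split.
  move=> T n x T0 n0 x0; cbv zeta; set Delta := T / n%:R; set q := expR (- (m * Delta)).
  have nR : 0 < n%:R :> R by rewrite ltr0n.
  have D0 : 0 < Delta by rewrite divr_gt0.
  have q0 : 0 <= q by exact: expR_ge0.
  have q1 : 0 < 1 - q by rewrite subr_gt0 -expR0 ltr_expR oppr_lt0 mulr_gt0.
  set G := \sum_(k < n) q ^+ k.
  have GS : G * (1 - q) <= 1 - q ^+ n.+1.
    have := subrX1 q n; rewrite -/G => e.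
    have -> : G * (1 - q) = 1 - q ^+ n by rewrite -[RHS]opprB e; ring.
    rewrite lerD2l lerN2 exprS ler_piMl ?exprn_ge0//; lra.
  have -> : expR (- (n.+1%:R * m * Delta)) = q ^+ n.+1.
    by rewrite /q -expRM_natl mulrN -[n.+1%:R * m * _]mulrA.
  have Q1 : 0 < 1 - q ^+ n.+1 by apply: lt_le_trans GS; rewrite mulr_gt0// (lt_le_trans ltr01 (G1 _ _ q0 n0)).
  set S := (1 - q ^+ n.+1) / (1 - q).
  have GS' : G <= S by rewrite ler_pdivlMr.
  have S0 : 0 < S by rewrite divr_gt0.
  pose K := 2 * p0 * lmax * S * (x + lmax).
  have lx : 0 < x + lmax by rewrite addr_gt0.
  have := @deviation_bound _ _ _ _ _ _ _ _ _ _ _ _ _ _ hX hA hB_eig hB_pos T n x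
    _ _ K T0 n0 x0 (lam_ge0 q n q0 n0) (mulr_ge0 (ltW l0) (lam_ge0 q n q0 n0))
    (corr_row_sum m _ p1 l0) (corr_row_frob m _ p1 l0).
  have e : n%:R * x ^+ 2 / (4 * K) = x ^+ 2 * n%:R * (1 - q) * (x + lmax)^-1 /
      (8 * p0 * lmax * (1 - q ^+ n.+1)).
    by rewrite /K /S; field; rewrite !gt_eqF.
  rewrite e; apply; rewrite -/q -/G.
  set L := lmax * _; have -> : lmax * L + L * x = L * (x + lmax) by ring.
  rewrite /K ltr_pM2r// /L; have -> : 2 * p0 * lmax * S = lmax * (2 * p0 * S) by ring.
  by rewrite ltr_pM2l//; have := ler_wpM2l (ltW p00) GS'; lra.
move=> T x T0 Tn x0; have lx : 0 < x + lmax by rewrite addr_gt0.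
have u_small c : 0 < c -> \forall n \near \oo, m * (T n / n%:R) < c.
  move=> c0; have uT : m * (T n / n%:R) @[n --> \oo] --> 0.
    by rewrite -[X in _ --> X](mulr0 m); exact: cvgMr.
  have /cvgr0Pnorm_lt/(_ _ c0) := uT.
  by apply: filterS => n; exact: le_lt_trans (ler_norm _).
have reduce n (lam0 F1 : R) : (0 < n)%N -> 0 <= lam0 -> 0 <= F1 ->
    (forall i : 'I_n, \sum_(j < n) lmax * decay_corr P0 m (T n / n%:R) (i - j + (j - i)) <= lam0) ->
    (forall i : 'I_n, \sum_(j < n) (lmax * decay_corr P0 m (T n / n%:R) (i - j + (j - i))) ^+ 2 <= F1) ->
    F1 + lam0 * x < 2 * p0 * lmax / (m * (T n / n%:R)) * (x + lmax) ->
    (sup_deviation P A0 X (T n) n x <= (2 * expR (- (n%:R * (T n / n%:R) * H0 x)))%:E)%E.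
  move=> n0 lam0_ge0 F1_ge0 rows frob FK.
  have D0 : 0 < T n / n%:R by rewrite divr_gt0 ?ltr0n.
  have := @deviation_bound _ _ _ _ _ _ _ _ _ _ _ _ _ _ hX hA hB_eig hB_pos (T n) n x
    _ _ _ (T0 n) n0 x0 lam0_ge0 F1_ge0 rows frob FK.
  set D := T n / n%:R in D0 *.
  have -> : n%:R * x ^+ 2 / (4 * (2 * p0 * lmax / (m * D) * (x + lmax))) = n%:R * D * H0 x.
    by rewrite /H0; field; rewrite !gt_eqF.
  by [].
have geo (u : R) n : 0 < u -> \sum_(k < n) expR (- u) ^+ k - 1 <= u^-1 - (2 + u)^-1.
  by move=> u0; have := geo_sum_le n u0; lra.
case: (ltP 1 p0) => [p_gt1|p_le1].
  (* The diagonal contributes 1 instead of p0, which is enough once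
     u < 2 (p0 - 1), where u = m Delta. *)
  have c0 : 0 < 2 * (p0 - 1) by rewrite mulr_gt0// subr_gt0.
  near=> n; cbv zeta.
  have n0 : (0 < n)%N by near: n; exact: nbhs_infty_gt.
  have uc : m * (T n / n%:R) < 2 * (p0 - 1) by near: n; exact: u_small.
  have u0 : 0 < m * (T n / n%:R) by rewrite mulr_gt0 ?divr_gt0 ?ltr0n.
  have l1 := lam_ge0 _ n (expR_ge0 (- (m * (T n / n%:R)))) n0.
  apply: (reduce n _ _ n0 l1 (mulr_ge0 (ltW l0) l1) (corr_row_sum m _ p1 l0) (corr_row_frob m _ p1 l0)).
  have := geo _ n u0; move: uc u0; set u := m * _ => uc u0.
  set G := \sum_(k < n) _ => Gu.
  set L := lmax * _; have -> : lmax * L + L * x = L * (x + lmax) by ring.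
  rewrite ltr_pM2r// /L; have -> : 2 * p0 * lmax / u = lmax * (2 * p0 / u) by ring.
  rewrite ltr_pM2l//; have := ler_wpM2l (ltW p00) Gu.
  have : 1 < 2 * p0 * (2 + u)^-1 by rewrite ltr_pdivlMr ?addr_gt0//; lra.
  lra.
(* Now the room comes from the squared correlations, of order lmax^2 / u where
   K contains 2 lmax^2 / u. *)
have pE : p0 = 1 by apply/eqP; rewrite eq_le p_le1.
have c0 : 0 < lmax / (x + lmax) by rewrite divr_gt0.
near=> n; cbv zeta.
have n0 : (0 < n)%N by near: n; exact: nbhs_infty_gt.
have uc : m * (T n / n%:R) < lmax / (x + lmax) by near: n; exact: u_small.
have u0 : 0 < m * (T n / n%:R) by rewrite mulr_gt0 ?divr_gt0 ?ltr0n.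
have l1 := lam_ge0 _ n (expR_ge0 (- (m * (T n / n%:R)))) n0.
have f0 : 0 <= lmax ^+ 2 * (1 + 2 * 1 * (\sum_(k < n) (expR (- (m * (T n / n%:R))) ^+ 2) ^+ k - 1)).
  by rewrite mulr_ge0 ?sqr_ge0// addr_ge0// mulr_ge0// subr_ge0 G1// exprn_ge0 ?expR_ge0.
apply: (reduce n _ _ n0 l1 f0 (corr_row_sum m _ p1 l0)).
  by move=> i; exact: (corr_row_frob_normal m lmax _ p1 i pE).
have := geo _ n u0; move: uc u0; set u := m * _ => uc u0.
have -> : expR (- u) ^+ 2 = expR (- (2 * u)) by rewrite -expRM_natl mulrN.
have u2 : 0 < 2 * u by rewrite mulr_gt0.
have := geo _ n u2; set G2 := \sum_(k < n) _; set G := \sum_(k < n) _ => G2u Gu.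
rewrite pE.
have i1 : 1 - 2 * (2 + u)^-1 <= u.
  have -> : 1 - 2 * (2 + u)^-1 = u / (2 + u) by field; rewrite gt_eqF// addr_gt0.
  by rewrite ler_piMr ?(ltW u0)// invf_le1 ?addr_gt0//; lra.
have i2 : 1 + 2 * ((2 * u)^-1 - (2 + 2 * u)^-1) <= u^-1 + u.
  have -> : 1 + 2 * ((2 * u)^-1 - (2 + 2 * u)^-1) = u^-1 + u / (1 + u).
    by field; rewrite !gt_eqF// ?addr_gt0// mulr_gt0.
  by rewrite lerD2l ler_piMr ?(ltW u0)// invf_le1 ?addr_gt0//; lra.
have h1 : lmax ^+ 2 * (1 + 2 * 1 * (G2 - 1)) <= lmax ^+ 2 * (u^-1 + u).
  by rewrite ler_wpM2l ?sqr_ge0//; lra.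
have h2 : lmax * (1 + 2 * 1 * (G - 1)) * x <= lmax * (2 * u^-1 + u) * x.
  by rewrite ler_wpM2r ?(ltW x0)// ler_wpM2l ?(ltW l0)//; lra.
apply: (le_lt_trans (lerD h1 h2)).
have u1 : u < 1.
  by apply: lt_le_trans uc _; rewrite ler_pdivrMr// mul1r lerDr ltW.
have uinv : 1 <= u^-1 by rewrite invf_ge1// ltW.
have h3 : u * (x + lmax) < lmax * u^-1.
  by rewrite ltr_pdivlMr// in uc; apply: lt_le_trans uc _; rewrite ler_peMr// ltW.
rewrite -(ltr_pM2l l0) in h3.
lra.
Unshelve. all: by end_near. Qed.
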